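(* Let $X\neq L^\infty$ be a rearrangement invariant (r.i.) space on $[0,1]$. The following conditions are equivalent. (a) The space $[\mathcal{C},X]$ is order isomorphic to an AL-space. (b) The spaces $L^1(m_X)$ and $L^1(|m_X|)$ are order isomorphic via the natural inclusion $L^1(|m_X|)\subseteq L^1(m_X)$ (written $L^1(m_X)\simeq L^1(|m_X|)$). (c) The function $y\mapsto\|F_y\|_X$, where $F_y(x):=\frac1x\chi_{[y,1]}(x)$ for $0<x\le1$ (defined for a.e. $y\in[0,1]$), belongs to the associate space $[\mathcal{C},X]'$. If any one of these conditions holds, then $[\mathcal{C},X]=L^1(m_X)\simeq L^1(|m_X|)$.
   Context: $\lambda$ is Lebesgue measure on $[0,1]$, $\mathcal{M}$ the $\sigma$-algebra of Lebesgue measurable subsets of $[0,1]$, $f^*$ the decreasing rearrangement of a measurable function $f$ on $[0,1]$ (right-continuous inverse of $\tau\mapsto\lambda(\{|f|>\tau\})$). Functions are real-valued. A Banach function space (B.f.s.) $X$ on $[0,1]$ is a Banach space of ($\lambda$-a.e. classes of) measurable functions on $[0,1]$ such that $g\in X$ and $\|g\|_X\le\|f\|_X$ whenever $f\in X$ and $|g|\le|f|$ a.e. A r.i. space is a B.f.s. on $[0,1]$ such that if $g^*\le f^*$ and $f\in X$ then $g\in X$ and $\|g\|_X\le\|f\|_X$. Every r.i. space satisfies $L^\infty\subseteq X\subseteq L^1$. The Fatou property is not assumed. The associate space $Y'$ of a B.f.s. $Y$ consists of all measurable $g$ with $\int_0^1|f(t)g(t)|\,dt<\infty$ for every $f\in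 Y$. An AL-space is a Banach lattice in which the norm is additive over disjoint functions (elements). Order isomorphic means isomorphic via a linear lattice isomorphism that is a homeomorphism (not necessarily isometric). The Cesàro operator is $\mathcal{C}(f)(x):=\frac1x\int_0^x f(t)\,dt$. The Cesàro space is the B.f.s. $[\mathcal{C},X]:=\{f:\mathcal{C}(|f|)\in X\}$ with norm $\|f\|_{[\mathcal{C},X]}:=\|\mathcal{C}(|f|)\|_X$. The set function $m_X\colon\mathcal{M}\to X$, $m_X(A):=\mathcal{C}(\chi_A)$, is a $\sigma$-additive vector measure with the same null sets as $\lambda$. Its variation is $|m_X|(A)=\sup\sum_i\|m_X(A_i)\|_X$, the supremum over finite measurable partitions $(A_i)$ of $A$; it is a $\sigma$-finite positive measure, and $L^1(|m_X|)$ is its usual $L^1$-space. For a vector measure $m\colon\mathcal{M}\to X$ and $x^*\in X^*$ let $x^*m(A)=\langle m(A),x^*\rangle$, with variation $|x^*m|$. A measurable $f$ is $m$-integrable if $f\in L^1(|x^*m|)$ for all $x^*\in X^*$ and for each $A\in\mathcal{M}$ there is $\int_A f\,dm\in X$ with $\langle\int_A f\,dm,x^*\rangle=\int_A f\,d(x^*m)$ for all $x^*\in X^*$. $L^1(m)$ is the Banach lattice of (classes modulo $m$-null sets of) $m$-integrable functions with norm $\|f\|_{L^1(m)}=\sup_{\|x^*\|\le1}\int|f|\,d|x^*m|$. One always has $L^1(|m|)\subseteq L^1(m)$. *)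

(* Defs.v *)
From HB Require Import structures.
From mathcomp Require Import all_boot all_order all_algebra.
From mathcomp Require Import all_classical all_reals all_analysis.

Set Implicit Arguments.
Unset Strict Implicit.
Unset Printing Implicit Defensive.
Import Order.TTheory GRing.Theory Num.Theory.
Import numFieldNormedType.Exports.

Local Open Scope classical_set_scope.
Local Open Scope ring_scope.

(* The real line with the Lebesgue (not merely Borel) measurable sets: this is
   the carrier on which the library defines [completed_lebesgue_measure], and
   it is convertible to R.  Functions on [0,1] are represented by functions on
   the whole line whose values off [0,1] are never looked at. *)
Notation lebT R := (caratheodory_type ((@wlength R idfun)^*)%mu).
Notation lam := completed_lebesgue_measure.

Definition I01 (R : realType) : set (lebT R) := [set x | 0 <= (x : R) <= 1].
Arguments I01 {R}.

Definition ae_eq01 (R : realType) (f g : lebT R -> R) : Prop :=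
  {ae lam, forall x, I01 x -> f x = g x}.

(** * Normed lattices presented by representatives *)

(* A normed vector lattice given by a vector space [nl_sort], the vectors
   [nl_car] representing its elements, the relation [nl_eq] of representing the
   same element, the lattice operations and the norm.  Spaces of classes of
   functions are presented in this way without forming quotient types. *)
Record nlspace (R : realType) := NLSpace {
  nl_sort :> lmodType R;
  nl_car : set nl_sort;
  nl_eq : nl_sort -> nl_sort -> Prop;
  nl_join : nl_sort -> nl_sort -> nl_sort;
  nl_meet : nl_sort -> nl_sort -> nl_sort;
  nl_norm : nl_sort -> R }.

(* [phi] induces a bijective linear lattice homomorphism from (the classes of)
   V onto (the classes of) W which is a homeomorphism. *)
Record order_isomorphism (R : realType) (V W : nlspace R) (phi : V -> W) : Prop :=
  OrderIsomorphism {
  oi_car : forall f, nl_car f -> nl_car (phi f);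
  oi_eq : forall f g, nl_car f -> nl_car g ->
    (nl_eq (phi f) (phi g) <-> nl_eq f g);
  oi_surj : forall h, @nl_car R W h -> exists2 f, nl_car f & nl_eq (phi f) h;
  oi_linear : forall (a : R) f g, nl_car f -> nl_car g ->
    nl_eq (phi (a *: f + g)) (a *: phi f + phi g);
  oi_join : forall f g, nl_car f -> nl_car g ->
    nl_eq (phi (nl_join f g)) (nl_join (phi f) (phi g));
  oi_meet : forall f g, nl_car f -> nl_car g ->
    nl_eq (phi (nl_meet f g)) (nl_meet (phi f) (phi g));
  oi_continuous : forall f, nl_car f -> forall e : R, 0 < e ->
    exists2 d : R, 0 < d & forall g, nl_car g ->
      nl_norm (g - f) < d -> nl_norm (phi g - phi f) < e;
  oi_inv_continuous : forall f, nl_car f -> forall e : R, 0 < e ->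
    exists2 d : R, 0 < d & forall g, nl_car g ->
      nl_norm (phi g - phi f) < d -> nl_norm (g - f) < e }.

(** * Banach lattices and AL-spaces *)

Record banach_lattice (R : realType) (E : completeNormedModType R)
    (le : E -> E -> Prop) (join meet : E -> E -> E) : Prop := BanachLattice {
  bl_refl : forall x, le x x;
  bl_anti : forall x y, le x y -> le y x -> x = y;
  bl_trans : forall x y z, le x y -> le y z -> le x z;
  bl_joinl : forall x y, le x (join x y);
  bl_joinr : forall x y, le y (join x y);
  bl_join_le : forall x y z, le x z -> le y z -> le (join x y) z;
  bl_meetl : forall x y, le (meet x y) x;
  bl_meetr : forall x y, le (meet x y) y;
  bl_le_meet : forall x y z, le z x -> le z y -> le z (meet x y);
  bl_leD : forall x y z, le x y -> le (x + z) (y + z);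
  bl_leZ : forall (a : R) x y, 0 <= a -> le x y -> le (a *: x) (a *: y);
  bl_le_norm : forall x y, le (join x (- x)) (join y (- y)) -> `|x| <= `|y| }.

Definition AL_space (R : realType) (E : completeNormedModType R)
    (le : E -> E -> Prop) (join meet : E -> E -> E) : Prop :=
  banach_lattice le join meet /\
  forall x y, meet (join x (- x)) (join y (- y)) = 0 -> `|x + y| = `|x| + `|y|.

Definition nl_of_banach (R : realType) (E : completeNormedModType R)
    (join meet : E -> E -> E) : nlspace R :=
  @NLSpace R E setT eq join meet (fun x => `|x|).

Definition order_isomorphic_to_AL (R : realType) (V : nlspace R) : Prop :=
  exists (E : completeNormedModType R) (le : E -> E -> Prop)
         (join meet : E -> E -> E) (phi : V -> E),
    AL_space le join meet /\
    @order_isomorphism R V (nl_of_banach join meet) phi.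

(** * Function spaces on [0,1] *)

Record funspace (R : realType) := FunSpace {
  fs_car :> (lebT R -> R) -> Prop;
  fs_eq : (lebT R -> R) -> (lebT R -> R) -> Prop;
  fs_norm : (lebT R -> R) -> R }.

Definition nl_of_fun (R : realType) (Y : funspace R) : nlspace R :=
  @NLSpace R (lebT R -> R^o : lmodType R) (fs_car Y) (@fs_eq R Y)
    (fun f g x => Num.max (f x) (g x)) (fun f g x => Num.min (f x) (g x))
    (@fs_norm R Y).

Definition fs_same (R : realType) (Y Z : funspace R) : Prop :=
  [/\ fs_car Y = fs_car Z,
      forall f g, Y f -> Y g -> (fs_eq Y f g <-> fs_eq Z f g) &
      forall f, Y f -> fs_norm Y f = fs_norm Z f].

Record is_Bfs (R : realType) (X : funspace R) : Prop := IsBfs {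
  bfs_measurable : forall f, X f -> measurable_fun I01 f;
  bfs_eqE : forall f g, fs_eq X f g <-> ae_eq01 f g;
  bfs_zero : X (fun=> 0);
  bfs_linear : forall (a : R) f g, X f -> X g -> X (fun x => a * f x + g x);
  bfs_normD : forall f g, X f -> X g ->
    fs_norm X (fun x => f x + g x) <= fs_norm X f + fs_norm X g;
  bfs_normZ : forall (a : R) f, X f ->
    fs_norm X (fun x => a * f x) = `|a| * fs_norm X f;
  bfs_norm0_eq0 : forall f, X f -> fs_norm X f = 0 -> ae_eq01 f (fun=> 0);
  bfs_ideal : forall f g : lebT R -> R, X f -> measurable_fun I01 g ->
    {ae lam, forall x, I01 x -> `|g x| <= `|f x|} ->
    X g /\ fs_norm X g <= fs_norm X f;
  bfs_complete : forall u : nat -> lebT R -> R, (forall n, X (u n)) ->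
    (forall e : R, 0 < e -> exists N, forall m n, (N <= m)%N -> (N <= n)%N ->
       fs_norm X (fun x => u m x - u n x) < e) ->
    exists2 f, X f &
      (fun n => fs_norm X (fun x => u n x - f x)) @ \oo --> (0 : R) }.

(* Infinite only possibly at t = 0. *)
Definition rearrangement (R : realType) (f : lebT R -> R) (t : R) : \bar R :=
  ereal_inf [set tau%:E | tau in
    [set tau : R | 0 <= tau /\
       (lam [set x | I01 x /\ (tau < `|f x|)%R] <= t%:E)%E]].

(* The space {0} is excluded, as is implicit in L^oo being contained in every
   r.i. space. *)
Record is_ri (R : realType) (X : funspace R) : Prop := IsRi {
  ri_Bfs : is_Bfs X;
  ri_nonzero : exists2 f, X f & ~ ae_eq01 f (fun=> 0);
  ri_rearrangement : forall f g : lebT R -> R, X f -> measurable_fun I01 g ->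
    (forall t : R, 0 <= t <= 1 -> (rearrangement g t <= rearrangement f t)%E) ->
    X g /\ fs_norm X g <= fs_norm X f }.

Definition Linfty01 (R : realType) : set (lebT R -> R) :=
  [set f : lebT R -> R | measurable_fun I01 f /\
     exists M : R, {ae lam, forall x, I01 x -> `|f x| <= M}].
Arguments Linfty01 : clear implicits.

Definition associate (R : realType) (Y : funspace R) : set (lebT R -> R) :=
  [set g : lebT R -> R | measurable_fun I01 g /\
     forall f, Y f -> (\int[lam]_(t in I01) `|f t * g t|%:E < +oo)%E].

(** * The Cesaro operator and the Cesaro space *)

Definition cesaro_op (R : realType) (f : lebT R -> R) (x : lebT R) : \bar R :=
  (((x : R)^-1)%:E *
   \int[lam]_(t in [set t : lebT R | (0 <= (t : R) <= (x : R))%R]) (f t)%:E)%E.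

(* [fine] sends +oo to 0, whence the explicit finiteness condition in the
   definition of the Cesaro space. *)
Definition cesaro_abs (R : realType) (f : lebT R -> R) (x : lebT R) : R :=
  fine (cesaro_op (fun t => `|f t|) x).

Definition cesaro_space (R : realType) (X : funspace R) : funspace R :=
  FunSpace
    [set f : lebT R -> R | [/\ measurable_fun I01 f,
       {ae lam, forall x, I01 x -> (cesaro_op (fun t => `|f t|%R) x < +oo)%E} &
       X (cesaro_abs f)]]
    (@ae_eq01 R)
    (fun f => fs_norm X (cesaro_abs f)).

(** * Vector measures with values in a function space *)

Definition set_variation (R : realType) (p : set (lebT R) -> R) (A : set (lebT R)) :
    \bar R :=
  ereal_sup [set s | exists (n : nat) (F : 'I_n -> set (lebT R)),
    [/\ forall i, measurable (F i), trivIset setT F, \bigcup_i F i = A &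
        s = (\sum_(i < n) p (F i))%:E]].

(* The upper variation: the positive part of the Jordan decomposition when nu
   is a finite signed measure. *)
Definition upper_variation (R : realType) (nu : set (lebT R) -> R)
    (A : set (lebT R)) : \bar R :=
  ereal_sup [set (nu B)%:E | B in [set B | measurable B /\ B `<=` A]].

Definition lower_variation (R : realType) (nu : set (lebT R) -> R) :
  set (lebT R) -> \bar R := upper_variation (fun A => - nu A).

Definition signed_integral (R : realType) (nu : set (lebT R) -> R)
    (A : set (lebT R)) (f : lebT R -> R) : \bar R :=
  (\int[upper_variation nu]_(t in A) (f t)%:E -
   \int[lower_variation nu]_(t in A) (f t)%:E)%E.

Definition dual_space (R : realType) (X : funspace R) : set ((lebT R -> R) -> R) :=
  [set x | (forall (a : R) f g, X f -> X g ->
              x (fun t => a * f t + g t) = a * x f + x g) /\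
           exists K : R, forall f, X f -> `|x f| <= K * fs_norm X f].

Definition dual_ball (R : realType) (X : funspace R) :
    set ((lebT R -> R) -> R) :=
  [set x | dual_space X x /\ forall f, X f -> `|x f| <= fs_norm X f].

Section VectorMeasure.
Variables (R : realType) (X : funspace R) (m : set (lebT R) -> lebT R -> R).

Definition scalar_measure (x : (lebT R -> R) -> R) (A : set (lebT R)) : R :=
  x (m A).

Definition scalar_variation (x : (lebT R -> R) -> R) :
    set (lebT R) -> \bar R :=
  set_variation (fun A => `|scalar_measure x A|).

Definition vm_variation : set (lebT R) -> \bar R :=
  set_variation (fun A => fs_norm X (m A)).

Definition vm_null (A : set (lebT R)) : Prop :=
  measurable A /\
  forall B, measurable B -> B `<=` A -> fs_eq X (m B) (fun=> 0).

Definition vm_integrable (f : lebT R -> R) : Prop :=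
  [/\ measurable_fun I01 f,
      forall x, dual_space X x -> (scalar_variation x).-integrable I01 (EFin \o f) &
      forall A, measurable A -> A `<=` I01 ->
        exists2 g, X g & forall x, dual_space X x ->
          (x g)%:E = signed_integral (scalar_measure x) A f].

(* The supremum is finite on integrable functions. *)
Definition L1_vm : funspace R :=
  FunSpace vm_integrable
    (fun f g => exists2 N, vm_null N &
       forall t, I01 t -> ~ N t -> f t = g t)
    (fun f => fine (ereal_sup
       [set (\int[scalar_variation x]_(t in I01) `|f t|%:E)%E
          | x in dual_ball X])).

Definition L1_variation : funspace R :=
  FunSpace [set f : lebT R -> R | vm_variation.-integrable I01 (EFin \o f)]
    (fun f g => {ae vm_variation, forall t, I01 t -> f t = g t})
    (fun f => fine (\int[vm_variation]_(t in I01) `|f t|%:E)%E).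

Definition L1_vm_iso_L1_variation : Prop :=
  @order_isomorphism R (nl_of_fun L1_variation) (nl_of_fun L1_vm) (fun f => f).

End VectorMeasure.

Definition cesaro_vm (R : realType) (A : set (lebT R)) : lebT R -> R :=
  fun x => fine (cesaro_op (\1_A) x).
Arguments cesaro_vm : clear implicits.

Definition Fy (R : realType) (y : lebT R) : lebT R -> R :=
  fun x => (x : R)^-1 * \1_[set t : lebT R | (y : R) <= (t : R) <= 1] x.

(* Main.v *)
(** With [phi y := ||F_y||_X], each condition amounts to the existence of [K] such
    that [int f phi <= K ||C f||_X] for all [f >= 0] in [[C, X]] ([AL_bound]).
    For [f >= 0] supported on a short interval near [y > 0], the average [C f] is
    close to [(int f) F_y], so cutting [[d, 1]] into many small cells gives
    [sum_i ||C (f chi_i)|| -> int f phi] ([norm_fcell]).  Three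
    consequences: [|m_X|] has density [phi] and [||C f|| <= int f phi]; if
    [[C, X]] is lattice isomorphic to a space whose norm is additive on disjoint
    elements, then the sum over the cells, hence [int f phi], is at most a
    constant times [||C f||]; and the same holds if the norms of [L^1(m_X)] and
    [L^1(|m_X|)] are equivalent, because the norm of [L^1(m_X)] is that of
    [[C, X]].  Finiteness of [int |f| phi] on [[C, X]], which is (c), upgrades to
    such a bound by a Riesz-Fischer argument.  Conversely the bound makes
    [int |f| phi] an equivalent additive norm on [[C, X]] = [L^1(|m_X|)].

    Functionals are accessible through densities: since [X <> L^oo], the norms
    of indicators of small sets tend to 0, so for [x] in the dual of [X] the
    measure [x m_X] is countably additive and has a density [h], and
    [x (C f) = int f h] as soon as [int |f| phi] is finite.  Hahn-Banach then
    identifies the norm of [L^1(m_X)], and, applied to [f |-> ||f^+||], yields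
    enough positive functionals to see that [L^1(m_X)] lies in [[C, X]]. *)

Require Import Defs.
From HB Require Import structures.
From mathcomp Require Import all_boot all_order all_algebra.
From mathcomp Require Import all_classical all_reals all_analysis.
From mathcomp Require Import measurable_realfun ring lra.

Set Implicit Arguments.
Unset Strict Implicit.
Unset Printing Implicit Defensive.
Import Order.TTheory GRing.Theory Num.Theory.
Import numFieldNormedType.Exports.

Local Open Scope classical_set_scope.
Local Open Scope ring_scope.

(** Without the Fatou property, an increasing norm bounded sequence in X need not have its pointwise
    limit in X. Limits are therefore taken along Cauchy sequences: the difference of two truncations
    of [f] is again bounded and zero near 0, so the norm of its average is at most the difference of
    the two integrals against [phi], and finiteness of [Iphi f] makes the averages Cauchy.
    Truncation cuts near 0 as well as in height because [phi], being nonincreasing, can be unbounded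
    at 0 only; on [d, 1] it is at most [phi d], and its drops over consecutive cells telescope,
    which is what makes the error of the cell sums explicit. The norm of X is not assumed to be
    order continuous either, so [x (C f)] is first computed for bounded [f]; the extension to
    unbounded [f] rests on [Iphi (f - trunc n f)] tending to 0. *)

(** * Intervals and the completed Lebesgue measure *)

Section lam_intervals.
Variable R : realType.

Lemma lam_measurable_itv (i : interval R) :
  measurable ([set` i] : set (lebT R)).
Proof. by apply: sub_caratheodory; exact: measurable_itv. Qed.

Lemma lam_measurable_is_interval (A : set R) : is_interval A ->
  measurable (A : set (lebT R)).
Proof.
by move=> iA; apply: sub_caratheodory; exact: measurable_realfun.is_interval_measurable.
Qed.

Lemma lam_itvcc (a b : R) : a <= b ->
  lam ([set t : lebT R | a <= (t:R) <= b]) = (b - a)%:E.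
Proof.
move=> ab.
have -> : [set t : lebT R | a <= (t:R) <= b] = [set` `[a, b]].
  by apply/seteqP; split => x /=; rewrite in_itv.
(* The completed measure and [lebesgue_measure] restrict the same outer measure, so the two values
   are convertible. *)
rewrite -[LHS]/(lebesgue_measure `[a,b]%classic) lebesgue_measure_itv /= lte_fin.
by move: ab; rewrite le_eqVlt => /predU1P[->|->]; rewrite ?ltxx ?subrr.
Qed.

Lemma measurable_I01 : measurable (@I01 R).
Proof.
have -> : @I01 R = [set` `[0:R, 1]].
  by apply/seteqP; split => x /=; rewrite /I01/= in_itv.
exact: lam_measurable_itv.
Qed.

Lemma lam_set1 (a : R) : lam ([set a] : set (lebT R)) = 0%E.
Proof.
by rewrite -[LHS]/(lebesgue_measure [set a]) lebesgue_measure_set1.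
Qed.
End lam_intervals.

#[local] Opaque completed_lebesgue_measure.

(** * Truncation in height and near 0 *)

Section trunc.
Variable R : realType.
Local Notation T := (lebT R).
Implicit Types (f g w : T -> R) (x t : T) (n : nat).

Definition nneg f := measurable_fun (@I01 R) f /\ forall t, I01 t -> 0 <= f t.

(** The endpoints are null. Statements about averages are claimed inside (0,1) only: at 0 the
    inverse is 0 by convention, and the integral up to 1 may be infinite. *)
Lemma ae01W (P : T -> Prop) :
  (forall x, 0 < (x : R) < 1 -> P x) -> {ae lam, forall x, I01 x -> P x}.
Proof.
move=> h; exists ([set (0:R)] `|` [set (1:R)] : set T).
have m1 (a : R) : measurable ([set a] : set T).
  by apply: sub_caratheodory; exact: measurable_set1.
split; first exact: measurableU.
  by rewrite measureU0 //; exact: lam_set1.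
move=> x /= /not_implyP [/andP[x0 x1] nP].
move: x0; rewrite le_eqVlt => /predU1P[->|x0]; first by left.
move: x1; rewrite le_eqVlt => /predU1P[->|x1]; first by right.
by exfalso; apply: nP; apply: h; rewrite x0.
Qed.

(** The cut near 0 makes integrals against a nonincreasing weight finite even when the weight is
    unbounded at 0. [n.+1] avoids inverting 0. *)
Definition trunc n f t := if n.+1%:R^-1 <= (t : R) then Num.min (f t) n%:R else 0.

Lemma measurable_ge (a : R) : measurable ([set t : T | a <= (t : R)]).
Proof.
rewrite (_ : [set t : T | a <= (t : R)] = [set` `[a, +oo[ ]).
  exact: lam_measurable_itv.
by apply/seteqP; split => x /=; rewrite in_itv /= andbT.
Qed.

Lemma trunc_measurable n f : measurable_fun (@I01 R) f ->
  measurable_fun (@I01 R) (trunc n f).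
Proof.
move=> mf; rewrite /trunc.
have mi := @measurable_I01 R.
have mb : measurable_fun (@I01 R) (fun t : T => n.+1%:R^-1 <= (t : R)).
  apply: (measurable_fun_bool true).
  rewrite (_ : _ @^-1` _ = [set t : T | n.+1%:R^-1 <= (t : R)]) //.
  by apply: measurableI; [exact: mi|exact: measurable_ge].
apply: (measurable_fun_if mi mb); last exact: measurable_cst.
have mm := measurable_minr mf (measurable_cst (n%:R : R)).
by apply: (measurable_funS mi _ mm) => t [].
Qed.

Lemma trunc_ge0 n f t : 0 <= f t -> 0 <= trunc n f t.
Proof. by move=> f0; rewrite /trunc; case: ifP => // _; rewrite le_min f0 ler0n. Qed.

Lemma trunc_nneg n f : nneg f -> nneg (trunc n f).
Proof.
by case=> mf f0; split; [exact: trunc_measurable|move=> t /f0 /trunc_ge0].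
Qed.

Lemma trunc_le n f t : 0 <= f t -> trunc n f t <= f t.
Proof. by move=> f0; rewrite /trunc; case: ifP => // _; rewrite ge_min lexx. Qed.

Lemma trunc_bound n f t : trunc n f t <= n%:R.
Proof. by rewrite /trunc; case: ifP => _; rewrite ?ler0n // ge_min lexx orbT. Qed.

Lemma trunc_supp n f t : (t : R) < n.+1%:R^-1 -> trunc n f t = 0.
Proof. by rewrite /trunc ltNge; case: ifP. Qed.

Lemma trunc_homo f t m n : 0 <= f t -> (m <= n)%N -> trunc m f t <= trunc n f t.
Proof.
move=> f0 mn; rewrite /trunc; case: ifPn => [mt|_].
  rewrite (le_trans _ mt) ?lef_pV2 ?posrE ?ler_nat //.
  by rewrite le_min ge_min lexx /= ge_min ler_nat mn orbT.
by case: ifP => // _; rewrite le_min f0 ler0n.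
Qed.

Lemma trunc_near f t : 0 < (t : R) -> \forall n \near \oo, trunc n f t = f t.
Proof.
move=> t0.
have h1 : \forall n \near \oo, n.+1%:R^-1 <= (t : R).
  near=> n; rewrite -[leRHS]invrK lef_pV2 ?posrE ?invr_gt0 //.
  by apply: (@le_trans _ _ n%:R); [near: n; exact: nbhs_infty_ger|rewrite ler_nat].
have h2 : \forall n \near \oo, f t <= n%:R by exact: nbhs_infty_ger.
near=> n; rewrite /trunc ifT; last by near: n.
by apply/min_idPl; near: n.
Unshelve. all: by end_near. Qed.

Lemma trunc_cvg (D : set T) f w : measurable D -> D `<=` I01 -> nneg f ->
  measurable_fun D w -> (forall t, D t -> 0 <= w t) ->
  (\int[lam]_(t in D) (trunc n f t * w t)%:E @[n --> \oo] -->
   \int[lam]_(t in D) (f t * w t)%:E)%E.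
Proof.
move=> mD DI nf mw w0.
pose Z := [set (0:R)] : set T.
have m0 : measurable Z.
  by apply: sub_caratheodory; exact: measurable_set1.
have mfw g : nneg g -> measurable_fun D (EFin \o (fun t => g t * w t)).
  move=> [mg _]; apply/measurable_EFinP; apply: measurable_funM => //.
  exact: (measurable_funS (@measurable_I01 R) DI mg).
have fw0 g : nneg g -> forall t, D t -> (0 <= (g t * w t)%:E)%E.
  by move=> [_ g0] t Dt; rewrite lee_fin mulr_ge0 // ?w0 // g0 //; exact: DI.
(* The point 0 is discarded: every truncation is 0 there and need not converge to [f]. *)
have E g : nneg g -> (\int[lam]_(t in D) (g t * w t)%:E =
    \int[lam]_(t in D `\` Z) (g t * w t)%:E)%E.
  move=> ng; apply: (ge0_negligible_integral m0 mD (mfw _ ng) (fw0 _ ng)).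
  exact: lam_set1.
rewrite (E _ nf).
rewrite (_ : (fun n => _) = (fun n => \int[lam]_(t in D `\` Z) (trunc n f t * w t)%:E)%E); last first.
  by apply/funext => n; rewrite E //; exact: trunc_nneg.
have mD' : measurable (D `\` Z) by exact: measurableD.
have DD' : D `\` Z `<=` D by exact: subDsetl.
rewrite (_ : (\int[lam]_(t in D `\` Z) (f t * w t)%:E =
  \int[lam]_(t in D `\` Z) (limn (fun n => (trunc n f t * w t)%:E)))%E).
  apply: (cvg_monotone_convergence mD').
  - by move=> n; exact: (measurable_funS mD DD' (mfw _ (trunc_nneg n nf))).
  - by move=> n t /DD'; exact: fw0 (trunc_nneg n nf) t.
  - move=> t /DD' Dt m n mn; rewrite lee_fin; apply: ler_wpM2r; first exact: w0.
    by apply: trunc_homo => //; apply: nf.2; exact: DI.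
apply: eq_integral => t; rewrite inE => -[Dt /= /eqP t0]; apply/esym/cvg_lim => //.
apply: cvg_near_cst.
have tp : 0 < (t : R) by rewrite lt_neqAle eq_sym t0; have /andP[] := DI _ Dt.
by apply: filterS (trunc_near f tp) => n ->.
Qed.

(** By monotone convergence, bounds on weighted integrals only have to be checked on truncations. *)
Lemma trunc_sup (D : set T) f w c : measurable D -> D `<=` I01 -> nneg f ->
  measurable_fun D w -> (forall t, D t -> 0 <= w t) ->
  (forall n, \int[lam]_(t in D) (trunc n f t * w t)%:E <= c)%E ->
  (\int[lam]_(t in D) (f t * w t)%:E <= c)%E.
Proof.
move=> mD DI nf mw w0 h; have cv := trunc_cvg mD DI nf mw w0.
rewrite -(cvg_lim _ cv) //; apply: lime_le; first by apply/cvg_ex; eexists; exact: cv.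
exact: nearW.
Qed.

End trunc.

(** * Cesaro averages of nonnegative functions *)

Section cesaro.
Variable R : realType.
Local Notation T := (lebT R).
Local Open Scope ereal_scope.
Implicit Types (f g : T -> R) (x y t : T) (A : set T).

Definition seg0 x : set T := [set t : T | (0 <= (t : R) <= (x : R))%R].

Lemma seg0_sub x : ((x : R) <= 1)%R -> seg0 x `<=` I01.
Proof. by move=> x1 t /andP[t0 tx]; rewrite /I01/= t0 /= (le_trans tx). Qed.

Lemma measurable_seg0 x : measurable (seg0 x).
Proof.
rewrite (_ : seg0 x = [set` `[0%R, (x : R)]]); first exact: lam_measurable_itv.
by apply/seteqP; split => t /=; rewrite /seg0/= in_itv.
Qed.

Lemma seg0_homo x y : ((x : R) <= y)%R -> seg0 x `<=` seg0 y.
Proof. by move=> xy t /andP[t0 tx]; rewrite /seg0/= t0 /= (le_trans tx). Qed.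

Definition cint f x := \int[lam]_(t in seg0 x) (f t)%:E.

(** An infinite average becomes 0 under [fine], which is why additivity is stated for [locint]
    functions. [cesaro_abs f] and [cesaro_vm A] are convertible with [ces] of the absolute value and
    of the indicator. *)
Definition ces f x : R := fine (cesaro_op f x).

Lemma nnegD f g : nneg f -> nneg g -> nneg (fun t => f t + g t)%R.
Proof.
move=> [mf f0] [mg g0]; split; first exact: measurable_funD.
by move=> t It; rewrite addr_ge0 ?f0 ?g0.
Qed.

Lemma nnegM f g : nneg f -> nneg g -> nneg (fun t => f t * g t)%R.
Proof.
move=> [mf f0] [mg g0]; split; first exact: measurable_funM.
by move=> t It; rewrite mulr_ge0 ?f0 ?g0.
Qed.

Lemma nneg_cst (c : R) : (0 <= c)%R -> nneg (fun=> c).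
Proof. by move=> c0; split => //; exact: measurable_cst. Qed.

Lemma nnegZ (c : R) f : (0 <= c)%R -> nneg f -> nneg (fun t => c * f t)%R.
Proof. by move=> c0; exact: nnegM (nneg_cst c0). Qed.

Lemma nneg_indic A : measurable A -> nneg (\1_A : T -> R).
Proof.
move=> mA; split; last by move=> t _; rewrite indicE.
exact: measurable_indic.
Qed.

Lemma nneg_abs f : measurable_fun (@I01 R) f -> nneg (fun t => `|f t|)%R.
Proof.
move=> mf; split; last by [].
exact: (measurableT_comp (@normr_measurable R setT)).
Qed.

Lemma nnegB f g : nneg f -> nneg g -> (forall t, I01 t -> (g t <= f t)%R) ->
  nneg (fun t => f t - g t)%R.
Proof.
move=> [mf f0] [mg g0] gf; split; first exact: measurable_funB.
by move=> t It; rewrite subr_ge0 gf.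
Qed.

Lemma nneg_EFin f D : D `<=` I01 -> nneg f -> measurable_fun D (EFin \o f).
Proof.
move=> DI [mf _]; apply/measurable_EFinP.
exact: (measurable_funS (@measurable_I01 R) DI mf).
Qed.

Lemma cint_ge0 f x : ((x : R) <= 1)%R -> nneg f -> 0 <= cint f x.
Proof.
move=> x1 [_ f0]; apply: integral_ge0 => t /(seg0_sub x1) It.
by rewrite lee_fin f0.
Qed.

Lemma cint_le f g x : ((x : R) <= 1)%R -> nneg f -> nneg g ->
  (forall t, I01 t -> f t <= g t)%R -> cint f x <= cint g x.
Proof.
move=> x1 nf ng fg; have s := seg0_sub x1.
apply: (ge0_le_integral _ (measurable_seg0 x)).
- by move=> t /s It; rewrite lee_fin nf.2.
- exact: nneg_EFin.
- exact: nneg_EFin.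
- by move=> t /s It; rewrite lee_fin fg.
Qed.

Lemma cint_homo f x y : ((x : R) <= y)%R -> ((y : R) <= 1)%R -> nneg f ->
  cint f x <= cint f y.
Proof.
move=> xy y1 nf; have s := seg0_sub y1.
apply: (ge0_subset_integral _ (measurable_seg0 x) (measurable_seg0 y)).
- exact: nneg_EFin.
- by move=> t /s It; rewrite lee_fin nf.2.
- exact: seg0_homo.
Qed.

Lemma cintD f g x : ((x : R) <= 1)%R -> nneg f -> nneg g ->
  cint (fun t => f t + g t)%R x = cint f x + cint g x.
Proof.
move=> x1 nf ng; have s := seg0_sub x1; rewrite /cint.
under eq_integral do rewrite EFinD.
apply: (ge0_integralD _ (measurable_seg0 x)).
- by move=> t /s It; rewrite lee_fin nf.2.
- exact: nneg_EFin.
- by move=> t /s It; rewrite lee_fin ng.2.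
- exact: nneg_EFin.
Qed.

Lemma cintZ (c : R) f x : ((x : R) <= 1)%R -> (0 <= c)%R -> nneg f ->
  cint (fun t => c * f t)%R x = c%:E * cint f x.
Proof.
move=> x1 c0 nf; have s := seg0_sub x1; rewrite /cint.
under eq_integral do rewrite EFinM.
apply: (ge0_integralZl_EFin _ (measurable_seg0 x)) => //.
- by move=> t /s It; rewrite lee_fin nf.2.
- exact: nneg_EFin.
Qed.

Lemma cint_cst (c : R) x : I01 x -> cint (fun=> c) x = (c * (x : R))%:E.
Proof.
move=> /andP[x0 x1]; rewrite /cint.
rewrite -[X in integral _ _ X]/(cst c%:E) (integral_cst _ (measurable_seg0 x)).
by rewrite /= (lam_itvcc x0) subr0 -EFinM.
Qed.

Lemma cint_bound f (M : R) x : I01 x -> nneg f ->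
  (forall t, I01 t -> f t <= M)%R -> cint f x <= (M * (x : R))%:E.
Proof.
move=> Ix nf fM; rewrite -cint_cst //; case/andP: (Ix) => x0 x1.
have i0 : I01 (0%R : T) by rewrite /I01/= lexx ler01.
apply: cint_le => //; apply: nneg_cst; exact: le_trans (nf.2 _ i0) (fM _ i0).
Qed.

(** The point 1 is excluded on purpose: a member of the Cesaro space need not be integrable up to 1.
    For X = L^1, the function 1/(1-t) has the integrable average -log(1-x)/x. *)
Definition locint f := nneg f /\ forall x, (0 <= (x : R) < 1)%R -> cint f x < +oo.

Lemma bounded_locint f (M : R) : nneg f -> (forall t, I01 t -> f t <= M)%R ->
  locint f.
Proof.
move=> nf fM; split => // x /andP[x0 x1].
have Ix : I01 x by rewrite /I01/= x0 ltW.
by apply: le_lt_trans (cint_bound Ix nf fM) _; rewrite ltry.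
Qed.

Lemma locint_le f g : nneg f -> locint g -> (forall t, I01 t -> f t <= g t)%R ->
  locint f.
Proof.
move=> nf [ng gi] fg; split => // x x01; have /andP[x0 x1] := x01.
by apply: le_lt_trans (gi _ x01); apply: cint_le => //; exact: ltW.
Qed.

Lemma locintD f g : locint f -> locint g -> locint (fun t => f t + g t)%R.
Proof.
move=> [nf fi] [ng gi]; split => [|x x01]; first exact: nnegD.
have /andP[x0 x1] := x01; rewrite cintD ?ltW //.
by rewrite lte_add_pinfty ?fi ?gi.
Qed.

Lemma locintZ (c : R) f : (0 <= c)%R -> locint f -> locint (fun t => c * f t)%R.
Proof.
move=> c0 [nf fi]; split => [|x x01]; first exact: nnegZ.
have /andP[x0 x1] := x01; rewrite (cintZ (ltW x1) c0 nf).
have cf : cint f x \is a fin_num by rewrite ge0_fin_numE ?fi // cint_ge0 ?ltW.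
by rewrite -(fineK cf) -EFinM ltry.
Qed.

Lemma cint_fin f x : locint f -> (0 <= (x : R) < 1)%R -> cint f x \is a fin_num.
Proof.
move=> [nf fi] x01; rewrite ge0_fin_numE; first exact: fi.
by apply: cint_ge0 => //; case/andP: x01 => _ /ltW.
Qed.

Lemma cesaro_opE f x : cesaro_op f x = ((x : R)^-1)%:E * cint f x.
Proof. by []. Qed.

Lemma cesE f x : locint f -> (0 <= (x : R) < 1)%R ->
  ces f x = ((x : R)^-1 * fine (cint f x))%R.
Proof. by move=> lf x01; rewrite /ces cesaro_opE fineM // cint_fin. Qed.

Lemma cesE' f x : locint f -> (0 <= (x : R) < 1)%R ->
  (ces f x)%:E = (((x : R)^-1)%:E * cint f x).
Proof. by move=> lf x01; rewrite cesE // EFinM fineK // cint_fin. Qed.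

Lemma cesaro_op_ge0 f x : I01 x -> nneg f -> 0 <= cesaro_op f x.
Proof.
move=> /andP[x0 x1] nf; rewrite cesaro_opE mule_ge0 ?cint_ge0 //.
by rewrite lee_fin invr_ge0.
Qed.

Lemma ces_ge0 f x : I01 x -> nneg f -> (0 <= ces f x)%R.
Proof. by move=> Ix nf; rewrite /ces fine_ge0 // cesaro_op_ge0. Qed.

Lemma ces_le f g x : (0 <= (x : R) < 1)%R -> nneg f -> locint g ->
  (forall t, I01 t -> f t <= g t)%R -> (ces f x <= ces g x)%R.
Proof.
move=> x01 nf lg fg; have /andP[x0 x1] := x01.
rewrite -lee_fin !cesE' //; last exact: locint_le lg fg.
apply: lee_wpmul2l; first by rewrite lee_fin invr_ge0.
by apply: cint_le => //; [exact: ltW|exact: lg.1].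
Qed.

Lemma cesD f g x : (0 <= (x : R) < 1)%R -> locint f -> locint g ->
  ces (fun t => f t + g t)%R x = (ces f x + ces g x)%R.
Proof.
move=> x01 lf lg; apply: EFin_inj.
rewrite EFinD (cesE' (locintD lf lg) x01) (cesE' lf x01) (cesE' lg x01).
rewrite (cintD _ lf.1 lg.1); last by case/andP: x01 => _ /ltW.
by rewrite muleDr // fin_num_adde_defr // cint_fin.
Qed.

Lemma cesZ (c : R) f x : (0 <= (x : R) < 1)%R -> (0 <= c)%R -> locint f ->
  ces (fun t => c * f t)%R x = (c * ces f x)%R.
Proof.
move=> x01 c0 lf; apply: EFin_inj.
rewrite EFinM (cesE' (locintZ c0 lf) x01) (cesE' lf x01) (cintZ _ c0 lf.1).
  by rewrite muleCA.
by case/andP: x01 => _ /ltW.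
Qed.

Lemma ces_bound f (M : R) x : I01 x -> nneg f -> (0 <= M)%R ->
  (forall t, I01 t -> f t <= M)%R -> (ces f x <= M)%R.
Proof.
move=> Ix nf M0 fM; have /andP[x0 x1] := Ix.
have cb := cint_bound Ix nf fM.
have fc : cint f x \is a fin_num.
  by rewrite ge0_fin_numE ?cint_ge0 // (le_lt_trans cb) ?ltry.
rewrite /ces cesaro_opE fineM //= .
move: x0; rewrite le_eqVlt => /predU1P[<-|x0]; first by rewrite invr0 mul0r.
by rewrite mulrC ler_pdivrMr // -lee_fin fineK.
Qed.

(** Superlevel sets of a nonincreasing function on (0,1] are intervals. The value at 0 is left free,
    since both the inverse and [phi] take the value 0 there by convention. *)
Lemma antitone01_measurable (g : T -> R) :
  (forall x y, 0 < (x : R) -> (x : R) <= y -> (y : R) <= 1 -> g y <= g x)%R ->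
  measurable_fun (@I01 R) g.
Proof.
move=> gd; pose Z := [set (0%R : R)] : set T.
have mZ : measurable Z by apply: sub_caratheodory; exact: measurable_set1.
pose J := [set` `]0%R, (1%R : R)]] : set T.
have mJ : measurable J by exact: lam_measurable_itv.
rewrite (_ : @I01 R = Z `|` J).
  apply/(measurable_funU _ mZ mJ); split; first exact: measurable_fun_set1.
  apply: (measurability (@RGenCInfty.G R)) => [|/= _ [_ [r ->] <-]].
    exact: RGenCInfty.measurableE.
  apply: lam_measurable_is_interval => a b /=.
  rewrite /J/= !in_itv/= !andbT => -[/andP[a0 a1] ga] [/andP[b0 b1] gb] z.
  move=> /andP[az zb]; rewrite in_itv/= (lt_le_trans a0 az) (le_trans zb b1).
  by rewrite in_itv/= andbT; split => //; apply: le_trans gb _; apply: gd => //;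
    exact: lt_le_trans az.
apply/seteqP; split => t; rewrite /I01 /J /Z /= in_itv/=.
  move=> /andP[t0 t1]; move: t0; rewrite (le_eqVlt (0%R : R)).
  by case/orP => [/eqP <-|->]; [left|right].
by case=> [->|/andP[/ltW -> ->] //]; rewrite lexx ler01.
Qed.

Lemma cesaro_op_measurable f : nneg f -> measurable_fun (@I01 R) (cesaro_op f).
Proof.
move=> nf; have mI := @measurable_I01 R.
have minv : measurable_fun (@I01 R) (fun x : T => (x : R)^-1%R).
  apply: antitone01_measurable => x y x0 xy _.
  by rewrite lef_pV2 ?posrE // (lt_le_trans x0).
apply: (@emeasurable_funM _ _ _ _ (EFin \o (fun x : T => (x : R)^-1%R)) (cint f)).
  exact/measurable_EFinP.
(* [cint f] is nondecreasing, so its superlevel sets are intervals. *)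
apply: (measurability (@ErealGenCInfty.G R)) => [|/= _ [_ [r ->] <-]].
  exact: ErealGenCInfty.measurableE.
rewrite [X in measurable X](_ : _ =
   [set t : R | I01 (t : T) /\ r%:E <= cint f (t : T)]).
  apply: lam_measurable_is_interval => a b /= [Ia fa] [Ib fb] z /andP[az zb].
  case/andP: Ia => a0 a1; case/andP: Ib => b0 b1.
  split; first by rewrite /I01/= (le_trans a0 az) (le_trans zb b1).
  by apply: le_trans fa _; apply: cint_homo => //; exact: le_trans zb b1.
by apply/seteqP; split => z /=; rewrite in_itv/= andbT.
Qed.

Lemma ces_measurable f : nneg f -> measurable_fun (@I01 R) (ces f).
Proof.
move=> nf; apply: (measurableT_comp (@fine_measurable R _ measurableT)).
exact: cesaro_op_measurable.
Qed.

Lemma nneg_ces f : nneg f -> nneg (ces f).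
Proof.
by move=> nf; split; [exact: ces_measurable|move=> x Ix; exact: ces_ge0].
Qed.

Lemma eq_ces f g x : ((x : R) <= 1)%R -> (forall t, I01 t -> f t = g t) ->
  ces f x = ces g x.
Proof.
move=> x1 fg; rewrite /ces !cesaro_opE; congr (fine (_ * _)).
by apply: eq_integral => t; rewrite inE => /(seg0_sub x1) It; rewrite fg.
Qed.

Lemma ae_eq_cint f g x : ((x : R) <= 1)%R -> nneg f -> nneg g -> ae_eq01 f g ->
  cint f x = cint g x.
Proof.
move=> x1 nf ng fg; have s := seg0_sub x1.
apply: (ge0_ae_eq_integral (measurable_seg0 x)).
- exact: nneg_EFin.
- exact: nneg_EFin.
- by move=> t /s It; rewrite lee_fin nf.2.
- by move=> t /s It; rewrite lee_fin ng.2.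
- by apply: filterS fg => t h /s It; rewrite h.
Qed.

Lemma ae_eq_ces f g x : ((x : R) <= 1)%R -> nneg f -> nneg g -> ae_eq01 f g ->
  ces f x = ces g x.
Proof. by move=> *; rewrite /ces !cesaro_opE (@ae_eq_cint f g). Qed.

Lemma cint_trunc_sup f x (c : \bar R) : ((x : R) <= 1)%R -> nneg f ->
  (forall n, cint (trunc n f) x <= c) -> cint f x <= c.
Proof.
move=> x1 nf h.
have := @trunc_sup R (seg0 x) f (cst 1%R) c (measurable_seg0 x) (seg0_sub x1) nf
  (measurable_cst _) (fun _ _ => ler01).
rewrite /cint; under eq_integral do rewrite mulr1.
apply => n; apply: le_trans (h n); rewrite /cint le_eqVlt; apply/orP; left.
by apply/eqP/eq_integral => t _; rewrite mulr1.
Qed.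

End cesaro.

(** * Banach function spaces *)

Section bfs.
Variables (R : realType) (X : funspace R) (hB : is_Bfs X).
Local Notation T := (lebT R).
Local Notation N := (fs_norm X).
Implicit Types (f g : T -> R) (x y t : T) (A B : set T).

Lemma bfs_le f g : X f -> measurable_fun (@I01 R) g ->
  (forall x, 0 < (x : R) < 1 -> `|g x| <= `|f x|) -> X g /\ N g <= N f.
Proof. by move=> Xf mg gf; apply: (bfs_ideal hB Xf mg); exact: ae01W. Qed.

Lemma bfs_ae f g : X f -> measurable_fun (@I01 R) g -> ae_eq01 f g ->
  X g /\ N g = N f.
Proof.
move=> Xf mg fg.
have [Xg gf] : X g /\ N g <= N f.
  by apply: (bfs_ideal hB Xf mg); apply: filterS fg => x h Ix; rewrite h.
have [_ fg'] : X f /\ N f <= N g.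
  apply: (bfs_ideal hB Xg (bfs_measurable hB Xf)).
  by apply: filterS fg => x h Ix; rewrite h.
by split => //; apply/eqP; rewrite eq_le gf fg'.
Qed.

Lemma bfs_eq f g : X f -> measurable_fun (@I01 R) g ->
  (forall x, 0 < (x : R) < 1 -> f x = g x) -> X g /\ N g = N f.
Proof. by move=> Xf mg fg; apply: bfs_ae => //; exact: ae01W. Qed.

Lemma bfs_scale (a : R) f : X f -> X (fun x => a * f x).
Proof.
move=> Xf; have := bfs_linear hB a Xf (bfs_zero hB).
by congr (fs_car X _); apply/funext => x; rewrite addr0.
Qed.

Lemma bfs_add f g : X f -> X g -> X (fun x => f x + g x).
Proof.
move=> Xf Xg; have := bfs_linear hB 1 Xf Xg.
by congr (fs_car X _); apply/funext => x; rewrite mul1r.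
Qed.

Lemma bfs_opp f : X f -> X (fun x => - f x).
Proof.
move=> /(bfs_scale (-1)).
by congr (fs_car X _); apply/funext => x; rewrite mulN1r.
Qed.

Lemma bfs_sub f g : X f -> X g -> X (fun x => f x - g x).
Proof. by move=> Xf Xg; apply: bfs_add => //; exact: bfs_opp. Qed.

Lemma bfs_norm0 : N (fun=> 0) = 0.
Proof.
have := bfs_normZ hB 0 (bfs_zero hB); rewrite normr0 mul0r.
by rewrite mul0r.
Qed.

Lemma bfs_norm_ge0 f : X f -> 0 <= N f.
Proof.
move=> Xf; rewrite -bfs_norm0.
apply: (bfs_le Xf _ _).2; first exact: measurable_cst.
by move=> x _; rewrite normr0.
Qed.

Lemma bfs_normN f : X f -> N (fun x => - f x) = N f.
Proof.
move=> Xf; rewrite -[RHS]mul1r -(normr1 R) -(normrN 1) -(bfs_normZ hB) //.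
by congr N; apply/funext => x; rewrite mulN1r.
Qed.

Lemma bfs_norm_sub f g : X f -> X g -> N (fun x => f x - g x) <= N f + N g.
Proof.
move=> Xf Xg; rewrite -(bfs_normN Xg); apply: (bfs_normD hB) => //.
exact: bfs_opp.
Qed.

Lemma bfs_sum (I : Type) (r : seq I) (F : I -> T -> R) : (forall i, X (F i)) ->
  X (fun x => \sum_(i <- r) F i x) /\
  N (fun x => \sum_(i <- r) F i x) <= \sum_(i <- r) N (F i).
Proof.
move=> XF; elim: r => [|i r [Xs Ns]].
  rewrite (_ : (fun x => _) = (fun=> 0)); last first.
    by apply/funext => x; rewrite big_nil.
  by rewrite big_nil bfs_norm0; split => //; exact: bfs_zero.
rewrite (_ : (fun x => _) = (fun x => F i x + \sum_(j <- r) F j x)); last first.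
  by apply/funext => x; rewrite big_cons.
split; first exact: bfs_add.
by rewrite big_cons (le_trans (bfs_normD hB _ _)) ?lerD2l.
Qed.

End bfs.

(** * Rearrangement invariant spaces *)

Section ri.
Variables (R : realType) (X : funspace R) (hX : is_ri X).
Local Notation T := (lebT R).
Local Notation N := (fs_norm X).
Local Notation hB := (ri_Bfs hX).
Implicit Types (f g : T -> R) (x y t : T) (A B : set T).

(** A smaller distribution function enlarges the set whose infimum is the rearrangement.
    Rearrangement invariance is always applied in this form. *)
Lemma ri_dist f g : X f -> measurable_fun (@I01 R) g ->
  (forall tau : R, 0 <= tau -> (lam [set x | I01 x /\ (tau < `|g x|)%R] <=
     lam [set x | I01 x /\ (tau < `|f x|)%R])%E) -> X g /\ N g <= N f.
Proof.
move=> Xf mg gf; apply: (ri_rearrangement hX Xf mg) => t _.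
apply: le_ereal_inf => _ [tau [t0 tf] <-]; exists tau => //; split => //.
exact: le_trans (gf _ t0) tf.
Qed.

Lemma lam_le_I01 A : measurable A -> A `<=` I01 -> (lam A <= 1%:E)%E.
Proof.
move=> mA AI; have <- : lam (@I01 R) = 1%:E.
  by rewrite /I01 lam_itvcc ?ler01 // subr0.
by apply: le_measure; rewrite ?inE //; exact: measurable_I01.
Qed.

Lemma lam_fin A : measurable A -> A `<=` I01 -> lam A \is a fin_num.
Proof.
move=> mA AI; rewrite ge0_fin_numE ?measure_ge0 //.
by apply: le_lt_trans (lam_le_I01 mA AI) _; rewrite ltry.
Qed.

Lemma measurable_gt (M : R) f : measurable_fun (@I01 R) f ->
  measurable [set x | I01 x /\ M < `|f x|].
Proof.
move=> /nneg_abs[ma _].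
have := ma (@measurable_I01 R) `]M, +oo[%classic (measurable_itv _).
by congr measurable; apply/seteqP; split => x /=; rewrite in_itv/= andbT.
Qed.

Lemma dist_indic A (tau : R) : A `<=` I01 -> 0 <= tau ->
  [set x | I01 x /\ tau < `|\1_A x : R|] = if tau < 1 then A else set0.
Proof.
move=> AI t0; apply/seteqP; split => x /=; rewrite indicE.
  case: (boolP (x \in A)) => [/set_mem Ax|_]; rewrite /= ?normr1 ?normr0.
    by case=> _ ->.
  by case=> _ /(le_lt_trans t0); rewrite ltxx.
by case: ifP => // t1 Ax; rewrite mem_set // normr1; split => //; exact: AI.
Qed.

Lemma ri_indic A B : measurable A -> measurable B -> A `<=` I01 -> B `<=` I01 ->
  (lam A <= lam B)%E -> X (\1_B) -> X (\1_A) /\ N \1_A <= N \1_B.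
Proof.
move=> mA mB AI BI AB XB; apply: (ri_dist XB); first exact: (nneg_indic mA).1.
move=> tau t0; rewrite !dist_indic //; case: ifP => // _.
Qed.

Lemma le_indic A f : measurable A -> X f -> (forall x, A x -> 1 <= `|f x|) ->
  X (\1_A) /\ N \1_A <= N f.
Proof.
move=> mA Xf h; apply: (bfs_le hB Xf); first exact: (nneg_indic mA).1.
move=> x _; rewrite indicE; case: (boolP (x \in A)) => [/set_mem/h|_] /=.
  by rewrite normr1.
by rewrite normr0.
Qed.

Lemma gt0_level f : measurable_fun (@I01 R) f -> ~ ae_eq01 f (fun=> 0) ->
  exists n, (0 < lam [set x | I01 x /\ (n.+1%:R^-1 < `|f x|)%R])%E.
Proof.
move=> mf nf0; apply: contrapT => h; apply: nf0.
have h0 n : lam.-negligible [set x | I01 x /\ n.+1%:R^-1 < `|f x|].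
  apply/negligibleP; first exact: measurable_gt.
  apply/eqP; rewrite eq_le measure_ge0 andbT leNgt; apply/negP => hn.
  by apply: h; exists n.
apply: negligibleS (negligible_bigcup h0) => x /= /not_implyP[Ix /eqP fx].
have f0 : 0 < `|f x| by rewrite normr_gt0.
exists (Num.truncn `|f x|^-1) => //; split => //.
rewrite -[ltRHS]invrK ltf_pV2 ?posrE ?invr_gt0 //.
exact: truncnS_gt.
Qed.

(** A superlevel set [B] of a nonzero member has positive measure and an indicator in X. Finitely
    many intervals no longer than the measure of [B] cover [0,1]; their indicators lie in X by
    rearrangement, and the sum dominates 1. *)
Lemma ri_one : X (fun=> 1).
Proof.
have [f Xf nf0] := ri_nonzero hX.
have mf := bfs_measurable hB Xf.
have [n +] := gt0_level mf nf0; set B := [set x | _] => B0.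
have mB : measurable B by exact: measurable_gt.
have BI : B `<=` I01 by move=> x [].
have [XB _] : X (\1_B) /\ N \1_B <= N (fun x => n.+1%:R * f x).
  apply: le_indic => //; first exact: (bfs_scale hB).
  move=> x [_ xB]; rewrite normrM ger0_norm ?ler0n //.
  by rewrite mulrC -ler_pdivrMr ?ltr0n // div1r ltW.
have lB := lam_fin mB BI; pose d := fine (lam B).
have d0 : 0 < d by rewrite fine_gt0 // B0 ltey_eq lB.
pose m := Num.truncn d^-1.
have md : m.+1%:R^-1 <= d.
  rewrite -[leRHS]invrK lef_pV2 ?posrE ?invr_gt0 ?ltr0n //.
  exact/ltW/truncnS_gt.
pose J (k : 'I_m.+1) := [set x : T | k%:R / m.+1%:R <= (x : R) <= k.+1%:R / m.+1%:R].
have JI k : J k `<=` I01.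
  move=> x /andP[x0 x1]; rewrite /I01/= (le_trans _ x0) ?divr_ge0 ?ler0n //.
  by rewrite (le_trans x1) // ler_pdivrMr ?ltr0n // mul1r ler_nat.
have mJ k : measurable (J k).
  rewrite (_ : J k = [set` `[k%:R / m.+1%:R, (k.+1%:R / m.+1%:R : R)]]).
    exact: lam_measurable_itv.
  by apply/seteqP; split => t /=; rewrite in_itv.
have XJ k : X (\1_(J k)).
  apply: (ri_indic (mJ k) mB (JI k) BI _ XB).1.
  rewrite lam_itvcc ?ler_pM2r ?invr_gt0 ?ltr0n ?ler_nat // -(fineK lB) lee_fin.
  by rewrite -mulrBl -natrB // subSnn mul1r.
have [Xs _] := bfs_sum hB (index_enum 'I_m.+1) XJ.
apply: (bfs_le hB Xs _ _).1; first exact: measurable_cst.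
move=> x /andP[x0 x1]; rewrite normr1.
(* The index of an interval [J k] that contains [x]. *)
pose k := Num.truncn (x * m.+1%:R : R).
have xm0 : 0 <= (x : R) * m.+1%:R by rewrite mulr_ge0 ?ler0n ?ltW.
have km : (k < m.+1)%N.
  rewrite -(ltr_nat R); apply: le_lt_trans (_ : (x : R) * m.+1%:R < _).
    by rewrite truncn_le.
  by rewrite gtr_pMl ?ltr0n.
rewrite ger0_norm; last by apply: sumr_ge0 => i _; rewrite indicE ler0n.
rewrite (bigD1 (Ordinal km)) //= indicE mem_set; last first.
  rewrite /J /= ler_pdivrMr ?ltr0n // truncn_le // ler_pdivlMr ?ltr0n //=.
  by rewrite xm0 ltW // truncnS_gt.
by rewrite lerDl sumr_ge0 // => i _; rewrite indicE ler0n.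
Qed.

Lemma ri_bounded f (M : R) : measurable_fun (@I01 R) f ->
  {ae lam, forall x, I01 x -> `|f x| <= M} ->
  X f /\ N f <= `|M| * N (fun=> 1).
Proof.
move=> mf fM; rewrite -(bfs_normZ hB M ri_one).
apply: (bfs_ideal hB _ mf); first exact: (bfs_scale hB _ ri_one).
by apply: filterS fM => x h Ix; rewrite mulr1 (le_trans (h Ix)) // ler_norm.
Qed.

Lemma ri_bounded01 f (M : R) : measurable_fun (@I01 R) f ->
  (forall x, 0 < (x : R) < 1 -> `|f x| <= M) ->
  X f /\ N f <= `|M| * N (fun=> 1).
Proof. by move=> mf fM; apply: ri_bounded => //; exact: ae01W. Qed.

(** Contrapositive: suppose that all these indicators have norm at least [e]. By Chebyshev's
    inequality the indicator of the set where |f| > M has norm at most N f / M, which is below [e]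
    for the [M] chosen; so this set is null and [f] is essentially bounded. *)
Lemma ri_small (hXinf : fs_car X <> Linfty01 R) (e : R) : 0 < e ->
  exists2 eta : R, 0 < eta <= 1 & N \1_(seg0 (eta : T)) < e.
Proof.
move=> e0; apply: contrapT => h; apply: hXinf; apply/seteqP; split; last first.
  by move=> f [mf [M fM]]; exact: (ri_bounded mf fM).1.
move=> f Xf; have mf := bfs_measurable hB Xf; split => //.
pose M := N f / e + 1; exists M.
have Nf0 := bfs_norm_ge0 hB Xf.
have M0 : 0 < M by rewrite ltr_wpDl // divr_ge0 // ltW.
pose B := [set x | I01 x /\ M < `|f x|].
have mB : measurable B by exact: measurable_gt.
have BI : B `<=` I01 by move=> x [].
have lB := lam_fin mB BI; pose d := fine (lam B).
suff B0 : lam B = 0%E.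
  exists B; split => // x /= /not_implyP[Ix /negP]; rewrite -ltNge => Mf.
  by split.
apply: contrapT => /eqP lB0.
have d0 : 0 < d by rewrite fine_gt0 // lt0e lB0 measure_ge0 ltey_eq lB.
have d1 : d <= 1 by rewrite -lee_fin fineK // lam_le_I01.
have [XB NB] : X \1_B /\ N \1_B <= N (fun x => M^-1 * f x).
  apply: le_indic => //; first exact: (bfs_scale hB).
  move=> x [_ Mf]; rewrite normrM gtr0_norm ?invr_gt0 //.
  by rewrite mulrC ler_pdivlMr // mul1r ltW.
have [Xs Ns] : X \1_(seg0 (d : T)) /\ N \1_(seg0 (d : T)) <= N \1_B.
  apply: ri_indic => //.
  - exact: measurable_seg0.
  - exact: seg0_sub.
  - by rewrite /seg0 (lam_itvcc (ltW d0)) subr0 fineK.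
have : N \1_(seg0 (d : T)) < e.
  apply: le_lt_trans Ns (le_lt_trans NB _).
  rewrite (bfs_normZ hB) // gtr0_norm ?invr_gt0 // mulrC ltr_pdivrMr //.
  by rewrite /M mulrDr mulr1 mulrCA mulfV ?gt_eqF // mulr1 ltrDl.
by move=> de; apply: h; exists d => //; rewrite d0.
Qed.

End ri.

Lemma nneg_ge0 (R : realType) (f : lebT R -> R) :
  nneg f -> forall t, I01 t -> 0 <= f t.
Proof. by case. Qed.

Lemma nneg_meas (R : realType) (f : lebT R -> R) :
  nneg f -> measurable_fun (@I01 R) f.
Proof. by case. Qed.

#[local] Opaque nneg.

(** * The density of the variation *)

Section density.
Variables (R : realType) (X : funspace R) (hX : is_ri X).
Local Notation T := (lebT R).
Local Notation N := (fs_norm X).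
Local Notation hB := (ri_Bfs hX).
Implicit Types (f g : T -> R) (x y t : T) (A B : set T).

Lemma measurable_inv01 : measurable_fun (@I01 R) (fun x : T => (x : R)^-1).
Proof.
apply: antitone01_measurable => x y x0 xy _.
by rewrite lef_pV2 ?posrE // (lt_le_trans x0).
Qed.

Lemma measurable_itvcc (a b : R) : measurable ([set t : T | a <= (t : R) <= b]).
Proof.
rewrite (_ : [set t : T | _] = [set` `[a, b]]); first exact: lam_measurable_itv.
by apply/seteqP; split => t /=; rewrite in_itv.
Qed.

Lemma measurable_itvoc (a b : R) : measurable ([set t : T | a < (t : R) <= b]).
Proof.
rewrite (_ : [set t : T | _] = [set` `]a, b]]); first exact: lam_measurable_itv.
by apply/seteqP; split => t /=; rewrite in_itv.
Qed.

Lemma nneg_Fy y : nneg (Fy y).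
Proof.
split.
  apply: measurable_funM; first exact: measurable_inv01.
  exact: (nneg_meas (nneg_indic (measurable_itvcc _ _))).
by move=> t /andP[t0 _]; rewrite /Fy mulr_ge0 ?invr_ge0 // indicE ler0n.
Qed.

Lemma FyE y x : Fy y x = if (y : R) <= (x : R) <= 1 then (x : R)^-1 else 0.
Proof.
rewrite /Fy indicE; case: ifPn => yx; first by rewrite mem_set // mulr1.
by rewrite memNset ?mulr0 //; apply/negP.
Qed.

Lemma Fy_X y : 0 < (y : R) -> X (Fy y).
Proof.
move=> y0; apply: (ri_bounded01 (M := (y : R)^-1) hX (nneg_meas (nneg_Fy y)) _).1.
move=> x /andP[x0 x1]; rewrite FyE; case: ifP => [/andP[yx _]|_].
  by rewrite ger0_norm ?invr_ge0 ?(ltW x0) // lef_pV2.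
by rewrite normr0 invr_ge0 ltW.
Qed.

(* The paper's [||F_y||_X], set to 0 off (0,1]. *)
Definition phi y : R := if 0 < (y : R) <= 1 then N (Fy y) else 0.

Lemma phiE y : 0 < (y : R) <= 1 -> phi y = N (Fy y).
Proof. by rewrite /phi => ->. Qed.

Lemma phi_ge0 y : 0 <= phi y.
Proof.
rewrite /phi; case: ifP => // /andP[y0 _].
by apply: (bfs_norm_ge0 hB); exact: Fy_X.
Qed.

Lemma phi_homo x y : 0 < (x : R) -> (x : R) <= y -> (y : R) <= 1 ->
  phi y <= phi x.
Proof.
move=> x0 xy y1; have y0 := lt_le_trans x0 xy.
rewrite !phiE ?x0 ?y0 ?y1 ?(le_trans xy y1) //.
apply: (bfs_le hB (Fy_X x0) (nneg_meas (nneg_Fy y)) _).2 => t /andP[t0 t1].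
have It : I01 t by rewrite /I01/= !ltW.
rewrite !ger0_norm ?(nneg_ge0 (nneg_Fy _)) // !FyE.
case: ifP => [/andP[yt ->]|_]; first by rewrite (le_trans xy yt).
by case: ifP => // _; rewrite invr_ge0 ltW.
Qed.

Lemma nneg_phi : nneg phi.
Proof.
split; first by apply: antitone01_measurable; exact: phi_homo.
by move=> t _; exact: phi_ge0.
Qed.

Definition Iphi f : \bar R := (\int[lam]_(t in I01) (f t * phi t)%:E)%E.

Lemma measurable_phiM f : nneg f ->
  measurable_fun (@I01 R) (EFin \o (fun t => f t * phi t)).
Proof. by move=> nf; apply: nneg_EFin; [exact: subset_refl|exact: nnegM nneg_phi]. Qed.

Lemma Iphi_ge0 f : nneg f -> (0 <= Iphi f)%E.
Proof.
move=> nf; apply: integral_ge0 => t It.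
by rewrite lee_fin mulr_ge0 ?phi_ge0 // (nneg_ge0 nf).
Qed.

Lemma Iphi_le f g : nneg f -> nneg g -> (forall t, I01 t -> f t <= g t) ->
  (Iphi f <= Iphi g)%E.
Proof.
move=> nf ng fg; apply: (ge0_le_integral _ (@measurable_I01 R)).
- by move=> t It; rewrite lee_fin (nneg_ge0 (nnegM nf nneg_phi)).
- exact: measurable_phiM.
- exact: measurable_phiM.
- by move=> t It; rewrite lee_fin ler_wpM2r ?phi_ge0 // fg.
Qed.

Lemma IphiD f g : nneg f -> nneg g ->
  Iphi (fun t => f t + g t) = (Iphi f + Iphi g)%E.
Proof.
move=> nf ng; rewrite /Iphi.
under eq_integral do rewrite mulrDl EFinD.
apply: (ge0_integralD _ (@measurable_I01 R)).
- by move=> t It; rewrite lee_fin (nneg_ge0 (nnegM nf nneg_phi)).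
- exact: measurable_phiM.
- by move=> t It; rewrite lee_fin (nneg_ge0 (nnegM ng nneg_phi)).
- exact: measurable_phiM.
Qed.

Lemma IphiZ (c : R) f : 0 <= c -> nneg f ->
  Iphi (fun t => c * f t) = (c%:E * Iphi f)%E.
Proof.
move=> c0 nf; rewrite /Iphi; under eq_integral do rewrite -mulrA EFinM.
apply: (ge0_integralZl_EFin _ (@measurable_I01 R)) => //.
- by move=> t It; rewrite lee_fin (nneg_ge0 (nnegM nf nneg_phi)).
- exact: measurable_phiM.
Qed.

Lemma eq_Iphi f g : (forall t, I01 t -> f t = g t) -> Iphi f = Iphi g.
Proof. by move=> fg; apply: eq_integral => t; rewrite inE => /fg ->. Qed.

Lemma ae_eq_Iphi f g : nneg f -> nneg g -> ae_eq01 f g -> Iphi f = Iphi g.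
Proof.
move=> nf ng fg; apply: (ge0_ae_eq_integral (@measurable_I01 R)).
- exact: measurable_phiM.
- exact: measurable_phiM.
- by move=> t It; rewrite lee_fin (nneg_ge0 (nnegM nf nneg_phi)).
- by move=> t It; rewrite lee_fin (nneg_ge0 (nnegM ng nneg_phi)).
- by apply: filterS fg => t h It; rewrite h.
Qed.

Lemma nneg_sum (I : Type) (r : seq I) (F : I -> T -> R) : (forall i, nneg (F i)) ->
  nneg (fun t => \sum_(i <- r) F i t).
Proof.
move=> nF; elim: r => [|i r IH].
  by under eq_fun do rewrite big_nil; apply: nneg_cst.
by under eq_fun do rewrite big_cons; apply: nnegD.
Qed.

Lemma locint_sum (I : Type) (r : seq I) (F : I -> T -> R) :
  (forall i, locint (F i)) -> locint (fun t => \sum_(i <- r) F i t).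
Proof.
move=> lF; elim: r => [|i r IH].
  under eq_fun do rewrite big_nil.
  by apply: (bounded_locint (nneg_cst (lexx 0)) (M := 0)).
by under eq_fun do rewrite big_cons; apply: locintD.
Qed.

Lemma ces0 x : ces (fun=> 0 : R) x = 0.
Proof. by rewrite /ces cesaro_opE /cint integral0 mule0. Qed.

Lemma ces_sum (I : Type) (r : seq I) (F : I -> T -> R) x :
  (0 <= (x : R) < 1) -> (forall i, locint (F i)) ->
  ces (fun t => \sum_(i <- r) F i t) x = \sum_(i <- r) ces (F i) x.
Proof.
move=> x01 lF; elim: r => [|i r IH].
  by under eq_fun do rewrite big_nil; rewrite big_nil ces0.
under eq_fun do rewrite big_cons.
by rewrite (cesD x01 (lF i) (locint_sum r lF)) IH big_cons.
Qed.

Lemma Iphi_sum (I : Type) (r : seq I) (F : I -> T -> R) : (forall i, nneg (F i)) ->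
  Iphi (fun t => \sum_(i <- r) F i t) = (\sum_(i <- r) Iphi (F i))%E.
Proof.
move=> nF; elim: r => [|i r IH].
  under eq_fun do rewrite big_nil.
  rewrite big_nil /Iphi; under eq_integral do rewrite mul0r.
  exact: integral0.
under eq_fun do rewrite big_cons.
by rewrite (IphiD (nF i) (nneg_sum r nF)) IH big_cons.
Qed.

Definition bsupp (d M : R) f := [/\ nneg f, forall t, I01 t -> f t <= M &
  forall t, I01 t -> (t : R) <= d -> f t = 0].

Lemma ces_X f (M : R) : nneg f -> (forall t, I01 t -> f t <= M) -> X (ces f).
Proof.
move=> nf fM; have i0 : I01 (0 : T) by rewrite /I01/= lexx ler01.
have M0 : 0 <= M by exact: le_trans ((nneg_ge0 nf) _ i0) (fM _ i0).
apply: (ri_bounded01 hX (M := M) (ces_measurable nf) _).1 => x /andP[x0 x1].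
have Ix : I01 x by rewrite /I01/= !ltW.
by rewrite ger0_norm ?ces_ge0 // ces_bound.
Qed.

Lemma I01_1 : I01 (1 : T).
Proof. by rewrite /I01/= ler01 lexx. Qed.

Lemma cint1_fin f (M : R) : nneg f -> (forall t, I01 t -> f t <= M) ->
  cint f (1 : T) \is a fin_num.
Proof.
move=> nf fM; rewrite ge0_fin_numE; last exact: cint_ge0.
by apply: le_lt_trans (cint_bound I01_1 nf fM) _; rewrite ltry.
Qed.

Section piece.
Variables (g : T -> R) (M : R) (a b : R).
Hypotheses (ng : nneg g) (gM : forall t, I01 t -> g t <= M).
Hypotheses (a0 : 0 < a) (ab : a <= b) (b1 : b <= 1).
Hypothesis (gab : forall t, I01 t -> g t != 0 -> a <= (t : R) <= b).
Let c := fine (cint g (1 : T)).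
Let b0 : 0 < b := lt_le_trans a0 ab.
Let a1 : a <= 1 := le_trans ab b1.

Lemma piece_c0 : 0 <= c.
Proof. by rewrite fine_ge0 // cint_ge0. Qed.

Let cE : cint g (1 : T) = c%:E.
Proof. by rewrite fineK // (cint1_fin ng gM). Qed.

(** For [x >= b] the integral up to [x] has collected all the mass [c] of [g]; for [x < a] it is 0;
    in between it is at most [c]. *)
Lemma piece_ces x : 0 < (x : R) < 1 ->
  c * Fy (b : T) x <= ces g x <= c * Fy (a : T) x.
Proof.
move=> /andP[x0 x1]; have lg := bounded_locint ng gM.
have x01 : 0 <= (x : R) < 1 by rewrite ltW.
have Ix : I01 x by rewrite /I01/= !ltW.
have cx := cint_fin lg x01.
apply/andP; split; rewrite FyE (ltW x1) andbT.
  case: ifP => bx; last by rewrite mulr0 ces_ge0.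
  rewrite cesE // mulrC; apply: ler_wpM2l; first by rewrite invr_ge0 ltW.
  rewrite -lee_fin (fineK cx) -[c%:E]cE le_eqVlt; apply/orP; left; apply/eqP.
  rewrite /cint integral_mkcond [RHS]integral_mkcond; apply: eq_integral => t _.
  rewrite !patchE; case: ifPn => [/set_mem It|].
    case: ifPn => // /negP h; congr EFin; apply/eqP/negP => gt.
    have It' : I01 t by [].
    have /andP[_ tb] := gab It' (introN idP gt); apply: h; rewrite inE.
    by case/andP: It' => t0 _; rewrite /seg0/= t0 (le_trans tb).
  case: ifPn => // /set_mem h /negP; case; rewrite inE.
  exact: (seg0_sub (ltW x1)).
case: ifP => ax.
  rewrite cesE // [leRHS]mulrC; apply: ler_wpM2l; first by rewrite invr_ge0 ltW.
  by rewrite -lee_fin (fineK cx) -[c%:E]cE; apply: cint_homo => //; exact: ltW.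
rewrite mulr0 cesE // (_ : cint g x = 0%E) ?mulr0 //.
apply: integral0_eq => t h; have It := seg0_sub (ltW x1) h.
congr EFin; apply/eqP/negP => /negP gt; have /andP[at_ _] := gab It gt.
by case/andP: h => _ tx; rewrite (le_trans at_ tx) in ax.
Qed.

Lemma piece_norm : c * phi (b : T) <= N (ces g) <= c * phi (a : T).
Proof.
have c0 := piece_c0.
rewrite !phiE ?a0 ?b0 ?a1 //; have Xg := ces_X ng gM.
rewrite -[X in X * _ <= _](ger0_norm c0) -[X in _ <= X * _](ger0_norm c0).
rewrite -(bfs_normZ hB _ (Fy_X b0)) -(bfs_normZ hB _ (Fy_X a0)).
apply/andP; split.
  apply: (bfs_le hB Xg _ _).2.
    exact: (nneg_meas (nnegZ c0 (nneg_Fy _))).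
  move=> x x01; have /andP[h _] := piece_ces x01; case/andP: x01 => x0 x1.
  have Ix : I01 x by rewrite /I01/= !ltW.
  by rewrite !ger0_norm ?ces_ge0 // mulr_ge0 // (nneg_ge0 (nneg_Fy _)).
apply: (bfs_le hB _ (ces_measurable ng) _).2.
  by apply: (bfs_scale hB); exact: Fy_X.
move=> x x01; have /andP[_ h] := piece_ces x01; case/andP: x01 => x0 x1.
have Ix : I01 x by rewrite /I01/= !ltW.
by rewrite !ger0_norm ?ces_ge0 // mulr_ge0 // (nneg_ge0 (nneg_Fy _)).
Qed.

(** [phi] is nonincreasing on the support. The bounds are those of [piece_norm], so [N (ces g)] and
    [Iphi g] differ by at most [c * (phi a - phi b)]. *)
Lemma piece_Iphi : ((c * phi (b : T))%:E <= Iphi g <= (c * phi (a : T))%:E)%E.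
Proof.
have E (k : R) : 0 <= k ->
    (c * k)%:E = (\int[lam]_(t in I01) (k * g t)%:E)%E.
  by move=> k0; rewrite mulrC EFinM -[c%:E]cE -(cintZ _ k0 ng).
rewrite !E ?phi_ge0 //.
have mk (k : R) : 0 <= k -> measurable_fun (@I01 R) (EFin \o (fun t => k * g t)).
  by move=> k0; apply: nneg_EFin; [exact: subset_refl|exact: nnegZ].
have mp : measurable_fun (@I01 R) (EFin \o (fun t => g t * phi t)).
  exact: measurable_phiM.
apply/andP; split.
- apply: (ge0_le_integral _ (@measurable_I01 R)).
  + by move=> t It; rewrite lee_fin mulr_ge0 ?phi_ge0 // (nneg_ge0 ng).
  + by apply: mk; exact: phi_ge0.
  + exact: mp.
  + move=> t It; rewrite lee_fin mulrC.
    have [->|gt] := eqVneq (g t) 0; first by rewrite !mul0r.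
    have /andP[at_ tb] := gab It gt; apply: ler_wpM2l; first exact: (nneg_ge0 ng).
    by apply: phi_homo => //; exact: lt_le_trans at_.
- apply: (ge0_le_integral _ (@measurable_I01 R)).
  + by move=> t It; rewrite lee_fin mulr_ge0 ?phi_ge0 // (nneg_ge0 ng).
  + exact: mp.
  + by apply: mk; exact: phi_ge0.
  + move=> t It; rewrite lee_fin mulrC.
    have [->|gt] := eqVneq (g t) 0; first by rewrite !mulr0.
    have /andP[at_ tb] := gab It gt; apply: ler_wpM2r; first exact: (nneg_ge0 ng).
    by apply: phi_homo => //; case/andP: It.
Qed.

Lemma piece_c : c <= M * (b - a).
Proof.
have M0 : 0 <= M by exact: le_trans ((nneg_ge0 ng) _ I01_1) (gM I01_1).
rewrite -lee_fin -[c%:E]cE.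
have sI : [set t : T | a <= (t : R) <= b] `<=` I01.
  by move=> t /andP[t0 t1]; rewrite /I01/= (le_trans (ltW a0) t0) (le_trans t1).
have mab := measurable_itvcc a b.
rewrite /cint (_ : (\int[lam]_(t in seg0 (1%R : T)) (g t)%:E)%E =
   (\int[lam]_(t in [set t : T | (a <= (t : R) <= b)%R]) (g t)%:E)%E); last first.
  rewrite integral_mkcond [RHS]integral_mkcond; apply: eq_integral => t _.
  rewrite !patchE; case: ifPn => [/set_mem It|].
    case: ifPn => // /negP h; congr EFin; apply/eqP/negP => /negP gt.
    by apply: h; rewrite inE; exact: gab.
  by case: ifPn => // /set_mem h /negP; case; rewrite inE; exact: sI.
apply: (@le_trans _ _ (\int[lam]_(t in [set t : T | (a <= (t : R) <= b)%R]) (cst M%:E t))%E).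
  apply: (ge0_le_integral _ mab).
  - by move=> t /sI It; rewrite lee_fin (nneg_ge0 ng).
  - exact: nneg_EFin.
  - exact: measurable_cst.
  - by move=> t /sI It; rewrite lee_fin gM.
by rewrite (integral_cst _ mab) /= (lam_itvcc ab) -EFinM.
Qed.

End piece.

(** Half open, so that consecutive cells are disjoint and their indicators add up exactly. *)
Definition cell (a : nat -> R) i : set T := [set t : T | a i < (t : R) <= a i.+1].

Lemma measurable_cell (a : nat -> R) i : measurable (cell a i).
Proof. exact: measurable_itvoc. Qed.

Lemma cell_sum (a : nat -> R) n t : (forall i, a i <= a i.+1) ->
  \sum_(i < n) \1_(cell a i) t = \1_[set t : T | a 0 < (t : R) <= a n] t :> R.
Proof.
move=> a_nd; elim: n => [|n IH].
  rewrite big_ord0 indicE memNset // => /andP[h1 h2].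
  by have := lt_le_trans h1 h2; rewrite ltxx.
rewrite big_ord_recr /= IH !indicE -natrD; congr (_%:R).
have a0n : a 0 <= a n by elim: (n) => // m h; exact: le_trans h (a_nd m).
have E (u v : R) : (t \in [set t : T | u < (t : R) <= v]) = (u < (t : R) <= v).
  by apply/idP/idP => [/set_mem|h]; rewrite ?inE.
rewrite /cell !E; case: (ltP (a 0) t) => h0 /=.
  case: (leP (t : R) (a n)) => h1 /=; first by rewrite (le_trans h1 (a_nd n)).
  by case: (_ <= _).
by rewrite ltNge (le_trans h0 a0n).
Qed.

Definition part (d : R) n (i : nat) : R := d + i%:R * ((1 - d) / n.+1%:R).

Lemma part0 d n : part d n 0 = d.
Proof. by rewrite /part mul0r addr0. Qed.

Lemma part1 d n : part d n n.+1 = 1.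
Proof. by rewrite /part mulrCA mulfV ?mulr1 ?pnatr_eq0 // addrCA subrr addr0. Qed.

Lemma partS d n i : part d n i.+1 = part d n i + (1 - d) / n.+1%:R.
Proof. by rewrite /part -natr1 mulrDl mul1r addrA. Qed.

Lemma part_nd d n : d < 1 -> {homo part d n : i j / (i <= j)%N >-> i <= j}.
Proof.
move=> d1 i j ij; rewrite /part lerD2l ler_wpM2r ?ler_nat //.
by rewrite divr_ge0 ?ler0n // subr_ge0 ltW.
Qed.

Definition fcell f d n i t : R := f t * \1_(cell (part d n) i) t.

Lemma fcell_nneg f d n i : nneg f -> nneg (fcell f d n i).
Proof. by move=> nf; apply: nnegM => //; apply: nneg_indic; exact: measurable_cell. Qed.

Lemma fcell_le f d n i t : 0 <= f t -> fcell f d n i t <= f t.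
Proof.
by move=> f0; rewrite /fcell indicE; case: (_ \in _); rewrite ?mulr1 ?mulr0.
Qed.

Lemma fcell_sum f d M n t : bsupp d M f -> d < 1 -> I01 t ->
  f t = \sum_(i < n.+1) fcell f d n i t.
Proof.
move=> [nf fM f0] d1 It; rewrite /fcell -mulr_sumr cell_sum; last first.
  by move=> i; exact: part_nd.
rewrite part0 part1 indicE.
have [td|dt] := leP (t : R) d; first by rewrite f0 // mul0r.
by rewrite mem_set ?mulr1 //= dt; case/andP: It.
Qed.

(** A cell has width at most 1/(n+1), so it carries mass at most M/(n+1) and contributes an error of
    at most M/(n+1) times the drop of [phi] across it. The drops telescope to at most [phi d]. *)
Lemma norm_fcell f d M n : bsupp d M f -> 0 < d < 1 ->
  `|\sum_(i < n.+1) N (ces (fcell f d n i)) - fine (Iphi f)| <=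
  M * phi (d : T) / n.+1%:R.
Proof.
move=> bf /andP[d0 d1]; have [nf fM f0] := bf.
pose a := part d n; pose F (i : 'I_n.+1) := fcell f d n i.
have nF i : nneg (F i) by exact: fcell_nneg.
have FM i t : I01 t -> F i t <= M.
  by move=> It; apply: le_trans (fcell_le _ _ _ ((nneg_ge0 nf) _ It)) (fM _ It).
have a0 i : 0 < a i by apply: lt_le_trans d0 _; rewrite -{1}(part0 d n) part_nd.
have a1 (i : 'I_n.+1) : a i.+1 <= 1.
  by rewrite -(part1 d n); apply: part_nd.
have aS i : a i <= a i.+1 by exact: part_nd.
have Fab i t : I01 t -> F i t != 0 -> a i <= (t : R) <= a i.+1.
  move=> _; rewrite /F /fcell indicE.
  case: (boolP (t \in _)) => [/set_mem/andP[h1 h2] _|_]; last by rewrite mulr0 eqxx.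
  by rewrite (ltW h1).
pose c i := fine (cint (F i) (1 : T)).
have H1 i := piece_norm (nF i) (FM i) (a0 i) (aS i) (a1 i) (@Fab i).
have H2 i := piece_Iphi (nF i) (FM i) (a0 i) (a1 i) (@Fab i).
have H3 i := piece_c (nF i) (FM i) (a0 i) (aS i) (a1 i) (@Fab i).
have Ifin i : Iphi (F i) \is a fin_num.
  have /andP[_ h] := H2 i.
  by rewrite ge0_fin_numE ?Iphi_ge0 // (le_lt_trans h) ?ltry.
have -> : fine (Iphi f) = \sum_(i < n.+1) fine (Iphi (F i)).
  rewrite (@eq_Iphi _ (fun t => \sum_(i < n.+1) F i t)); last first.
    by move=> t It; exact: fcell_sum bf d1 It.
  rewrite (Iphi_sum _ nF).
  by rewrite (eq_bigr (fun i => (fine (Iphi (F i)))%:E)) ?sumEFin // => i _;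
    rewrite fineK.
rewrite -sumrB.
apply: le_trans (ler_norm_sum _ _ _) _.
have M0 : 0 <= M by exact: le_trans ((nneg_ge0 nf) _ I01_1) (fM _ I01_1).
apply: (@le_trans _ _ (\sum_(i < n.+1) M / n.+1%:R * (phi (a i : T) - phi (a i.+1 : T)))).
  apply: ler_sum => i _.
  have /andP[h1 h2] := H1 i; have /andP[] := H2 i.
  rewrite -(fineK (Ifin i)) !lee_fin => h3 h4.
  have pd : 0 <= phi (a i : T) - phi (a i.+1 : T).
    by rewrite subr_ge0 phi_homo.
  apply: (@le_trans _ _ (c i * (phi (a i : T) - phi (a i.+1 : T)))).
    rewrite ler_norml mulrBr opprB; apply/andP; split.
      by rewrite lerB.
    by rewrite lerB.
  apply: ler_wpM2r => //; apply: le_trans (H3 i) _.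
  apply: ler_wpM2l => //; rewrite /a partS addrAC subrr add0r.
  by rewrite ler_pdivrMr ?ltr0n // mulVf ?pnatr_eq0 // gerBl ltW.
rewrite -mulr_sumr mulrAC; apply: ler_wpM2r; first by rewrite invr_ge0 ler0n.
apply: ler_wpM2l => //.
have -> : \sum_(i < n.+1) (phi (a i : T) - phi (a i.+1 : T)) =
    phi (a 0 : T) - phi (a n.+1 : T).
  elim: (n.+1) => [|m IH]; first by rewrite big_ord0 subrr.
  by rewrite big_ord_recr /= IH addrA subrK.
by rewrite /a part0 gerBl phi_ge0.
Qed.

Lemma bsupp_Iphi_fin f d M : bsupp d M f -> 0 < d < 1 ->
  Iphi f \is a fin_num.
Proof.
move=> [nf fM f0] /andP[d0 d1].
have M0 : 0 <= M by exact: le_trans ((nneg_ge0 nf) _ I01_1) (fM _ I01_1).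
have fd t : I01 t -> f t != 0 -> d <= (t : R) <= 1.
  move=> It ft; case/andP: (It) => t0 ->; rewrite andbT leNgt; apply/negP => td.
  by rewrite f0 ?eqxx // ltW in ft.
have /andP[_ h] := piece_Iphi nf fM d0 (lexx 1) fd.
rewrite ge0_fin_numE; last exact: Iphi_ge0.
by apply: le_lt_trans h _; rewrite ltry.
Qed.

(** Triangle inequality over the cells, then [norm_fcell] with arbitrarily many cells. *)
Lemma bsupp_norm_le f d M : bsupp d M f -> 0 < d < 1 ->
  ((N (ces f))%:E <= Iphi f)%E.
Proof.
move=> bf d01; have [nf fM f0] := bf; have /andP[d0 d1] := d01.
have fin := bsupp_Iphi_fin bf d01.
rewrite -(fineK fin) lee_fin; apply/ler_addgt0Pr => e e0.
have M0 : 0 <= M by exact: le_trans ((nneg_ge0 nf) _ I01_1) (fM _ I01_1).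
pose n := Num.truncn (M * phi (d : T) / e).
have ne : M * phi (d : T) / n.+1%:R <= e.
  rewrite ler_pdivrMr ?ltr0n // [leRHS]mulrC -ler_pdivrMr //.
  by rewrite ltW // truncnS_gt.
have h := norm_fcell n bf d01.
have nF (i : 'I_n.+1) : nneg (fcell f d n i) by exact: fcell_nneg.
have FM (i : 'I_n.+1) t : I01 t -> fcell f d n i t <= M.
  by move=> It; apply: le_trans (fcell_le _ _ _ ((nneg_ge0 nf) _ It)) (fM _ It).
have XF (i : 'I_n.+1) : X (ces (fcell f d n i)) := ces_X (nF i) (FM i).
have [Xs Ns] := bfs_sum hB (index_enum 'I_n.+1) XF.
have le1 : N (ces f) <= \sum_(i < n.+1) N (ces (fcell f d n i)).
  apply: le_trans Ns; rewrite le_eqVlt; apply/orP; left; apply/eqP.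
  apply: (bfs_eq hB Xs (ces_measurable nf) _).2 => x /andP[x0 x1].
  rewrite -(ces_sum _ _ (fun i => bounded_locint (nF i) (FM i))) ?(ltW x0) //.
  by apply: eq_ces; [exact: ltW|move=> t It; rewrite -(fcell_sum _ bf)].
apply: le_trans le1 _; rewrite -lerBlDl; apply: le_trans (ler_norm _) _.
exact: le_trans h ne.
Qed.

(** [n.+2] rather than [n.+1]: a point at most 1/(n+2) lies strictly below the cut 1/(n+1), and
    1/(n+2) < 1 holds for [n = 0] as well. *)
Lemma trunc_bsupp n f : nneg f -> bsupp n.+2%:R^-1 n%:R (trunc n f).
Proof.
move=> nf; split; first exact: trunc_nneg.
- by move=> t _; exact: trunc_bound.
- move=> t _ h; apply: trunc_supp; apply: le_lt_trans h _.
  by rewrite ltf_pV2 ?posrE ?ltr0n // ltr_nat.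
Qed.

Lemma inv_n2 n : 0 < (n.+2%:R^-1 : R) < 1.
Proof. by rewrite invr_gt0 ltr0n invf_lt1 ?ltr0n // ltr1n. Qed.

End density.

(** * Monotone limits and the positive cone of the Cesaro space *)

Section cx.
Variables (R : realType) (X : funspace R) (hX : is_ri X).
Local Notation T := (lebT R).
Local Notation N := (fs_norm X).
Local Notation hB := (ri_Bfs hX).
Implicit Types (f g : T -> R) (x y t : T) (A B : set T).

Lemma ae01_exists (P : T -> Prop) (x0 : R) : 0 <= x0 < 1 ->
  {ae lam, forall x, I01 x -> P x} -> exists2 x : T, x0 < (x : R) < 1 & P x.
Proof.
move=> /andP[x00 x01] [A [mA A0 AP]]; apply: contrapT => h.
(* The middle third of (x0, 1) has positive measure, so no null set contains it. *)
pose a := (2 * x0 + 1) / 3; pose b := (x0 + 2) / 3.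
have ax : x0 < a by rewrite /a; lra.
have ab : a < b by rewrite /a /b; lra.
have b1 : b < 1 by rewrite /b; lra.
have sA : [set t : T | a <= (t : R) <= b] `<=` A.
  move=> t /andP[t0 t1]; apply: AP => /= Pt; apply: h; exists t.
    by rewrite (lt_le_trans ax t0) (le_lt_trans t1 b1).
  apply: Pt; rewrite /I01/= (le_trans _ t0) ?(le_trans t1 (ltW b1)) //.
  exact: le_trans x00 (ltW ax).
have : (lam [set t : T | (a <= (t : R) <= b)%R] <= lam A)%E.
  by apply: le_measure sA; rewrite inE //; exact: measurable_itvcc.
by rewrite A0 (lam_itvcc (ltW ab)) lee_fin subr_le0 leNgt ab.
Qed.

(** Replaces the Fatou property: completeness supplies a limit in norm, and monotonicity of the
    sequence shows that this limit dominates every term almost everywhere. *)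
Lemma mono_limit (u : nat -> T -> R) (c : R) : (forall n, X (u n)) ->
  (forall n x, 0 < (x : R) < 1 -> u n x <= u n.+1 x) ->
  (forall e : R, 0 < e -> exists n0, forall m n, (n0 <= m)%N -> (n0 <= n)%N ->
       N (fun x => u m x - u n x) < e) ->
  (forall n, N (u n) <= c) ->
  exists g, [/\ X g, forall n, {ae lam, forall x, I01 x -> u n x <= g x} &
    N g <= c].
Proof.
move=> Xu u_nd uC uc; have [g Xg ug] := bfs_complete hB Xu uC.
have ugm (e : R) n : 0 < e -> exists2 m, (n <= m)%N & N (fun x => u m x - g x) < e.
  move=> e0; have /cvgr0Pnorm_lt/(_ _ e0)[m0 _ h] := ug.
  exists (maxn n m0); first exact: leq_maxl.
  apply: le_lt_trans (ler_norm _) _; apply: h; exact: leq_maxr.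
have und n m x : (n <= m)%N -> 0 < (x : R) < 1 -> u n x <= u m x.
  move=> /subnKC <- x01; elim: (m - n)%N => [|k IH]; first by rewrite addn0.
  by rewrite addnS (le_trans IH) // u_nd.
exists g; split => // [n|]; last first.
  apply/ler_addgt0Pr => e e0; have [m _ hm] := ugm e 0 e0.
  have Xd : X (fun x => u m x - g x) by exact: (bfs_sub hB).
  rewrite (_ : N g = N (fun x => u m x - (u m x - g x))); last first.
    by congr N; apply/funext => x; rewrite subKr.
  apply: le_trans (bfs_norm_sub hB (Xu m) Xd) _.
  by rewrite lerD // ltW.
(* Inside (0,1), [0 <= h <= |u m - g|] for all [m >= n]. The right side has arbitrarily small norm,
   so [h] vanishes almost everywhere. *)
pose h x := Num.max (u n x - g x) 0.
have mu k : measurable_fun (@I01 R) (u k) by exact: (bfs_measurable hB).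
have mg := bfs_measurable hB Xg.
have mh : measurable_fun (@I01 R) h.
  by apply: measurable_maxr; [exact: measurable_funB|exact: measurable_cst].
have hm m : (n <= m)%N -> X h /\ N h <= N (fun x => u m x - g x).
  move=> nm; apply: (bfs_le hB) => //; first exact: (bfs_sub hB).
  move=> x x01; have := und _ _ _ nm x01; rewrite /h ger0_norm ?le_max ?lexx ?orbT //.
  rewrite ge_max normr_ge0 andbT => umn.
  by apply: le_trans (ler_norm _); rewrite lerD2r.
have Xh : X h by exact: (hm n (leqnn _)).1.
have h0 : N h = 0.
  apply/eqP; rewrite eq_le (bfs_norm_ge0 hB Xh) andbT.
  apply/ler_addgt0Pr => e e0; rewrite add0r.
  by have [m nm me] := ugm e n e0; apply: le_trans (hm _ nm).2 (ltW me).
have := bfs_norm0_eq0 hB Xh h0; apply: filterS => x hx Ix.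
by rewrite -subr_le0 -(hx Ix) /h le_max lexx.
Qed.

Lemma cint_ces f x : locint f -> 0 < (x : R) < 1 ->
  cint f x = ((x : R) * ces f x)%:E.
Proof.
move=> lf /andP[x0 x1]; have x01 : 0 <= (x : R) < 1 by rewrite ltW.
by rewrite cesE // mulrA mulfV ?gt_eqF // mul1r fineK // cint_fin.
Qed.

Lemma ces_le_of_cint f x (c : R) : locint f -> 0 < (x : R) < 1 ->
  (cint f x <= ((x : R) * c)%:E)%E -> ces f x <= c.
Proof.
move=> lf x01; rewrite cint_ces // lee_fin ler_pM2l //.
by case/andP: x01.
Qed.

Lemma locint_ae f : nneg f -> {ae lam, forall x, I01 x -> (cint f x < +oo)%E} ->
  locint f.
Proof.
move=> nf h; split => // x x01.
have [y /andP[xy y1] hy] := ae01_exists x01 h.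
by apply: le_lt_trans hy; apply: cint_homo => //; exact: ltW.
Qed.

(** Monotone convergence of the integrals up to [x]. Finiteness at almost every [x] gives finiteness
    at every [x < 1], because the integral grows with [x]. *)
Lemma ces_sup f g : nneg f ->
  (forall n, {ae lam, forall x, I01 x -> ces (trunc n f) x <= g x}) ->
  locint f /\ {ae lam, forall x, I01 x -> ces f x <= g x}.
Proof.
move=> nf /ae_foralln h.
have h1 : {ae lam, forall x, I01 x -> 0 < (x : R) < 1}.
  exact: ae01W.
have h2 : {ae lam, forall x, I01 x -> (0 < (x : R) < 1) /\
    (cint f x <= ((x : R) * g x)%:E)%E}.
  move: h h1; apply: filterS2 => x h h1 Ix; have x01 := h1 Ix; split => //.
  have /andP[x0 x1] := x01.
  apply: cint_trunc_sup => //; first exact: ltW.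
  move=> n; rewrite cint_ces //; last first.
    exact: bounded_locint (trunc_nneg n nf) (fun t _ => trunc_bound n f t).
  by rewrite lee_fin ler_pM2l // h.
have lf : locint f.
  apply: locint_ae => //; apply: filterS h2 => x h2 Ix; have [_] := h2 Ix.
  by move=> /le_lt_trans; apply; rewrite ltry.
split => //; apply: filterS h2 => x h2 Ix; have [x01 h3] := h2 Ix.
exact: ces_le_of_cint.
Qed.

Lemma cauchy_of_mono (a : nat -> R) (c e : R) : nondecreasing_seq a ->
  (forall n, a n <= c) -> 0 < e ->
  exists n0, forall m n, (n0 <= n)%N -> (n <= m)%N -> a m - a n < e.
Proof.
move=> a_nd ac e0.
have cv : cvgn a.
  by apply: nondecreasing_is_cvgn => //; exists c => _ [n _ <-].
have /cvgrPdist_lt/(_ _ e0)[n0 _ h] := cv; exists n0 => m n n0n nm.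
have ml : a m <= limn a by exact: nondecreasing_cvgn_le.
apply: le_lt_trans (h n n0n); apply: le_trans (ler_norm _).
by rewrite lerD2r.
Qed.

Lemma Iphi_norm_le f : nneg f -> (Iphi X f < +oo)%E ->
  [/\ locint f, X (ces f) & ((N (ces f))%:E <= Iphi X f)%E].
Proof.
move=> nf fi.
have Ifin : Iphi X f \is a fin_num by rewrite ge0_fin_numE // Iphi_ge0.
have tb n := trunc_bsupp n nf.
have tn n := trunc_nneg n nf.
have tM n t : I01 t -> trunc n f t <= n%:R by move=> _; exact: trunc_bound.
have tl n : locint (trunc n f) := bounded_locint (tn n) (tM n).
pose A n := fine (Iphi X (trunc n f)).
have AE n : Iphi X (trunc n f) = (A n)%:E.
  by rewrite fineK // (bsupp_Iphi_fin hX (tb n) (inv_n2 _ n)).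
have Ac n : A n <= fine (Iphi X f).
  rewrite -lee_fin -AE fineK //; apply: (Iphi_le hX) => // t It.
  by apply: trunc_le; exact: (nneg_ge0 nf).
pose D m n t := trunc m f t - trunc n f t.
have mono m n t : I01 t -> (n <= m)%N -> trunc n f t <= trunc m f t.
  by move=> It; apply: trunc_homo; exact: (nneg_ge0 nf).
have nD m n : (n <= m)%N -> nneg (D m n).
  by move=> nm; apply: nnegB => // t It; exact: mono.
(* [D m n] vanishes wherever [trunc m f] does, so [bsupp_norm_le] bounds the norms of the increments
   by [A m - A n]. *)
have bD m n : (n <= m)%N -> bsupp m.+2%:R^-1 m%:R (D m n).
  move=> nm; split; first exact: nD.
    move=> t It; apply: le_trans (tM m t It); rewrite gerBl.
    exact: (nneg_ge0 (tn n)).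
  move=> t It td; rewrite /D.
  have [_ _ h] := tb m; have hm := h _ It td; rewrite hm sub0r.
  suff -> : trunc n f t = 0 by rewrite oppr0.
  apply/eqP; rewrite eq_le (nneg_ge0 (tn n)) // andbT.
  by rewrite -hm mono.
have ID m n : (n <= m)%N -> (Iphi X (D m n) = (A m - A n)%:E)%E.
  move=> nm; have : Iphi X (trunc m f) = (Iphi X (trunc n f) + Iphi X (D m n))%E.
    rewrite -(IphiD hX (tn n) (nD _ _ nm)); apply: eq_Iphi => t _.
    by rewrite /D addrC subrK.
  have fD := bsupp_Iphi_fin hX (bD _ _ nm) (inv_n2 _ m).
  by rewrite !AE -(fineK fD) -EFinD => -[->]; rewrite addrAC subrr add0r.
have A_nd : nondecreasing_seq A.
  by move=> n m nm; rewrite -subr_ge0 -lee_fin -ID // Iphi_ge0 //; exact: nD.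
have cD m n x : (n <= m)%N -> 0 < (x : R) < 1 ->
    ces (D m n) x = ces (trunc m f) x - ces (trunc n f) x.
  move=> nm /andP[x0 x1]; have x01 : 0 <= (x : R) < 1 by rewrite ltW.
  have [_ bDM _] := bD _ _ nm.
  have lD := bounded_locint (nD _ _ nm) bDM.
  apply/eqP; rewrite eq_sym subr_eq -(cesD x01 lD (tl n)); apply/eqP.
  by apply: eq_ces; [exact: ltW|move=> t _; rewrite /D subrK].
have Xt n : X (ces (trunc n f)) := ces_X hX (tn n) (tM n).
have ND m n : (n <= m)%N ->
    N (fun x => ces (trunc m f) x - ces (trunc n f) x) <= A m - A n.
  move=> nm; rewrite -lee_fin -ID //.
  apply: le_trans (bsupp_norm_le hX (bD _ _ nm) (inv_n2 _ m)).
  rewrite lee_fin le_eqVlt; apply/orP; left; apply/eqP.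
  have [_ bDM _] := bD _ _ nm.
  apply: (bfs_eq hB (ces_X hX (nD _ _ nm) bDM) _ _).2.
    by apply: measurable_funB; apply: ces_measurable.
  by move=> x x01; rewrite cD.
have Nt n : N (ces (trunc n f)) <= fine (Iphi X f).
  apply: le_trans (Ac n); rewrite -lee_fin -AE.
  exact: bsupp_norm_le (tb n) (inv_n2 _ n).
have [g [Xg ug Ng]] : exists g, [/\ X g,
    forall n, {ae lam, forall x, I01 x -> ces (trunc n f) x <= g x} &
    N g <= fine (Iphi X f)].
  apply: mono_limit => //.
    move=> n x /andP[x0 x1]; apply: ces_le => //; first by rewrite ltW.
    by move=> t It; apply: mono.
  move=> e e0; have [n0 h] := cauchy_of_mono A_nd Ac e0.
  exists n0 => m n n0m n0n; have [nm|/ltnW mn] := leqP n m.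
    exact: le_lt_trans (ND _ _ nm) (h _ _ n0n nm).
  rewrite -(bfs_normN hB); last exact: (bfs_sub hB).
  under eq_fun do rewrite opprB.
  exact: le_lt_trans (ND _ _ mn) (h _ _ n0m mn).
have [lf fg] := ces_sup nf ug.
have [Xf Nf] : X (ces f) /\ N (ces f) <= N g.
  apply: (bfs_ideal hB Xg (ces_measurable nf)); apply: filterS fg => x h Ix.
  by rewrite ger0_norm ?ces_ge0 // (le_trans (h Ix)) // ler_norm.
by split => //; rewrite -(fineK Ifin) lee_fin; exact: le_trans Nf Ng.
Qed.

(* The nonnegative members of [C, X]. *)
Definition cx f := locint f /\ X (ces f).

Lemma cx_nneg f : cx f -> nneg f.
Proof. by case=> -[]. Qed.

Lemma cx_le f g : nneg g -> cx f -> (forall t, I01 t -> g t <= f t) ->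
  cx g /\ N (ces g) <= N (ces f).
Proof.
move=> ng [lf Xf] gf; have lg := locint_le ng lf gf.
have [Xg Ng] : X (ces g) /\ N (ces g) <= N (ces f).
  apply: (bfs_le hB Xf (ces_measurable ng)) => x /andP[x0 x1].
  have Ix : I01 x by rewrite /I01/= !ltW.
  rewrite !ger0_norm ?ces_ge0 //; last by case: lf.
  by apply: ces_le => //; rewrite ltW.
by [].
Qed.

Lemma cx_ae f g : nneg g -> cx f -> ae_eq01 f g -> cx g /\ N (ces g) = N (ces f).
Proof.
move=> ng [[nf lf] Xf] fg.
have lg : locint g.
  split => // x /andP[x0 x1]; rewrite -(@ae_eq_cint _ f) ?lf ?x0 //.
  exact: ltW.
have [Xg Ng] : X (ces g) /\ N (ces g) = N (ces f).
  apply: (bfs_eq hB Xf (ces_measurable ng)) => x /andP[x0 x1].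
  by apply: ae_eq_ces => //; exact: ltW.
by [].
Qed.

Lemma cx_eq f g : cx f -> (forall t, I01 t -> f t = g t) ->
  cx g /\ N (ces g) = N (ces f).
Proof.
move=> cf fg; apply: cx_ae => //; last exact: aeW.
case: cf => -[[mf f0] _] _; split; last by move=> t It; rewrite -fg // f0.
by apply: eq_measurable_fun mf => t; rewrite inE => /fg.
Qed.

Lemma cxD f g : cx f -> cx g ->
  cx (fun t => f t + g t) /\ N (ces (fun t => f t + g t)) <= N (ces f) + N (ces g).
Proof.
move=> [lf Xf] [lg Xg]; have lfg := locintD lf lg.
have [XS NS] : X (ces (fun t => f t + g t)) /\
    N (ces (fun t => f t + g t)) = N (fun x => ces f x + ces g x).
  apply: (bfs_eq hB (bfs_add hB Xf Xg)).
    by apply: ces_measurable; case: lfg.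
  by move=> x /andP[x0 x1]; rewrite cesD // ltW.
by split=> //; rewrite NS; exact: (bfs_normD hB).
Qed.

Lemma cxZ (c : R) f : 0 <= c -> cx f ->
  cx (fun t => c * f t) /\ N (ces (fun t => c * f t)) = c * N (ces f).
Proof.
move=> c0 [lf Xf]; have lc := locintZ c0 lf.
have [XS NS] : X (ces (fun t => c * f t)) /\
    N (ces (fun t => c * f t)) = N (fun x => c * ces f x).
  apply: (bfs_eq hB (bfs_scale hB c Xf)).
    by apply: ces_measurable; case: lc.
  by move=> x /andP[x0 x1]; rewrite cesZ // ltW.
by split=> //; rewrite NS (bfs_normZ hB) // ger0_norm.
Qed.

Lemma cx_bounded f (M : R) : nneg f -> (forall t, I01 t -> f t <= M) -> cx f.
Proof. by move=> nf fM; split; [exact: bounded_locint fM|exact: ces_X fM]. Qed.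

Lemma cx_sum (I : Type) (r : seq I) (F : I -> T -> R) : (forall i, cx (F i)) ->
  cx (fun t => \sum_(i <- r) F i t) /\
  N (ces (fun t => \sum_(i <- r) F i t)) <= \sum_(i <- r) N (ces (F i)).
Proof.
move=> cF; elim: r => [|i r [cr Nr]].
  have n0 : nneg (fun=> 0 : R) by exact: nneg_cst.
  under [X in cx X]eq_fun do rewrite big_nil.
  under [X in ces X]eq_fun do rewrite big_nil.
  rewrite big_nil; split; first by apply: (cx_bounded n0 (M := 0)).
  rewrite (_ : ces _ = fun=> 0) ?(bfs_norm0 hB) //.
  by apply/funext => x; exact: ces0.
under [X in cx X]eq_fun do rewrite big_cons.
under [X in ces X]eq_fun do rewrite big_cons.
have [c1 N1] := cxD (cF i) cr; split => //.
by rewrite big_cons (le_trans N1) // lerD2l.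
Qed.

Lemma cesaro_spaceP f : cesaro_space X f <->
  measurable_fun (@I01 R) f /\ cx (fun t => `|f t|).
Proof.
split => [[mf ff Xf]|[mf [[nf lf] Xf]]].
  split; first exact: mf.
  split; last exact: Xf.
  apply: locint_ae; first exact: nneg_abs.
  have h1 : {ae lam, forall x, I01 x -> 0 < (x : R) < 1} by exact: ae01W.
  move: ff h1; apply: filterS2 => x h h1 Ix; have /andP[x0 x1] := h1 Ix.
  move: (h Ix); rewrite cesaro_opE; case: (cint _ _) => // .
    by move=> r _; rewrite ltry.
  by rewrite gt0_muley ?lte_fin ?invr_gt0.
split; [exact: mf| |exact: Xf]; apply: ae01W => x /andP[x0 x1].
have x01 : 0 <= (x : R) < 1 by rewrite ltW.
by rewrite cesaro_opE -(fineK (cint_fin (conj nf lf) x01)) -EFinM ltry.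
Qed.

Lemma nneseries_partial (f : nat -> T -> R) t n : (forall k, 0 <= f k t) ->
  ((\sum_(k < n) f k t)%:E <= \sum_(k <oo) (f k t)%:E)%E.
Proof.
move=> f0; rewrite -sumEFin -(big_mkord xpredT (fun k => (f k t)%:E)).
by apply: nneseries_lim_ge => k _ _; rewrite lee_fin.
Qed.

(** The sum is identified pointwise almost everywhere, not only bounded in norm, so that partial
    sums and tails can be compared with it. The factor 2 is the sum of the geometric series. *)
Lemma riesz_fischer (f : nat -> T -> R) (a : R) :
  (forall k, cx (f k)) -> (forall k, N (ces (f k)) <= a * (2^-1) ^+ k) ->
  exists F, [/\ cx F, N (ces F) <= 2 * a & {ae lam, forall t, I01 t ->
    (F t)%:E = (\sum_(k <oo) (f k t)%:E)%E}].
Proof.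
move=> cf fa; have nf k := cx_nneg (cf k).
have a0 : 0 <= a.
  by have := fa 0; rewrite expr0 mulr1; apply: le_trans; exact: (bfs_norm_ge0 hB (cf 0).2).
pose S n t := \sum_(k < n) f k t.
have cS n : cx (S n) := (cx_sum (index_enum 'I_n) (fun k : 'I_n => cf k)).1.
have Sle n t : I01 t -> S n t <= S n.+1 t.
  by move=> It; rewrite /S big_ord_recr lerDl (nneg_ge0 (nf _)).
have geo n : \sum_(k < n) a * (2^-1) ^+ k = 2 * a - 2 * a * 2^-1 ^+ n.
  elim: n => [|n IH]; first by rewrite big_ord0 expr0 mulr1 subrr.
  rewrite big_ord_recr /= IH exprS; lra.
have p0 n : 0 <= (2^-1 : R) ^+ n by rewrite exprn_ge0 // invr_ge0 ler0n.
have NS n : N (ces (S n)) <= 2 * a.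
  apply: le_trans (cx_sum (index_enum 'I_n) (fun k : 'I_n => cf k)).2 _.
  apply: (@le_trans _ _ (\sum_(k < n) a * (2^-1) ^+ k)); first exact: ler_sum.
  by rewrite geo gerBl !mulr_ge0.
have ND m n : (n <= m)%N -> N (fun x => ces (S m) x - ces (S n) x) <=
    2 * a * (2^-1) ^+ n - 2 * a * (2^-1) ^+ m.
  move=> /subnKC <-; elim: (m - n)%N => [|k IH].
    rewrite addn0 subrr; under eq_fun do rewrite subrr.
    by rewrite (bfs_norm0 hB).
  rewrite addnS.
  have E : N (fun x => ces (S (n + k).+1) x - ces (S n) x) =
      N (fun x => ces (f (n + k)%N) x + (ces (S (n + k)%N) x - ces (S n) x)).
    apply/esym; apply: (bfs_eq hB _ _ _).2.
    - by apply: (bfs_sub hB); [exact: (cS _).2|exact: (cS _).2].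
    - apply: measurable_funD; last apply: measurable_funB;
        by apply: ces_measurable; first [exact: (nf _)|exact: (cx_nneg (cS _))].
    - move=> x /andP[x0 x1]; rewrite addrA; congr (_ - _).
      rewrite -(cesD _ (cf _).1 (cS _).1) ?ltW //.
      apply: eq_ces; first exact: ltW.
      by move=> t _; rewrite /S big_ord_recr /= addrC.
  rewrite E; apply: le_trans (bfs_normD hB (cf _).2 _) _.
    by apply: (bfs_sub hB); [exact: (cS _).2|exact: (cS _).2].
  apply: le_trans (lerD (fa _) IH) _; rewrite exprS; lra.
have [g [Xg ug Ng]] : exists g, [/\ X g,
    forall n, {ae lam, forall x, I01 x -> ces (S n) x <= g x} & N g <= 2 * a].
  apply: mono_limit => //; first by move=> n; exact: (cS n).2.
    move=> n x /andP[x0 x1]; apply: ces_le; rewrite ?ltW //.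
    - exact: cx_nneg (cS n).
    - exact: (cS _).1.
    - exact: Sle.
  (* The right side of [ND] is an increment of this nondecreasing sequence bounded by 0, which makes
     it a Cauchy criterion. *)
  pose b n := - (2 * a * (2^-1) ^+ n).
  have b_nd : nondecreasing_seq b.
    apply/nondecreasing_seqP => n; rewrite /b lerN2 ler_wpM2l ?mulr_ge0 //.
    by rewrite exprS ler_piMl // invf_le1 // ler1n.
  have b0 n : b n <= 0 by rewrite oppr_le0 !mulr_ge0.
  move=> e e0; have [n0 h] := cauchy_of_mono b_nd b0 e0.
  have ND' m n : (n <= m)%N -> N (fun x => ces (S m) x - ces (S n) x) <= b m - b n.
    by move=> nm; rewrite /b opprK addrC ND.
  exists n0 => m n n0m n0n; have [nm|/ltnW mn] := leqP n m.
    exact: le_lt_trans (ND' _ _ nm) (h _ _ n0n nm).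
  rewrite -(bfs_normN hB); last by apply: (bfs_sub hB); exact: (cS _).2.
  under eq_fun do rewrite opprB.
  exact: le_lt_trans (ND' _ _ mn) (h _ _ n0m mn).
pose E t : \bar R := (\sum_(k <oo) (f k t)%:E)%E.
have E0 t : I01 t -> (0 <= E t)%E.
  by move=> It; apply: nneseries_ge0 => k _ _; rewrite lee_fin (nneg_ge0 (nf k)).
have mI := @measurable_I01 R.
have mfk k : measurable_fun (@I01 R) (EFin \o f k).
  by apply: nneg_EFin; [exact: subset_refl|exact: nf].
have mE : measurable_fun (@I01 R) E.
  rewrite (_ : E = fun t => (\sum_(k <oo | k \in xpredT) (EFin \o f k) t)%E).
    apply: ge0_emeasurable_sum; last by move=> k _; exact: mfk.
    by move=> k t It _; rewrite lee_fin (nneg_ge0 (nf k)).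
  by apply/funext => t; apply: eq_eseriesl => k.
have iE x : 0 < (x : R) < 1 -> (forall n, ces (S n) x <= g x) ->
    (\int[lam]_(t in seg0 x) E t <= ((x : R) * g x)%:E)%E.
  move=> x01 h; have /andP[x0 x1] := x01; have s := seg0_sub (ltW x1).
  rewrite (integral_nneseries _ (measurable_seg0 x)); last first.
  - by move=> n t /s It; rewrite lee_fin (nneg_ge0 (nf n)).
  - by move=> n; exact: nneg_EFin.
  apply: lime_le.
    by apply: is_cvg_nneseries => n _ _; exact: (cint_ge0 (ltW x1) (nf n)).
  apply: nearW => n.
  rewrite (_ : (\sum_(0 <= i < n) _)%E = cint (S n) x); last first.
    rewrite big_mkord /S; elim: n => [|n IH].
      rewrite big_ord0; under eq_fun do rewrite big_ord0.
      by rewrite cint_cst ?mul0r // /I01/= !ltW.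
    rewrite big_ord_recr /= IH; under [in RHS]eq_fun do rewrite big_ord_recr /=.
    by rewrite (cintD (ltW x1) (cx_nneg (cS n)) (nf n)).
  by rewrite (cint_ces (cS n).1 x01) lee_fin ler_pM2l.
have iEae : {ae lam, forall x, I01 x -> 0 < (x : R) < 1 /\
    (\int[lam]_(t in seg0 x) E t <= ((x : R) * g x)%:E)%E}.
  have h1 : {ae lam, forall x, I01 x -> 0 < (x : R) < 1} by exact: ae01W.
  move: (ae_foralln ug) h1; apply: filterS2 => x h h1 Ix.
  by have x01 := h1 Ix; split => //; apply: iE => // n; exact: h.
(* The bound of [iEae] holds at points [y] arbitrarily close to 1, and [E] is integrable over [0,y]
   for each of them. *)
have finE : {ae lam, forall t, I01 t -> E t \is a fin_num}.
  have hn n : {ae lam, forall t, (0 <= (t : R) <= 1 - n.+1%:R^-1) ->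
      E t \is a fin_num}.
    have r0 : 0 <= 1 - (n.+1%:R^-1 : R) < 1.
      by rewrite subr_ge0 invf_le1 ?ler1n ?ltr0n //= gtrBl invr_gt0 ltr0n.
    have [y /andP[y0 y1] [y01 hy]] := ae01_exists r0 iEae.
    have s := seg0_sub (ltW y1).
    have : lam.-integrable (seg0 y) E.
      apply/integrableP; split.
        exact: (measurable_funS mI s mE).
      rewrite (@eq_integral _ _ _ _ _ E).
        by apply: le_lt_trans hy _; rewrite ltry.
      by move=> t; rewrite inE => /s It; rewrite gee0_abs // E0.
    move=> /(integrable_ae (measurable_seg0 y)); apply: filterS => t h /andP[t0 t1].
    by apply: h; rewrite /seg0/= t0 (le_trans t1) // ltW.
  have h1 : {ae lam, forall x, I01 x -> 0 < (x : R) < 1} by exact: ae01W.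
  move: (ae_foralln hn) h1; apply: filterS2 => t h h1 It.
  have /andP[t0 t1] := h1 It.
  pose n := Num.truncn (1 - (t : R))^-1; apply: (h n); rewrite ltW //=.
  rewrite lerBrDr -lerBrDl -[leRHS]invrK lef_pV2 ?posrE ?invr_gt0 ?subr_gt0 //.
  by rewrite ltW // truncnS_gt.
pose F t := fine (E t).
have nF : nneg F.
  split; last by move=> t It; rewrite fine_ge0 // E0.
  exact: (measurableT_comp (@fine_measurable R _ measurableT)).
have FE : {ae lam, forall t, I01 t -> (F t)%:E = E t}.
  by apply: filterS finE => t h It; rewrite /F fineK // h.
have cF x : (x : R) <= 1 -> cint F x = (\int[lam]_(t in seg0 x) E t)%E.
  move=> x1; have s := seg0_sub x1.
  apply: (ge0_ae_eq_integral (measurable_seg0 x)).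
  - exact: nneg_EFin.
  - exact: (measurable_funS mI s mE).
  - by move=> t /s It; rewrite lee_fin (nneg_ge0 nF).
  - by move=> t /s It; rewrite E0.
  - by apply: filterS FE => t h /s It; rewrite h.
have lF : locint F.
  apply: locint_ae => //; apply: filterS iEae => x h Ix; have [_ hx] := h Ix.
  by case/andP: Ix => _ x1; rewrite cF //; apply: le_lt_trans hx _; rewrite ltry.
have [XF NF] : X (ces F) /\ N (ces F) <= N g.
  apply: (bfs_ideal hB Xg (ces_measurable nF)).
  apply: filterS iEae => x h Ix; have [x01 hx] := h Ix.
  rewrite ger0_norm ?ces_ge0 // (le_trans _ (ler_norm _)) //.
  by apply: ces_le_of_cint => //; rewrite cF //; case/andP: Ix.
by exists F; split => //; exact: le_trans NF Ng.
Qed.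

(** Only bounded functions vanishing near 0 are tested: their [Iphi] is finite, so [fine] loses
    nothing. [AL_bound_cx] extends the bound to the whole cone. *)
Definition AL_bound := exists2 K : R, 0 <= K & forall f d M, 0 < d < 1 ->
  bsupp d M f -> fine (Iphi X f) <= K * N (ces f).

Lemma AL_bound_cx : AL_bound -> exists2 K : R, 0 <= K & forall f, cx f ->
  (Iphi X f <= (K * N (ces f))%:E)%E.
Proof.
move=> [K K0 hK]; exists K => // f cf; have nf := cx_nneg cf.
apply: (@trunc_sup R I01 f (phi X) _ (@measurable_I01 R)) => //.
- exact: (nneg_meas (nneg_phi hX)).
- by move=> t _; exact: phi_ge0.
move=> n; have tb := trunc_bsupp n nf; have i2 := inv_n2 R n.
rewrite -[leLHS]/(Iphi X (trunc n f)) -(fineK (bsupp_Iphi_fin hX tb i2)) lee_fin.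
apply: le_trans (hK _ _ _ i2 tb) _; apply: ler_wpM2l => //.
apply: (cx_le (trunc_nneg n nf) cf _).2 => t It.
by apply: trunc_le; exact: (nneg_ge0 nf).
Qed.

(** If the constants 2^k all fail, normalisation yields functions with [Iphi] equal to 1 and norm at
    most 2^-k. Their sum lies in the cone by [riesz_fischer], yet its [Iphi] is at least every
    natural number. *)
Lemma AL_bound_of_finite : (forall f, cx f -> (Iphi X f < +oo)%E) -> AL_bound.
Proof.
move=> hfin; apply: contrapT => nK.
have hk (k : nat) : exists g, [/\ cx g, Iphi X g = 1%E &
    N (ces g) <= 1 * (2^-1) ^+ k].
  have : ~ forall f d M, 0 < d < 1 -> bsupp d M f ->
      fine (Iphi X f) <= 2 ^+ k * N (ces f).
    by move=> h; apply: nK; exists (2 ^+ k); rewrite ?exprn_ge0.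
  move=> /existsNP[f /existsNP[d /existsNP[M /not_implyP[d01 /not_implyP[bf /negP]]]]].
  rewrite -ltNge => h; have [nf fM _] := bf.
  have cf := cx_bounded nf fM.
  have Nf0 := bfs_norm_ge0 hB cf.2.
  have If := bsupp_Iphi_fin hX bf d01; set I := fine (Iphi X f) in h.
  have I0 : 0 < I by apply: le_lt_trans h; rewrite mulr_ge0 ?exprn_ge0.
  have Ii0 : 0 <= I^-1 by rewrite invr_ge0 ltW.
  exists (fun t => I^-1 * f t); have [cI NI] := cxZ Ii0 cf; split => //.
    by rewrite (IphiZ hX) // -(fineK If) -EFinM mulVf ?gt_eqF.
  rewrite NI mul1r mulrC ler_pdivrMr // exprVn mulrC ler_pdivlMr ?exprn_gt0 //.
  by rewrite mulrC ltW.
have /choice[f hf] := hk.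
have cf k : cx (f k) by have [] := hf k.
have [F [cF _ FE]] := riesz_fischer cf (fun k => let: And3 _ _ h := hf k in h).
have nF := cx_nneg cF.
have := hfin _ cF; apply/negP; rewrite -leNgt leye_eq; apply/eqP/eqyP => A A0.
pose n := (Num.truncn A).+1.
apply: (@le_trans _ _ (Iphi X (fun t => \sum_(k < n) f k t))).
  rewrite (Iphi_sum hX); last by move=> k; exact: cx_nneg (cf k).
  rewrite (eq_bigr (fun=> 1%E)); last by move=> k _; have [] := hf k.
  rewrite sumEFin sumr_const card_ord lee_fin ltW //; exact: truncnS_gt.
apply: (ae_ge0_le_integral (@measurable_I01 R)).
- move=> t It; rewrite lee_fin mulr_ge0 ?phi_ge0 //.
  by apply: sumr_ge0 => k _; exact: (nneg_ge0 (cx_nneg (cf k))).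
- by apply: measurable_phiM => //; apply: nneg_sum => k; exact: cx_nneg (cf k).
- by move=> t It; rewrite lee_fin mulr_ge0 ?phi_ge0 // (nneg_ge0 nF).
- exact: measurable_phiM.
- apply: filterS FE => t h It; rewrite lee_fin ler_wpM2r ?phi_ge0 //.
  rewrite -lee_fin h //; apply: nneseries_partial => k.
  exact: (nneg_ge0 (cx_nneg (cf k))).
Qed.

Lemma AL_boundP : AL_bound <-> associate (cesaro_space X) (fun y => N (Fy y)).
Proof.
(* On [0,1] the two functions can differ at 0 only, where [Fy] may lie outside X. *)
have ephi : ae_eq01 (phi X) (fun y => N (Fy y)).
  by apply: ae01W => t /andP[t0 t1]; rewrite phiE // t0 ltW.
have mN : measurable_fun (@I01 R) (fun y : T => N (Fy y)).
  apply: antitone01_measurable => x y x0 xy y1; have := phi_homo hX x0 xy y1.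
  have y0 := lt_le_trans x0 xy.
  by rewrite !phiE // ?x0 ?y0 ?y1 // (le_trans xy).
have mphi : measurable_fun (@I01 R) (phi X) by exact: (nneg_meas (nneg_phi hX)).
have E f : measurable_fun (@I01 R) f ->
    (\int[lam]_(t in I01) `|f t * N (Fy t)|%:E)%E = Iphi X (fun t => `|f t|).
  move=> mf; apply: (ge0_ae_eq_integral (@measurable_I01 R)).
  - apply: nneg_EFin; first exact: subset_refl.
    by apply: nneg_abs; exact: measurable_funM.
  - exact: (measurable_phiM hX (nneg_abs mf)).
  - by move=> t It; rewrite lee_fin.
  - by move=> t It; rewrite lee_fin mulr_ge0 ?phi_ge0.
  - apply: filterS ephi => t h It; rewrite -h // normrM.
    by rewrite (ger0_norm (phi_ge0 _ _)).
split.
  move=> /AL_bound_cx[K K0 hK]; split => // f /cesaro_spaceP[mf cf].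
  by rewrite E //; apply: le_lt_trans (hK _ cf) _; rewrite ltry.
move=> [_ h]; apply: AL_bound_of_finite => f cf.
have nf := cx_nneg cf; have mf := nneg_meas nf.
have fE t : I01 t -> f t = `|f t| by move=> It; rewrite ger0_norm // (nneg_ge0 nf).
rewrite (eq_Iphi _ fE) -(E _ mf); apply: h; apply/cesaro_spaceP.
by split; [exact: mf|exact: (cx_eq cf fE).1].
Qed.

End cx.

(** * Order isomorphism with an AL-space *)

Section AL_necessary.
Variables (R : realType) (X : funspace R) (hX : is_ri X).
Local Notation T := (lebT R).
Local Notation N := (fs_norm X).
Local Notation hB := (ri_Bfs hX).
Local Notation CX := (cesaro_space X).
Implicit Types (f g h : T -> R) (x y t : T).

(** Continuity at 0 turned into boundedness by scaling [f] into the ball of radius [d]. Two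
    homogeneous functions on a cone are used instead of a linear map, so that the same statement
    serves a map, its inverse and a pair of norms. *)
Lemma homogeneous_bound (U : lmodType R) (C : set U) (q p : U -> R)
    (d : R) : 0 < d ->
  (forall (a : R) (f : U), 0 <= a -> C f -> C (a *: f)) ->
  (forall f : U, C f -> 0 <= q f) ->
  (forall (a : R) (f : U), 0 <= a -> C f -> q (a *: f) = a * q f) ->
  (forall (a : R) (f : U), 0 <= a -> C f -> p (a *: f) = a * p f) ->
  (forall f : U, C f -> q f < d -> p f < 1) ->
  forall f : U, C f -> p f <= 2 / d * q f.
Proof.
move=> d0 CZ q0 qZ pZ h f Cf.
have k0 : 0 < 2 / d by rewrite divr_gt0.
apply/ler_addgt0Pr => e e0.
(* The added term keeps [r] positive when [q f = 0]. The factor 2 in [a] makes [a * r] equal to d /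
   2. *)
pose r := q f + e / (2 / d).
have r0 : 0 < r by rewrite ltr_wpDl ?q0 // divr_gt0.
pose a := d / (2 * r).
have a0 : 0 < a by rewrite divr_gt0 // mulr_gt0.
have : p (a *: f) < 1.
  apply: h; first by apply: CZ => //; exact: ltW.
  rewrite qZ ?ltW //; apply: (@le_lt_trans _ _ (a * r)).
    rewrite ler_pM2l // /r lerDl ltW // divr_gt0 //.
  rewrite /a invfM mulrA mulfVK ?gt_eqF // ltr_pdivrMr // ltr_pMr //.
  by rewrite ltr1n.
rewrite (pZ _ _ (ltW a0) Cf) => h1.
have h2 : p f < a^-1 by rewrite -(ltr_pM2l a0) mulfV ?gt_eqF.
apply: le_trans (ltW h2) _.
rewrite (_ : a^-1 = 2 / d * r); last by rewrite /a invf_div mulrAC.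
by rewrite /r mulrDr [X in _ + X]mulrC divfK // gt_eqF.
Qed.

Lemma CX_le f g : CX f -> measurable_fun (@I01 R) g ->
  (forall t, I01 t -> `|g t| <= `|f t|) ->
  CX g /\ N (cesaro_abs g) <= N (cesaro_abs f).
Proof.
move=> /cesaro_spaceP[mf cf] mg gf.
have [cg Ng] := cx_le hX (nneg_abs mg) cf gf; split => //.
by apply/cesaro_spaceP; split; [exact: mg|exact: cg].
Qed.

Lemma CX_meas f : CX f -> measurable_fun (@I01 R) f.
Proof. by case. Qed.

Lemma CXD f g : CX f -> CX g -> CX (fun t => f t + g t).
Proof.
move=> /cesaro_spaceP[mf cf] /cesaro_spaceP[mg cg].
apply/cesaro_spaceP.
have mfg : measurable_fun (@I01 R) (fun t => f t + g t) by exact: measurable_funD.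
split; first exact: mfg.
apply: (cx_le hX (nneg_abs mfg) (cxD hX cf cg).1 _).1 => t _.
exact: ler_normD.
Qed.

Lemma CXZ (a : R) f : CX f ->
  CX (fun t => a * f t) /\ N (cesaro_abs (fun t => a * f t)) = `|a| * N (cesaro_abs f).
Proof.
move=> /cesaro_spaceP[mf cf].
have [ca Na] := cxZ hX (normr_ge0 a) cf.
have E t : I01 t -> `|a| * `|f t| = `|a * f t| by rewrite normrM.
have [ca' Na'] := cx_eq hX ca E; split; last by rewrite -Na -Na'.
apply/cesaro_spaceP; split; last exact: ca'.
by apply: measurable_funM => //; exact: measurable_cst.
Qed.

Lemma CXN f : CX f -> CX (fun t => - f t).
Proof.
move=> /(CXZ (-1))[+ _]; congr (fs_car CX _).
by apply/funext => t; rewrite mulN1r.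
Qed.

Lemma CX_nneg f : cx X f -> CX f /\ N (cesaro_abs f) = N (ces f).
Proof.
move=> cf; have nf := cx_nneg cf.
have E t : I01 t -> f t = `|f t| by move=> It; rewrite ger0_norm // (nneg_ge0 nf).
have [ca Na] := cx_eq hX cf E; split => //.
by apply/cesaro_spaceP; split; [exact: nneg_meas|exact: ca].
Qed.

Lemma CX0 : CX (fun=> 0).
Proof. by have [] := CX_nneg (cx_bounded hX (nneg_cst (lexx 0)) (fun _ _ => lexx 0)). Qed.

Lemma CX_norm_ge0 f : CX f -> 0 <= N (cesaro_abs f).
Proof. by case=> _ _ Xf; exact: (bfs_norm_ge0 hB). Qed.

(** The sums over the cells tend to [Iphi f] by [norm_fcell], while the right side does not depend
    on [n]. *)
Lemma AL_bound_of_cells (K : R) : 0 <= K ->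
  (forall f (d M : R) n, 0 < d < 1 -> bsupp d M f ->
     \sum_(i < n.+1) N (ces (fcell f d n i)) <= K * N (ces f)) ->
  AL_bound X.
Proof.
move=> K0 h; exists K => // f d M d01 bf.
apply/ler_addgt0Pr => e e0.
pose n := Num.truncn (M * phi X (d : T) / e).
have ne : M * phi X (d : T) / n.+1%:R <= e.
  rewrite ler_pdivrMr ?ltr0n // [leRHS]mulrC -ler_pdivrMr //.
  by rewrite ltW // truncnS_gt.
have := norm_fcell hX n bf d01; rewrite distrC => /(le_trans (ler_norm _)).
rewrite lerBlDl => /le_trans; apply; apply: lerD => //.
exact: h d01 bf.
Qed.

Lemma disjoint_cells (d : R) n (i j : nat) t : d < 1 ->
  cell (part d n) i t -> cell (part d n) j t -> i = j.
Proof.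
move=> d1; wlog ij : i j / (i <= j)%N.
  by move=> h ti tj; have [/h|/ltnW/h] := leqP i j; [exact|move=> ->].
move=> /andP[_ ti] /andP[tj _]; apply/eqP; rewrite eqn_leq ij /= leqNgt.
apply/negP => lij.
have := le_lt_trans ti (le_lt_trans (part_nd n d1 lij) tj).
by rewrite ltxx.
Qed.

Lemma fcell_disjoint f d n i j t : d < 1 -> i != j ->
  fcell f d n i t = 0 \/ fcell f d n j t = 0.
Proof.
move=> d1 ij; rewrite /fcell !indicE.
case: (boolP (t \in cell (part d n) i)) => [/set_mem ti|_]; last by left; rewrite mulr0.
right; rewrite memNset ?mulr0 // => tj.
by move: ij; rewrite (disjoint_cells d1 ti tj) eqxx.
Qed.

Lemma AL_bound_necessary : order_isomorphic_to_AL (nl_of_fun CX) -> AL_bound X.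
Proof.
move=> [E [le [join [meet [P [[bl add] iso]]]]]].
have Plin (a : R) f g : CX f -> CX g ->
    P (fun t => a * f t + g t) = a *: P f + P g.
  by move=> Cf Cg; have := oi_linear iso a Cf Cg.
have P0 : P (fun=> 0) = 0.
  have := Plin (-1) _ _ CX0 CX0; under eq_fun do rewrite mulr0 addr0.
  by rewrite scaleN1r addNr.
have PZ (a : R) f : CX f -> P (fun t => a * f t) = a *: P f.
  move=> Cf; have := Plin a _ _ Cf CX0; rewrite P0 addr0.
  by under eq_fun do rewrite addr0.
have PN f : CX f -> P (fun t => - f t) = - P f.
  move=> Cf; have := PZ (-1) _ Cf; rewrite scaleN1r => <-; congr P.
  by apply/funext => t; rewrite mulN1r.
have PD f g : CX f -> CX g -> P (fun t => f t + g t) = P f + P g.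
  move=> Cf Cg; have := Plin 1 _ _ Cf Cg; rewrite scale1r => <-; congr P.
  by apply/funext => t; rewrite mul1r.
have Pabs f : CX f -> join (P f) (- P f) = P (fun t => Num.max (f t) (- f t)).
  move=> Cf; rewrite -PN //; apply/esym.
  exact: (oi_join iso Cf (CXN Cf)).
(* [P] respects joins and meets, so it sends disjoint functions to disjoint elements, on which the
   AL-norm is additive. *)
have Padd f g : CX f -> CX g -> (forall t, I01 t -> f t = 0 \/ g t = 0) ->
    `|P (fun t => f t + g t)| = `|P f| + `|P g|.
  move=> Cf Cg fg; rewrite PD //; apply: add; rewrite !Pabs //.
  have Cmax k : CX k -> CX (fun t => Num.max (k t) (- k t)).
    move=> Ck; have mk := CX_meas Ck.
    apply: (CX_le Ck _ _).1 => [|t _].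
      exact: (measurable_maxr mk (measurable_funN mk)).
    by rewrite maxrN normr_id.
  have Cf' := Cmax _ Cf; have Cg' := Cmax _ Cg.
  have := oi_meet iso Cf' Cg'; rewrite /= => <-.
  (* The meet of the absolute values is known to vanish on [0,1] only, hence the comparison with 0
     through [oi_eq]. *)
  rewrite -P0; pose k t := Num.min (Num.max (f t) (- f t)) (Num.max (g t) (- g t)).
  rewrite -[LHS]/(P k).
  have kE t : I01 t -> k t = 0.
    move=> It; rewrite /k !maxrN.
    by case: (fg t It) => ->; rewrite normr0; [apply/min_idPl|apply/min_idPr].
  have Ck : CX k.
    apply: (CX_le CX0 _ _).1 => [|t It]; last by rewrite kE.
    exact: (measurable_minr (CX_meas Cf') (CX_meas Cg')).
  by apply/(oi_eq iso Ck CX0); apply: aeW => t; exact: kE.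
have Psum (F : nat -> T -> R) n : (forall i, CX (F i)) ->
    (forall i j t, i != j -> F i t = 0 \/ F j t = 0) ->
    CX (fun t => \sum_(i < n) F i t) /\
    `|P (fun t => \sum_(i < n) F i t)| = \sum_(i < n) `|P (F i)|.
  move=> CF dF; elim: n => [|n [IH1 IH2]].
    under [X in CX X]eq_fun do rewrite big_ord0.
    under [X in P X]eq_fun do rewrite big_ord0.
    by rewrite big_ord0 P0 normr0; split => //; exact: CX0.
  under [X in CX X]eq_fun do rewrite big_ord_recr /=.
  under [X in P X]eq_fun do rewrite big_ord_recr /=.
  split; first exact: CXD.
  rewrite big_ord_recr /= Padd // ?IH2 // => t _.
  have [->|/eqP Fn] := pselect (F n t = 0); first by right.
  left; apply: big1 => i _; case: (dF i n t) => //; first by rewrite ltn_eqF.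
  by move=> h; rewrite h eqxx in Fn.
have CXZ' (a : R) (f : nl_of_fun CX) : 0 <= a -> CX f -> CX (a *: f).
  by move=> _ /(CXZ a)[].
have qZ (a : R) (f : nl_of_fun CX) : 0 <= a -> CX f ->
    N (cesaro_abs (a *: f)) = a * N (cesaro_abs f).
  by move=> a0 /(CXZ a)[_]; rewrite ger0_norm.
have pZ (a : R) (f : nl_of_fun CX) : 0 <= a -> CX f -> `|P (a *: f)| = a * `|P f|.
  by move=> a0 Cf; have := PZ a f Cf => ->; rewrite normrZ ger0_norm.
have subf0 (f : nl_of_fun CX) : f - (fun=> 0) = f.
  by apply/funext => t; exact: subr0.
have [K1 K10 hK1] : exists2 K1 : R, 0 <= K1 & forall f, CX f ->
    `|P f| <= K1 * N (cesaro_abs f).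
  have [d d0 hd] := oi_continuous iso CX0 ltr01.
  exists (2 / d); first by rewrite divr_ge0 // ltW.
  apply: (@homogeneous_bound (nl_of_fun CX) CX (fun f => N (cesaro_abs f))
    (fun f => `|P f|) d d0 CXZ' CX_norm_ge0 qZ pZ) => f Cf hf.
  by have := hd f Cf; rewrite subf0 => /(_ hf) /=; rewrite P0 subr0.
have [K2 K20 hK2] : exists2 K2 : R, 0 <= K2 & forall f, CX f ->
    N (cesaro_abs f) <= K2 * `|P f|.
  have [d d0 hd] := oi_inv_continuous iso CX0 ltr01.
  exists (2 / d); first by rewrite divr_ge0 // ltW.
  apply: (@homogeneous_bound (nl_of_fun CX) CX (fun f => `|P f|)
    (fun f => N (cesaro_abs f)) d d0 CXZ' _ pZ qZ) => [f _|f Cf hf].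
    exact: normr_ge0.
  by have := hd f Cf; rewrite subf0 /= P0 subr0 => /(_ hf).
(* [K2] bounds the norm of each cell by the AL-norm of its image; there the norms add up to that of
   the whole sum, which [K1] brings back to the Cesaro norm. *)
apply: (@AL_bound_of_cells (K2 * K1)); first exact: mulr_ge0.
move=> f d M n d01 bf; have [nf fM f0] := bf; have /andP[d0 d1] := d01.
have nF i : nneg (fcell f d n i) by exact: fcell_nneg.
have cF i : cx X (fcell f d n i).
  apply: (cx_bounded hX (nF i)) => t It.
  exact: le_trans (fcell_le _ _ _ (nneg_ge0 nf It)) (fM _ It).
have [CS NS] := Psum (fcell f d n) n.+1 (fun i => (CX_nneg (cF i)).1)
  (fun i j t => @fcell_disjoint f d n i j t d1).
apply: (@le_trans _ _ (\sum_(i < n.+1) K2 * `|P (fcell f d n i)|)).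
  apply: ler_sum => i _; have [Ci Ni] := CX_nneg (cF i).
  by rewrite -Ni hK2.
rewrite -mulr_sumr -NS -mulrA ler_wpM2l //; apply: le_trans (hK1 _ CS) _.
rewrite ler_wpM2l //.
have cf := cx_bounded hX nf fM.
have [_ <-] := CX_nneg cf.
by apply: (CX_le (CX_nneg cf).1 (CX_meas CS) _).2 => t It; rewrite -(fcell_sum _ bf).
Qed.

End AL_necessary.

(** * The Banach space of a complete seminormed space *)

(** Completeness is asked only of sequences with increments at most 2^-n; every Cauchy filter on the
    quotient yields such a sequence. *)
Record complete_seminormed (R : realType) := CompleteSeminormed {
  sn_sort : lmodType R;
  sn_car : set sn_sort;
  sn_norm : sn_sort -> R;
  sn_car0 : sn_car 0;
  sn_lin : forall (a : R) x y, sn_car x -> sn_car y -> sn_car (a *: x + y);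
  sn_normD : forall x y, sn_car x -> sn_car y ->
    sn_norm (x + y) <= sn_norm x + sn_norm y;
  sn_normZ : forall (a : R) x, sn_car x -> sn_norm (a *: x) = `|a| * sn_norm x;
  sn_complete : forall u : nat -> sn_sort, (forall n, sn_car (u n)) ->
    (forall n, sn_norm (u n.+1 - u n) <= 2^-1 ^+ n) ->
    exists2 v, sn_car v & forall e : R, 0 < e ->
      exists n0, forall n, (n0 <= n)%N -> sn_norm (u n - v) < e }.

Section complete_seminormed_quotient.
Variables (R : realType) (D : complete_seminormed R).
Local Notation V := (sn_sort D).
Local Notation C := (@sn_car R D).
Local Notation p := (@sn_norm R D).
Implicit Types (a : R) (x y z : V).

Lemma sn_carZ a x : C x -> C (a *: x).
Proof. by move=> Cx; rewrite -[_ *: _]addr0; apply: sn_lin => //; exact: sn_car0. Qed.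

Lemma sn_carD x y : C x -> C y -> C (x + y).
Proof. by move=> Cx Cy; rewrite -[x]scale1r; exact: sn_lin. Qed.

Lemma sn_carN x : C x -> C (- x).
Proof. by rewrite -scaleN1r; exact: sn_carZ. Qed.

Lemma sn_carB x y : C x -> C y -> C (x - y).
Proof. by move=> Cx Cy; apply: sn_carD => //; exact: sn_carN. Qed.

Lemma sn_norm0 : p 0 = 0.
Proof. by rewrite -(scale0r (0 : V)) sn_normZ ?normr0 ?mul0r //; exact: sn_car0. Qed.

Lemma sn_normN x : C x -> p (- x) = p x.
Proof. by move=> Cx; rewrite -scaleN1r sn_normZ // normrN normr1 mul1r. Qed.

Lemma sn_norm_ge0 x : C x -> 0 <= p x.
Proof.
move=> Cx; have := sn_normD Cx (sn_carN Cx); rewrite subrr sn_norm0 sn_normN //.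
by rewrite -mulr2n pmulrn_lge0.
Qed.

Lemma sn_normB x y : C x -> C y -> p (x - y) = p (y - x).
Proof. by move=> Cx Cy; rewrite -opprB sn_normN //; exact: sn_carB. Qed.

(** One fixed choice per class of the seminorm: equivalent vectors give [xget] the same set, hence
    the same value ([sn_rep_eq]). *)
Definition sn_rep x : V := xget 0 [set y | C y /\ p (x - y) = 0].

Lemma sn_repP x : C x -> C (sn_rep x) /\ p (x - sn_rep x) = 0.
Proof.
move=> Cx; rewrite /sn_rep; case: xgetP => [y _ [] //|/(_ x) h].
by exfalso; apply: h; split; rewrite // subrr sn_norm0.
Qed.

Lemma sn_norm_eq x y : C x -> C y -> p (x - y) = 0 -> p x = p y.
Proof.
move=> Cx Cy h; apply/eqP; rewrite eq_le; apply/andP; split.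
  have := sn_normD (sn_carB Cx Cy) Cy; by rewrite subrK h add0r.
by have := sn_normD (sn_carB Cy Cx) Cx; rewrite subrK sn_normB // h add0r.
Qed.

Lemma sn_trans x y z : C x -> C y -> C z -> p (x - y) = 0 -> p (y - z) = 0 ->
  p (x - z) = 0.
Proof.
move=> Cx Cy Cz xy yz; apply/eqP; rewrite eq_le sn_norm_ge0 ?andbT; last exact: sn_carB.
by have := sn_normD (sn_carB Cx Cy) (sn_carB Cy Cz); rewrite addrA subrK xy yz addr0.
Qed.

Lemma sn_rep_eq x y : C x -> C y -> p (x - y) = 0 -> sn_rep x = sn_rep y.
Proof.
move=> Cx Cy xy; rewrite /sn_rep; congr xget; apply/seteqP.
by split => z /= [Cz h]; split => //; [apply: (sn_trans Cy Cx Cz) => //; rewrite sn_normB|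
  exact: (sn_trans Cx Cy Cz)].
Qed.

(** The quotient as the subtype of chosen representatives, so that equivalence of vectors becomes
    equality of classes and the norm is read on the representative. *)
Definition sn_quotient := {x : V | `[< C x /\ sn_rep x = x >]}.
HB.instance Definition _ := [Choice of sn_quotient by <:].
Implicit Types (q r s : sn_quotient).

Lemma sn_valP q : C (val q) /\ sn_rep (val q) = val q.
Proof. by case: q => x /= /asboolP. Qed.

Lemma sn_rep_canonical x : C x -> `[< C (sn_rep x) /\ sn_rep (sn_rep x) = sn_rep x >].
Proof.
move=> Cx; have [Cr h] := sn_repP Cx; apply/asboolP; split => //.
by apply: sn_rep_eq => //; rewrite sn_normB.
Qed.

Definition sn_class x : sn_quotient :=
  insubd (Sub (sn_rep 0) (sn_rep_canonical (sn_car0 D)) : sn_quotient) (sn_rep x).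

Lemma val_sn_class x : C x -> val (sn_class x) = sn_rep x.
Proof. by move=> Cx; rewrite val_insubd sn_rep_canonical. Qed.

Lemma sn_classK q : sn_class (val q) = q.
Proof. by apply: val_inj; have [Cq h] := sn_valP q; rewrite val_sn_class. Qed.

Lemma sn_val q : C (val q).
Proof. by have [] := sn_valP q. Qed.
Hint Resolve sn_val : core.

Lemma sn_class_eq x y : C x -> C y -> sn_class x = sn_class y <-> p (x - y) = 0.
Proof.
move=> Cx Cy; split => [h|h]; last first.
  by apply: val_inj; rewrite !val_sn_class //; exact: sn_rep_eq.
have [Cx' hx] := sn_repP Cx; have [Cy' hy] := sn_repP Cy.
apply: (sn_trans Cx Cx' Cy) => //.
by rewrite -(val_sn_class Cx) h val_sn_class // sn_normB.
Qed.

Lemma sn_class_val x : C x -> p (val (sn_class x) - x) = 0.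
Proof. by move=> Cx; have [Cr h] := sn_repP Cx; rewrite val_sn_class // sn_normB. Qed.

Lemma sn_classP q : exists2 x, C x & q = sn_class x.
Proof. by exists (val q); rewrite ?sn_classK. Qed.

Definition sn_add q r := sn_class (val q + val r).
Definition sn_opp q := sn_class (- val q).
Definition sn_scale a q := sn_class (a *: val q).

Lemma sn_norm_small x y : C x -> C y -> p x = 0 -> p y = 0 -> p (x + y) = 0.
Proof.
move=> Cx Cy x0 y0; apply/eqP; rewrite eq_le sn_norm_ge0 ?andbT; last exact: sn_carD.
by have := sn_normD Cx Cy; rewrite x0 y0 addr0.
Qed.

Lemma sn_addE x y : C x -> C y ->
  sn_add (sn_class x) (sn_class y) = sn_class (x + y).
Proof.
move=> Cx Cy; apply/sn_class_eq; try exact: sn_carD.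
rewrite opprD addrACA; apply: sn_norm_small; try exact: sn_carB.
  exact: sn_class_val.
exact: sn_class_val.
Qed.

Lemma sn_scaleE a x : C x -> sn_scale a (sn_class x) = sn_class (a *: x).
Proof.
move=> Cx; apply/sn_class_eq; try exact: sn_carZ.
rewrite -scalerBr sn_normZ ?sn_class_val ?mulr0 //; exact: sn_carB.
Qed.

Lemma sn_oppE x : C x -> sn_opp (sn_class x) = sn_class (- x).
Proof.
by move=> Cx; rewrite -scaleN1r -sn_scaleE // /sn_opp /sn_scale scaleN1r.
Qed.

Lemma sn_addA : associative sn_add.
Proof.
move=> q r s; have [x Cx ->] := sn_classP q; have [y Cy ->] := sn_classP r.
have [z Cz ->] := sn_classP s.
by rewrite !sn_addE ?addrA //; exact: sn_carD.
Qed.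

Lemma sn_addC : commutative sn_add.
Proof. by move=> q r; rewrite /sn_add addrC. Qed.

Lemma sn_add0 : left_id (sn_class 0) sn_add.
Proof.
move=> q; have [x Cx ->] := sn_classP q.
by rewrite sn_addE ?add0r //; exact: sn_car0.
Qed.

Lemma sn_addN : left_inverse (sn_class 0) sn_opp sn_add.
Proof.
move=> q; have [x Cx ->] := sn_classP q.
by rewrite sn_oppE // sn_addE ?addNr //; exact: sn_carN.
Qed.

HB.instance Definition _ :=
  GRing.isZmodule.Build sn_quotient sn_addA sn_addC sn_add0 sn_addN.

Lemma sn_scaleA a b q : sn_scale a (sn_scale b q) = sn_scale (a * b) q.
Proof.
have [x Cx ->] := sn_classP q.
by rewrite !sn_scaleE ?scalerA //; exact: sn_carZ.
Qed.

Lemma sn_scale1 : left_id 1 sn_scale.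
Proof. by move=> q; have [x Cx ->] := sn_classP q; rewrite sn_scaleE // scale1r. Qed.

Lemma sn_scaleDr : right_distributive sn_scale +%R.
Proof.
move=> a q r; have [x Cx ->] := sn_classP q; have [y Cy ->] := sn_classP r.
rewrite -[_ + _]/(sn_add _ _) -[RHS]/(sn_add _ _) (sn_addE Cx Cy).
rewrite !sn_scaleE //; last exact: sn_carD.
by rewrite scalerDr (sn_addE (sn_carZ a Cx) (sn_carZ a Cy)).
Qed.

Lemma sn_scaleDl q : {morph sn_scale^~ q : a b / a + b}.
Proof.
move=> a b; have [x Cx ->] := sn_classP q.
rewrite -[RHS]/(sn_add _ _) !sn_scaleE //.
by rewrite sn_addE ?scalerDl //; exact: sn_carZ.
Qed.

HB.instance Definition _ := GRing.Zmodule_isLmodule.Build R sn_quotient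
  sn_scaleA sn_scale1 sn_scaleDr sn_scaleDl.

Definition sn_qnorm q : R := p (val q).

Lemma sn_qnormE x : C x -> sn_qnorm (sn_class x) = p x.
Proof.
by move=> Cx; apply: sn_norm_eq => //; exact: sn_class_val.
Qed.

Lemma sn_qnormD q r : sn_qnorm (q + r) <= sn_qnorm q + sn_qnorm r.
Proof.
have [x Cx ->] := sn_classP q; have [y Cy ->] := sn_classP r.
rewrite -[_ + _ in leLHS]/(sn_add _ _) sn_addE // !sn_qnormE ?sn_normD //.
exact: sn_carD.
Qed.

Lemma sn_qnormZ a q : sn_qnorm (a *: q) = `|a| * sn_qnorm q.
Proof.
have [x Cx ->] := sn_classP q; rewrite -[_ *: _]/(sn_scale _ _) sn_scaleE //.
by rewrite !sn_qnormE ?sn_normZ //; exact: sn_carZ.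
Qed.

Lemma sn_qnorm0 q : sn_qnorm q = 0 -> q = 0.
Proof.
have [x Cx ->] := sn_classP q; rewrite sn_qnormE // => x0.
by apply/sn_class_eq; rewrite ?subr0 //; exact: sn_car0.
Qed.

HB.instance Definition _ :=
  Lmodule_isNormed.Build R sn_quotient sn_qnormD sn_qnormZ sn_qnorm0.

Lemma sn_quotient_complete (F : set_system sn_quotient) :
  ProperFilter F -> cauchy F -> cvg F.
Proof.
move=> PF cF.
(* Centres of intersecting balls of radii 2^-(n+2) and 2^-(n+3) are less than 2^-n apart, the rate
   that [sn_complete] requires. *)
pose rad n : R := 2^-1 ^+ n.+2.
have rad0 n : 0 < rad n by rewrite exprn_gt0 // invr_gt0.
have radS n : rad n = 2 * rad n.+1 by rewrite /rad !exprS; field.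
have hx n : exists q : sn_quotient, F (ball q (rad n)).
  by have /cauchyP := cF; apply.
have /choice[q hq] := hx.
have dq n : `|q n.+1 - q n| <= 2^-1 ^+ n.
  have [r []] : (ball (q n) (rad n) `&` ball (q n.+1) (rad n.+1)) !=set0.
    exact: (@filter_ex _ F _ _ (filterI (hq n) (hq n.+1))).
  rewrite -!ball_normE /= => h1 h2.
  have -> : q n.+1 - q n = (q n.+1 - r) - (q n - r).
    by rewrite opprB addrA subrK.
  apply: le_trans (ler_normB _ _) _; apply: le_trans (lerD (ltW h2) (ltW h1)) _.
  have e1 : 2^-1 ^+ n = 4 * rad n :> R by rewrite /rad !exprS; field.
  rewrite e1; have := radS n; have := rad0 n; have := rad0 n.+1; lra.
have nE r s : `|r - s| = p (val r - val s).
  rewrite -{1}(sn_classK r) -{1}(sn_classK s).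
  rewrite -[- _]/(sn_opp _) -[_ + _]/(sn_add _ _) sn_oppE // sn_addE //; last exact: sn_carN.
  by rewrite -[LHS]/(sn_qnorm _) sn_qnormE //; exact: sn_carB.
have dq' n : p (val (q n.+1) - val (q n)) <= 2^-1 ^+ n by rewrite -nE.
have [v Cv hv] := sn_complete (fun n => sn_val (q n)) dq'.
apply/cvg_ex; exists (sn_class v); apply/fcvgrPdist_lt => e e0.
have e2 : 0 < e / 2 by rewrite divr_gt0.
have [n0 h0] := hv _ e2.
have [n1 h1] : exists n1, rad n1 < e / 2.
  have : (fun n => (2^-1 : R) ^+ n) @ \oo --> (0 : R).
    by apply: cvg_expr; rewrite ger0_norm ?invr_ge0 // invf_lt1 // ltr1n.
  move=> /cvgr0Pnorm_lt/(_ _ e2)[n1 _ h1]; exists n1.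
  apply: le_lt_trans (h1 n1 (leqnn _)); apply: le_trans (ler_norm _).
  by apply: ler_wiXn2l; rewrite ?invr_ge0 ?invf_le1 ?ler1n // (leq_trans (leqnSn _)).
pose n := maxn n0 n1.
have hn1 : rad n < e / 2.
  apply: le_lt_trans h1; rewrite /rad.
  apply: ler_wiXn2l; rewrite ?invr_ge0 ?invf_le1 ?ler1n //.
  by rewrite !ltnS leq_maxr.
apply: filterS (hq n) => r; rewrite -ball_normE /= => hr.
have -> : sn_class v - r = (sn_class v - q n) + (q n - r) by rewrite addrA subrK.
apply: le_lt_trans (ler_normD _ _) _.
rewrite [e]splitr; apply: ltrD; last exact: lt_trans hr hn1.
rewrite distrC nE.
have Cc : C (val (q n) - v) by exact: sn_carB.
apply: le_lt_trans (h0 n (leq_maxl _ _)).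
have -> : val (q n) - val (sn_class v) = (val (q n) - v) + (v - val (sn_class v)).
  by rewrite addrA subrK.
apply: le_trans (sn_normD Cc _) _; first exact: sn_carB.
have vc : p (v - val (sn_class v)) = 0.
  by rewrite sn_normB //; exact: sn_class_val.
by rewrite vc addr0.
Qed.

HB.instance Definition _ :=
  Uniform_isComplete.Build sn_quotient sn_quotient_complete.

Definition sn_banach : completeNormedModType R := sn_quotient.

End complete_seminormed_quotient.

#[local] Opaque cesaro_space.

(** * The Cesaro space as an AL-space under the bound *)

Section AL_sufficient.
Variables (R : realType) (X : funspace R) (hX : is_ri X).
Local Notation T := (lebT R).
Local Notation N := (fs_norm X).
Local Notation hB := (ri_Bfs hX).
Local Notation CX := (cesaro_space X).
Implicit Types (f g h : T -> R) (x y t : T).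

(** [F_y] does not vanish on (y,1), a set of positive measure. *)
Lemma phi_gt0 y : 0 < (y : R) < 1 -> 0 < phi X y.
Proof.
move=> /andP[y0 y1]; rewrite lt_neqAle phi_ge0 // andbT; apply/eqP => /esym h.
have Fy0 : ae_eq01 (Fy y) (fun=> 0).
  apply: (bfs_norm0_eq0 hB (Fy_X hX y0)).
  by rewrite -h phiE // y0 ltW.
have [x /andP[yx x1]] := ae01_exists (introT andP (conj (ltW y0) y1)) Fy0.
rewrite FyE (ltW yx) (ltW x1) /= => /eqP.
by rewrite invr_eq0 gt_eqF // (lt_trans y0).
Qed.

Lemma Iphi_eq0 f : nneg f -> Iphi X f = 0%E -> ae_eq01 f (fun=> 0).
Proof.
move=> nf f0; have mI := @measurable_I01 R.
have mp := measurable_phiM hX nf.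
have : (\int[lam]_(t in I01) `|(EFin \o (fun t => f t * phi X t)%R) t|)%E = 0%E.
  rewrite -f0; apply: eq_integral => t; rewrite inE => It.
  by rewrite gee0_abs // lee_fin mulr_ge0 ?phi_ge0 // (nneg_ge0 nf).
move=> /(ae_eq_integral_abs _ mI mp) h.
have h1 : {ae lam, forall x : T, I01 x -> 0 < (x : R) < 1} by exact: ae01W.
move: h h1; apply: filterS2 => t h h1 It; have := h It => -[/eqP].
rewrite mulf_eq0 => /orP[/eqP //|]; by rewrite gt_eqF // phi_gt0 // h1.
Qed.

Lemma ae_le_Iphi f g : nneg f -> nneg g ->
  {ae lam, forall t, I01 t -> f t <= g t} -> (Iphi X f <= Iphi X g)%E.
Proof.
move=> nf ng fg; apply: (ae_ge0_le_integral (@measurable_I01 R)).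
- by move=> t It; rewrite lee_fin mulr_ge0 ?phi_ge0 // (nneg_ge0 nf).
- exact: measurable_phiM.
- by move=> t It; rewrite lee_fin mulr_ge0 ?phi_ge0 // (nneg_ge0 ng).
- exact: measurable_phiM.
- by apply: filterS fg => t h It; rewrite lee_fin ler_wpM2r ?phi_ge0 // h.
Qed.

(** The tail comes from [riesz_fischer] applied to the shifted series; both sums are known
    pointwise, so they match almost everywhere. *)
Lemma riesz_fischer_tail (f : nat -> T -> R) :
  (forall k, cx X (f k)) -> (forall k, N (ces (f k)) <= 2^-1 ^+ k) ->
  exists2 F, cx X F & forall n, exists G, [/\ cx X G,
    N (ces G) <= 2 * 2^-1 ^+ n & ae_eq01 F (fun t => \sum_(k < n) f k t + G t)].
Proof.
move=> cf Nf.
have Nf' k : N (ces (f k)) <= 1 * 2^-1 ^+ k by rewrite mul1r.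
have [F [cF _ FE]] := riesz_fischer hX cf Nf'.
exists F => // n.
have Nn k : N (ces (f (n + k)%N)) <= 2^-1 ^+ n * 2^-1 ^+ k by rewrite -exprD.
have [G [cG NG GE]] := riesz_fischer hX (fun k => cf (n + k)%N) Nn.
exists G; split => //; move: FE GE; apply: filterS2 => t hF hG It.
apply: EFin_inj; rewrite EFinD (hF It) (hG It).
have f0 k : (0 <= (f k t)%:E)%E by rewrite lee_fin (nneg_ge0 (cx_nneg (cf k))).
rewrite (nneseries_split 0 n) //; congr (_ + _)%E.
  by rewrite add0n big_mkord sumEFin.
rewrite add0n -{1}(addn0 n) -nneseries_addn //.
by apply: eq_eseriesr => k _; rewrite addn0 addnC.
Qed.

Hypothesis hAL : AL_bound X.

Definition Lphi f : R := fine (Iphi X (fun t => `|f t|)).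

Lemma Lphi_fin f : CX f -> Iphi X (fun t => `|f t|) \is a fin_num.
Proof.
move=> /cesaro_spaceP[mf cf]; have [K K0 hK] := AL_bound_cx hX hAL.
rewrite ge0_fin_numE; last exact: (Iphi_ge0 hX (nneg_abs mf)).
by apply: le_lt_trans (hK _ cf) _; rewrite ltry.
Qed.

Lemma LphiE f : CX f -> (Lphi f)%:E = Iphi X (fun t => `|f t|).
Proof. by move=> Cf; rewrite fineK // Lphi_fin. Qed.

Lemma ae_le_Lphi f g : CX f -> CX g ->
  {ae lam, forall t, I01 t -> `|f t| <= `|g t|} -> Lphi f <= Lphi g.
Proof.
move=> Cf Cg fg; rewrite -lee_fin !LphiE //.
exact: (ae_le_Iphi (nneg_abs (CX_meas Cf)) (nneg_abs (CX_meas Cg)) fg).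
Qed.

Lemma ae_Lphi_add f g h : CX f -> CX g -> CX h ->
  {ae lam, forall t, I01 t -> `|h t| = `|f t| + `|g t|} ->
  Lphi h = Lphi f + Lphi g.
Proof.
move=> Cf Cg Ch E.
have nf := nneg_abs (CX_meas Cf); have ng := nneg_abs (CX_meas Cg).
have nh := nneg_abs (CX_meas Ch).
apply: EFin_inj; rewrite EFinD !LphiE // -(IphiD hX nf ng).
exact: (ae_eq_Iphi hX nh (nnegD nf ng) E).
Qed.

Lemma Lphi_normD f g : CX f -> CX g -> Lphi (fun t => f t + g t) <= Lphi f + Lphi g.
Proof.
move=> Cf Cg; have Cfg := CXD hX Cf Cg.
have nf := nneg_abs (CX_meas Cf); have ng := nneg_abs (CX_meas Cg).
rewrite -lee_fin EFinD !LphiE // -(IphiD hX nf ng).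
apply: (Iphi_le hX (nneg_abs (CX_meas Cfg)) (nnegD nf ng)) => t _.
exact: ler_normD.
Qed.

Lemma Lphi_normZ (a : R) f : CX f -> Lphi (fun t => a * f t) = `|a| * Lphi f.
Proof.
move=> Cf; have [Ca _] := CXZ hX a Cf.
have nf := nneg_abs (CX_meas Cf).
apply: EFin_inj; rewrite EFinM !LphiE // -(IphiZ hX (normr_ge0 a) nf).
by apply: eq_Iphi => t _; rewrite normrM.
Qed.

Lemma norm_le_Lphi f : CX f -> N (cesaro_abs f) <= Lphi f.
Proof.
move=> Cf; have nf := nneg_abs (CX_meas Cf).
rewrite -lee_fin LphiE //.
have If : (Iphi X (fun t => `|f t|%R) < +oo)%E by rewrite -LphiE // ltry.
by have [] := Iphi_norm_le hX nf If.
Qed.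

Lemma Lphi_eq0 f : CX f -> Lphi f = 0 -> ae_eq01 f (fun=> 0).
Proof.
move=> Cf f0; have nf := nneg_abs (CX_meas Cf).
have I0 : Iphi X (fun t => `|f t|) = 0%E by rewrite -LphiE // f0.
apply: filterS (Iphi_eq0 nf I0) => t h It.
by apply/eqP; rewrite -normr_eq0 h.
Qed.

Lemma CX_complete (u : nat -> T -> R) : (forall n, CX (u n)) ->
  (forall n, Lphi (fun t => u n.+1 t - u n t) <= 2^-1 ^+ n) ->
  exists2 v, CX v & forall e : R, 0 < e ->
    exists n0, forall n, (n0 <= n)%N -> Lphi (fun t => u n t - v t) < e.
Proof.
move=> Cu du.
pose w k t := u k.+1 t - u k t.
have Cw k : CX (w k) by apply: (CXD hX (Cu _)); exact: CXN.
have Nw k : N (cesaro_abs (w k)) <= 2^-1 ^+ k.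
  exact: le_trans (norm_le_Lphi (Cw k)) (du k).
(* The increments are summed through their positive and negative parts, since [riesz_fischer_tail]
   treats nonnegative functions. *)
pose wp k t := Num.max (w k t) 0; pose wm k t := Num.max (- w k t) 0.
have mw k : measurable_fun (@I01 R) (w k) := CX_meas (Cw k).
have np k : nneg (wp k).
  split; last by move=> t _; rewrite /wp le_max lexx orbT.
  by apply: measurable_maxr; [exact: mw|exact: measurable_cst].
have nm k : nneg (wm k).
  split; last by move=> t _; rewrite /wm le_max lexx orbT.
  by apply: measurable_maxr; [exact: measurable_funN|exact: measurable_cst].
have cw k : cx X (fun t => `|w k t|) by have /cesaro_spaceP[] := Cw k.
have wpl k t : I01 t -> wp k t <= `|w k t|.
  by move=> _; rewrite /wp ge_max ler_norm normr_ge0.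
have wml k t : I01 t -> wm k t <= `|w k t|.
  by move=> _; rewrite /wm ge_max -normrN ler_norm normr_ge0.
have wE k t : w k t = wp k t - wm k t.
  rewrite /wp /wm; case: (lerP 0 (w k t)) => h.
    by rewrite [X in _ - X]max_r ?oppr_le0 // subr0.
  by rewrite max_l ?oppr_ge0 ?ltW // sub0r opprK.
have hp k := cx_le hX (np k) (cw k) (@wpl k).
have hm k := cx_le hX (nm k) (cw k) (@wml k).
have [Fp cFp hFp] := riesz_fischer_tail (fun k => (hp k).1)
  (fun k => le_trans (hp k).2 (Nw k)).
have [Fm cFm hFm] := riesz_fischer_tail (fun k => (hm k).1)
  (fun k => le_trans (hm k).2 (Nw k)).
pose v t := u 0 t + (Fp t - Fm t).
have Cv : CX v.
  apply: (CXD hX (Cu 0)); apply: (CXD hX (CX_nneg hX cFp).1).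
  exact: CXN (CX_nneg hX cFm).1.
have [K K0 hK] := AL_bound_cx hX hAL.
exists v => // e e0.
(* Each of the two tails has norm at most [2 * 2^-n], whence the 4; [K] passes from the norm of X to
   [Lphi]. *)
have bound n : Lphi (fun t => u n t - v t) <= K * 4 * 2^-1 ^+ n.
  have [Gp [cGp NGp Ep]] := hFp n; have [Gm [cGm NGm Em]] := hFm n.
  have un t : u n t = u 0 t + \sum_(k < n) w k t.
    elim: n {Gp cGp NGp Ep Gm cGm NGm Em} => [|n IH].
      by rewrite big_ord0 addr0.
    by rewrite big_ord_recr /= addrA -IH /w addrC subrK.
  have [cG NG] := cxD hX cGp cGm.
  have Cd : CX (fun t => u n t - v t) by apply: (CXD hX (Cu n)); exact: CXN.
  rewrite -lee_fin LphiE //; apply: le_trans (ae_le_Iphi _ (cx_nneg cG) _) _.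
  - exact: (nneg_abs (CX_meas Cd)).
  - move: Ep Em; apply: filterS2 => t Ep Em It.
    have gp := nneg_ge0 (cx_nneg cGp) It; have gm := nneg_ge0 (cx_nneg cGm) It.
    have -> : u n t - v t = Gm t - Gp t.
      rewrite un /v (Ep It) (Em It).
      rewrite (eq_bigr (fun k : 'I_n => wp k t - wm k t)) ?sumrB => [|k _]; last exact: wE.
      by ring.
    by apply: le_trans (ler_normB _ _) _; rewrite !ger0_norm // addrC.
  apply: le_trans (hK _ cG) _; rewrite lee_fin -mulrA ler_wpM2l //.
  apply: le_trans NG _; apply: le_trans (lerD NGp NGm) _.
  by rewrite -mulrDl -natrD.
have : (fun n => (2^-1 : R) ^+ n) @ \oo --> (0 : R).
  by apply: cvg_expr; rewrite ger0_norm ?invr_ge0 // invf_lt1 // ltr1n.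
have K41 : 0 < K * 4 + 1 by rewrite ltr_wpDl // mulr_ge0.
move=> /cvgr0Pnorm_lt/(_ _ (divr_gt0 e0 K41))[n0 _ h]; exists n0 => n n0n.
apply: le_lt_trans (bound n) _.
have p0 : 0 <= (2^-1 : R) ^+ n by rewrite exprn_ge0 // invr_ge0.
apply: (@le_lt_trans _ _ ((K * 4 + 1) * 2^-1 ^+ n)).
  by rewrite ler_wpM2r // lerDl.
rewrite mulrC -ltr_pdivlMr //; apply: le_lt_trans (ler_norm _) _.
exact: h.
Qed.

Lemma CX_linear (a : R) f g : CX f -> CX g -> CX (fun t => a * f t + g t).
Proof. by move=> Cf Cg; exact: (CXD hX (CXZ hX a Cf).1 Cg). Qed.

Definition CX_complete_seminormed : complete_seminormed R :=
  @CompleteSeminormed R (nl_sort (nl_of_fun CX)) (fs_car CX) Lphi (CX0 hX) CX_linear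
    Lphi_normD Lphi_normZ CX_complete.

Local Notation D := CX_complete_seminormed.
Local Notation E := (sn_banach D).
Implicit Types (q r s : E).

Definition L1class f : E := sn_class (D := D) f.
Definition L1rep q : T -> R := val (q : sn_quotient D).

Lemma L1rep_CX q : CX (L1rep q).
Proof. exact: (sn_val (D := D) q). Qed.

Lemma L1class_eq f g : CX f -> CX g -> L1class f = L1class g <-> ae_eq01 f g.
Proof.
move=> Cf Cg; have Cd : CX (fun t => f t - g t) by apply: (CXD hX Cf); exact: CXN.
split.
  move=> /(@sn_class_eq R D f g Cf Cg) h.
  have := Lphi_eq0 Cd h; apply: filterS => t ht It.
  by apply/eqP; rewrite -subr_eq0 ht.
move=> fg; apply/(@sn_class_eq R D f g Cf Cg).
apply/eqP; rewrite eq_le; apply/andP; split; last exact: (@sn_norm_ge0 R D _ Cd).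
rewrite -(@sn_norm0 R D); apply: ae_le_Lphi => //; first exact: CX0.
by apply: filterS fg => t h It; rewrite /= !fctE (h It) subrr.
Qed.

Lemma L1classK q : L1class (L1rep q) = q.
Proof. exact: (sn_classK (D := D) q). Qed.

Lemma L1repK f : CX f -> ae_eq01 (L1rep (L1class f)) f.
Proof.
move=> Cf; apply/L1class_eq => //; first exact: L1rep_CX.
exact: L1classK.
Qed.

Lemma L1norm q : `|q| = Lphi (L1rep q).
Proof. by []. Qed.

Lemma CX_max f g : CX f -> CX g -> CX (fun t => Num.max (f t) (g t)).
Proof.
move=> Cf Cg; have mf := CX_meas Cf; have mg := CX_meas Cg.
have /cesaro_spaceP[_ cf] := Cf; have /cesaro_spaceP[_ cg] := Cg.
have [Ca _] := CX_nneg hX (cxD hX cf cg).1.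
apply: (CX_le hX Ca (measurable_maxr mf mg) _).1 => t _.
rewrite [leRHS]ger0_norm ?addr_ge0 //.
rewrite -[(f \max g) t]/(Num.max (f t) (g t)).
by case: (leP (f t) (g t)) => _; rewrite ?lerDr ?lerDl.
Qed.

Lemma CX_min f g : CX f -> CX g -> CX (fun t => Num.min (f t) (g t)).
Proof.
move=> Cf Cg; have := CXN hX (CX_max (CXN hX Cf) (CXN hX Cg)).
by congr (fs_car CX _); apply/funext => t; rewrite oppr_max !opprK.
Qed.

Definition L1le q r : Prop := {ae lam, forall t, I01 t -> L1rep q t <= L1rep r t}.
Definition L1join q r : E := L1class (fun t => Num.max (L1rep q t) (L1rep r t)).
Definition L1meet q r : E := L1class (fun t => Num.min (L1rep q t) (L1rep r t)).

Lemma L1rep_join q r :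
  ae_eq01 (L1rep (L1join q r)) (fun t => Num.max (L1rep q t) (L1rep r t)).
Proof. by apply: L1repK; apply: CX_max; exact: L1rep_CX. Qed.

Lemma L1rep_meet q r :
  ae_eq01 (L1rep (L1meet q r)) (fun t => Num.min (L1rep q t) (L1rep r t)).
Proof. by apply: L1repK; apply: CX_min; exact: L1rep_CX. Qed.

Lemma L1repD q r : ae_eq01 (L1rep (q + r)) (fun t => L1rep q t + L1rep r t).
Proof. by apply: L1repK; apply: (CXD hX); exact: L1rep_CX. Qed.

Lemma L1repZ (a : R) q : ae_eq01 (L1rep (a *: q)) (fun t => a * L1rep q t).
Proof. by apply: L1repK; have [] := CXZ hX a (L1rep_CX q). Qed.

Lemma L1repN q : ae_eq01 (L1rep (- q)) (fun t => - L1rep q t).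
Proof. by apply: L1repK; apply: (CXN hX); exact: L1rep_CX. Qed.

Lemma L1rep0 : ae_eq01 (L1rep 0) (fun=> 0).
Proof. by apply: L1repK; exact: CX0. Qed.

Lemma L1rep_abs q : ae_eq01 (L1rep (L1join q (- q))) (fun t => `|L1rep q t|).
Proof.
move: (L1rep_join q (- q)) (L1repN q); apply: filterS2 => t h1 h2 It.
by rewrite h1 // h2 // maxrN.
Qed.

#[local] Opaque L1rep L1class L1join L1meet.

Lemma min_norm_eq0 (u v a b : R) : Num.min u v = 0 -> u = `|a| -> v = `|b| ->
  a = 0 \/ b = 0.
Proof.
move=> + eu ev; rewrite eu ev.
case: (leP `|a| `|b|) => _ /eqP; rewrite normr_eq0 => /eqP.
  by left.
by right.
Qed.

Lemma L1_AL : AL_space L1le L1join L1meet.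
Proof.
split; last first.
  move=> q r h; rewrite !L1norm; apply: ae_Lphi_add; try exact: L1rep_CX.
  have h0 : ae_eq01 (L1rep (L1meet (L1join q (- q)) (L1join r (- r)))) (fun=> 0).
    by rewrite h; exact: L1rep0.
  have hm := L1rep_meet (L1join q (- q)) (L1join r (- r)).
  have h1 : {ae lam, forall t, I01 t -> L1rep q t = 0 \/ L1rep r t = 0}.
    have h2 : {ae lam, forall t, I01 t ->
        Num.min (L1rep (L1join q (- q)) t) (L1rep (L1join r (- r)) t) = 0}.
      by move: h0 hm; apply: filterS2 => t h0 hm It; rewrite -hm // h0.
    move: h2 (L1rep_abs q) (L1rep_abs r); apply: filterS3 => t h2 hq hr It.
    exact: (min_norm_eq0 (h2 It) (hq It) (hr It)).
  move: h1 (L1repD q r); apply: filterS2 => t h1 hD It; rewrite (hD It).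
  by case: (h1 It) => ->; rewrite normr0 ?add0r ?addr0.
split.
- by move=> q; apply: aeW.
- move=> q r qr rq; rewrite -(L1classK q) -(L1classK r).
  apply/L1class_eq; try exact: L1rep_CX.
  by move: qr rq; apply: filterS2 => t h1 h2 It; apply/le_anti; rewrite h1 ?h2.
- move=> q r s; apply: filterS2 => t h1 h2 It.
  exact: le_trans (h1 It) (h2 It).
- move=> q r; move: (L1rep_join q r); apply: filterS => t h It.
  by rewrite (h It) le_max lexx.
- move=> q r; move: (L1rep_join q r); apply: filterS => t h It.
  by rewrite (h It) le_max lexx orbT.
- move=> q r s; move: (L1rep_join q r); apply: filterS3 => t h h1 h2 It.
  by rewrite (h It) ge_max h1 ?h2.
- move=> q r; move: (L1rep_meet q r); apply: filterS => t h It.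
  by rewrite (h It) ge_min lexx.
- move=> q r; move: (L1rep_meet q r); apply: filterS => t h It.
  by rewrite (h It) ge_min lexx orbT.
- move=> q r s; move: (L1rep_meet q r); apply: filterS3 => t h h1 h2 It.
  by rewrite (h It) le_min h1 ?h2.
- move=> q r s; move: (L1repD q s) (L1repD r s); apply: filterS3 => t h1 h2 h It.
  by rewrite (h1 It) (h2 It) lerD2r h.
- move=> a q r a0; move: (L1repZ a q) (L1repZ a r); apply: filterS3 => t h1 h2 h It.
  by rewrite (h1 It) (h2 It) ler_wpM2l // h.
- move=> q r h; rewrite !L1norm; apply: ae_le_Lphi; try exact: L1rep_CX.
  move: (L1rep_abs q) (L1rep_abs r) h; apply: filterS3 => t h1 h2 h It.
  by rewrite -(h1 It) -(h2 It) h.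
Qed.

Lemma AL_bound_sufficient : order_isomorphic_to_AL (nl_of_fun CX).
Proof.
exists E, L1le, L1join, L1meet, L1class; split; first exact: L1_AL.
have sub f g : CX f -> CX g -> CX (fun t => f t - g t).
  by move=> Cf Cg; apply: (CXD hX Cf); exact: CXN.
have classB f g : CX f -> CX g -> `|L1class f - L1class g| = Lphi (fun t => f t - g t).
  move=> Cf Cg; have Cfg := sub _ _ Cf Cg; rewrite L1norm.
  have h : ae_eq01 (L1rep (L1class f - L1class g)) (fun t => f t - g t).
    have : {ae lam, forall t, I01 t -> L1rep (L1class f - L1class g) t =
        L1rep (L1class f) t - L1rep (L1class g) t}.
      move: (L1repD (L1class f) (- L1class g)) (L1repN (L1class g)).
      by apply: filterS2 => t h1 h2 It; rewrite (h1 It) (h2 It).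
    move: (L1repK Cf) (L1repK Cg); apply: filterS3 => t h3 h4 h5 It.
    by rewrite (h5 It) (h3 It) (h4 It).
  apply/eqP; rewrite eq_le; apply/andP; split; apply: ae_le_Lphi;
    try exact: L1rep_CX; try exact: Cfg;
    by apply: filterS h => t h It; rewrite (h It).
have [K K0 hK] := AL_bound_cx hX hAL.
split.
- by [].
- by move=> f g Cf Cg; exact: (L1class_eq Cf Cg).
- by move=> q _; exists (L1rep q); [exact: L1rep_CX|exact: L1classK].
- move=> a f g Cf Cg; have Ca := (CXZ hX a Cf).1.
  change (L1class (fun t => a * f t + g t) = a *: L1class f + L1class g).
  rewrite -[RHS]L1classK; apply/L1class_eq; [exact: CX_linear|exact: L1rep_CX|].
  have : {ae lam, forall t, I01 t -> L1rep (a *: L1class f + L1class g) t =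
      a * L1rep (L1class f) t + L1rep (L1class g) t}.
    move: (L1repD (a *: L1class f) (L1class g)) (L1repZ a (L1class f)).
    by apply: filterS2 => t h1 h2 It; rewrite (h1 It) (h2 It).
  move: (L1repK Cf) (L1repK Cg); apply: filterS3 => t h1 h2 h3 It.
  by rewrite (h3 It) (h1 It) (h2 It).
- move=> f g Cf Cg.
  change (L1class (fun t => Num.max (f t) (g t)) = L1join (L1class f) (L1class g)).
  apply/L1class_eq; [exact: CX_max|apply: CX_max; exact: L1rep_CX|].
  move: (L1repK Cf) (L1repK Cg); apply: filterS2 => t h1 h2 It.
  by rewrite (h1 It) (h2 It).
- move=> f g Cf Cg.
  change (L1class (fun t => Num.min (f t) (g t)) = L1meet (L1class f) (L1class g)).
  apply/L1class_eq; [exact: CX_min|apply: CX_min; exact: L1rep_CX|].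
  move: (L1repK Cf) (L1repK Cg); apply: filterS2 => t h1 h2 It.
  by rewrite (h1 It) (h2 It).
(* [K] may be 0, hence [K + 1]. *)
- move=> f Cf e e0; exists (e / (K + 1)); first by rewrite divr_gt0 // ltr_wpDl.
  move=> g Cg.
  change (N (cesaro_abs (fun t => g t - f t)) < e / (K + 1) ->
    `|L1class g - L1class f| < e).
  have Cd := sub _ _ Cg Cf; rewrite classB // ltr_pdivlMr ?ltr_wpDl // => h.
  apply: le_lt_trans h; rewrite -lee_fin LphiE //.
  have /cesaro_spaceP[_ cd] := Cd.
  apply: le_trans (hK _ cd) _; rewrite lee_fin mulrC.
  by rewrite ler_wpM2l ?lerDl //; exact: (CX_norm_ge0 hX Cd).
- move=> f Cf e e0; exists e => // g Cg.
  change (`|L1class g - L1class f| < e ->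
    N (cesaro_abs (fun t => g t - f t)) < e).
  have Cd := sub _ _ Cg Cf; rewrite classB //; apply: le_lt_trans.
  exact: norm_le_Lphi.
Qed.

End AL_sufficient.

(** * Hahn-Banach theorem *)

Section hahn_banach.
Variables (R : realType) (V : lmodType R) (C : set V) (p : V -> R).
Hypotheses (C0 : C 0)
  (Clin : forall (a : R) x y, C x -> C y -> C (a *: x + y))
  (pD : forall x y, C x -> C y -> p (x + y) <= p x + p y)
  (pZ : forall (a : R) x, 0 <= a -> C x -> p (a *: x) = a * p x).

Let CZ (a : R) x : C x -> C (a *: x).
Proof. by move=> Cx; rewrite -[_ *: _]addr0; exact: Clin. Qed.

Let CD x y : C x -> C y -> C (x + y).
Proof. by move=> Cx Cy; rewrite -[x]scale1r; exact: Clin. Qed.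

Let CN x : C x -> C (- x).
Proof. by rewrite -scaleN1r; exact: CZ. Qed.

Let p0 : p 0 = 0.
Proof. by rewrite -(scale0r (0 : V)) pZ // mul0r. Qed.

Let pN x : C x -> - p x <= p (- x).
Proof.
by move=> Cx; have := pD Cx (CN Cx); rewrite subrr p0 -lerBlDl sub0r.
Qed.

(* Graphs of linear functionals dominated by [p]; that such a set is a function
   follows from the domination, applied to [(0, r - s)] and [(0, s - r)]. *)
Let dominated (G : set (V * R)) :=
  (forall z, G z -> C z.1 /\ z.2 <= p z.1) /\
  (forall (a : R) z w, G z -> G w -> G (a *: z.1 + w.1, a * z.2 + w.2)).

Let dominated0 (G : set (V * R)) z : dominated G -> G z -> G (0, 0).
Proof.
move=> [_ h] Gz; have := h (-1) _ _ Gz Gz.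
by rewrite scaleN1r addNr mulN1r addNr.
Qed.

Let dominatedZ (G : set (V * R)) z (a : R) : dominated G -> G z ->
  G (a *: z.1, a * z.2).
Proof.
move=> dG Gz; have := dG.2 a _ _ Gz (dominated0 dG Gz).
by rewrite !addr0.
Qed.

Let dominated_fun (G : set (V * R)) x r s : dominated G -> G (x, r) -> G (x, s) ->
  r = s.
Proof.
move=> dG Gr Gs; apply/eqP; rewrite eq_le; apply/andP; split.
  have := dG.2 (-1) _ _ Gs Gr; rewrite /= scaleN1r addNr mulN1r => /dG.1[_] /=.
  by rewrite p0 addrC subr_le0.
have := dG.2 (-1) _ _ Gr Gs; rewrite /= scaleN1r addNr mulN1r => /dG.1[_] /=.
by rewrite p0 addrC subr_le0.
Qed.

(** By subadditivity, each [z.2 - p (z.1 - y)] is at most each [p (w.1 + y) - w.2], so a value [c]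
    at [y] fits in between; the supremum of the former is taken. Scaling reduces positive and
    negative multiples of [y] to these two bounds. *)
Let dominated_extend (G : set (V * R)) y : dominated G -> G !=set0 -> C y ->
  exists c : R, dominated [set z | exists w (a : R), G w /\
    z = (w.1 + a *: y, w.2 + a * c)].
Proof.
move=> dG [z0 Gz0] Cy; have G00 := dominated0 dG Gz0.
pose S := [set z.2 - p (z.1 - y) | z in G].
have ubS z : G z -> ubound S (p (z.1 + y) - z.2).
  move=> Gz _ [w Gw <-]; have [Cz _] := dG.1 _ Gz; have [Cw _] := dG.1 _ Gw.
  rewrite lerBrDr addrAC lerBlDr.
  have := dG.2 1 _ _ Gw Gz; rewrite /= scale1r mul1r => /dG.1[_] /= h.
  apply: le_trans h _.
  have -> : w.1 + z.1 = (z.1 + y) + (w.1 - y).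
    by rewrite [RHS]addrC -addrA [- y + _]addrC addrK.
  by apply: pD; apply: CD => //; exact: CN.
have supS : has_sup S.
  split; first by exists (z0.2 - p (z0.1 - y)); exists z0.
  by exists (p (z0.1 + y) - z0.2); exact: ubS.
pose c := sup S.
have c1 z : G z -> z.2 - c <= p (z.1 - y).
  move=> Gz; rewrite lerBlDr -lerBlDl; apply: ub_le_sup; first by case: supS.
  by exists z.
have c2 z : G z -> z.2 + c <= p (z.1 + y).
  move=> Gz; rewrite -lerBrDl; apply: ge_sup; [by case: supS|exact: ubS].
exists c; split.
  move=> _ [w [a [Gw ->]]] /=; have [Cw hw] := dG.1 _ Gw.
  split; first by apply: CD => //; exact: CZ.
  have [a0|a0|->] := ltrgt0P a.
  - have := c2 _ (dominatedZ a^-1 dG Gw); rewrite /= -(ler_pM2l a0) mulrDr mulrA.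
    rewrite mulfV ?gt_eqF // mul1r -(pZ (ltW a0)); last first.
      by apply: CD => //; exact: CZ.
    by rewrite scalerDr scalerA mulfV ?gt_eqF // scale1r.
  - have na0 : 0 < - a by rewrite oppr_gt0.
    have := c1 _ (dominatedZ (- a)^-1 dG Gw).
    rewrite /= -(ler_pM2l na0) mulrBr mulrA.
    rewrite mulfV ?gt_eqF // mul1r -(pZ (ltW na0)); last first.
      by apply: CD; [exact: CZ|exact: CN].
    rewrite scalerBr scalerA mulfV ?gt_eqF // scale1r.
    by rewrite mulNr opprK scaleNr opprK.
  - by rewrite scale0r mul0r !addr0.
move=> b _ _ [w [a [Gw ->]]] [w' [a' [Gw' ->]]] /=.
exists (b *: w.1 + w'.1, b * w.2 + w'.2), (b * a + a'); split; first exact: dG.2.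
congr (_, _) => /=.
  by rewrite scalerDr scalerDl addrACA scalerA.
by ring.
Qed.

Theorem hahn_banach x0 : C x0 -> exists l : V -> R, [/\
  forall (a : R) x y, C x -> C y -> l (a *: x + y) = a * l x + l y,
  forall x, C x -> l x <= p x & l x0 = p x0].
Proof.
move=> Cx0.
(* The point [(x0, p x0)] is required of nonempty graphs only: the union of the empty chain is empty
   and must satisfy [P]. *)
pose P (G : set (V * R)) := dominated G /\ (G !=set0 -> G (x0, p x0)).
have [|A [[dA xA] maxA]] := @Zorn_bigcup _ P.
  move=> F FP Ftot; split; last first.
    move=> [z [G FG Gz]]; exists G => //; apply: (FP _ FG).2; by exists z.
  split => [z [G FG Gz]|a z w [G FG Gz] [H FH Hw]].
    exact: (FP _ FG).1.1.
  have [GH|HG] := Ftot _ _ FG FH.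
    by exists H => //; apply: (FP _ FH).1.2 => //; exact: GH.
  by exists G => //; apply: (FP _ FG).1.2 => //; exact: HG.
have A0 : A !=set0.
  apply: contrapT => nA.
  (* The line through [x0] would properly extend an empty maximal element; for negative [a] its
     domination is [pN]. *)
  pose G := [set z : V * R | exists a : R, z = (a *: x0, a * p x0)].
  have Gx : G (x0, p x0) by exists 1; rewrite scale1r mul1r.
  have PG : P G.
    split => //; split.
      move=> _ [a ->] /=; split; first exact: CZ.
      have [a0|a0] := leP 0 a; first by rewrite pZ.
      have na0 : 0 <= - a by rewrite oppr_ge0 ltW.
      have := pN (CZ (- a) Cx0).
      by rewrite pZ // mulNr opprK scaleNr opprK.
    move=> b _ _ [a ->] [a' ->] /=; exists (b * a + a').
    by rewrite scalerDl scalerA mulrDl mulrA.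
  apply: (maxA G _ PG); split; last by move=> /(_ _ Gx) Ax; apply: nA; exists (x0, p x0).
  by move=> z Az; exfalso; apply: nA; exists z.
have Atot y : C y -> exists r, A (y, r).
  move=> Cy; apply: contrapT => ny.
  have [c dB] := dominated_extend dA A0 Cy.
  set B := [set z | _] in dB.
  have AB : A `<=` B.
    move=> z Az; exists z, 0; split => //.
    by rewrite scale0r mul0r !addr0; case: (z).
  have PB : P B by split => // _; apply: AB; exact: xA.
  apply: (maxA B _ PB); split => //.
  move=> BA; apply: ny; exists c; apply: BA; exists (0, 0), 1.
  have [z Az] := A0; split; first exact: dominated0 dA Az.
  by rewrite /= scale1r mul1r !add0r.
pose l x : R := xget 0 [set r | A (x, r)].
have lA x : C x -> A (x, l x).
  move=> Cx; rewrite /l; case: xgetP => [r _ //|h].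
  by have [r Ar] := Atot _ Cx; case: (h r).
exists l; split.
- move=> a x y Cx Cy; apply: (dominated_fun dA (lA _ (Clin a Cx Cy))).
  exact: (dA.2 a _ _ (lA _ Cx) (lA _ Cy)).
- by move=> x Cx; have [] := dA.1 _ (lA _ Cx).
- by apply: (dominated_fun dA (lA _ Cx0)); exact: xA.
Qed.

End hahn_banach.

(* The library integrates against arbitrary set functions, so no measure
   structure is needed on the variations of a vector measure. *)
Section integral_density.
Context d (T : measurableType d) (R : realType).
Variables (nu : {measure set T -> \bar R}) (mu : set T -> \bar R) (w : T -> R).
Hypotheses (mw : measurable_fun setT w) (w0 : forall t, 0 <= w t)
  (muE : forall A, measurable A -> mu A = (\int[nu]_(t in A) (w t)%:E)%E).
Local Open Scope ereal_scope.

Import HBNNSimple.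

Let sintegral_density (h : {nnsfun T >-> R}) :
  sintegral mu h = \int[nu]_t (h t * w t)%:E.
Proof.
have mwE : measurable_fun setT (EFin \o w) by exact/measurable_EFinP.
have mh (r : R) : measurable (h @^-1` [set r]) by exact: measurable_sfunP.
have r0 (r : R) t : (0 <= r * \1_(h @^-1` [set r]) t)%R.
  by rewrite indicE; case: (boolP (t \in _)) => [/set_mem <-|_];
    rewrite ?mulr1 ?mulr0.
have m1 (r : R) : measurable_fun setT (fun t => (\1_(h @^-1` [set r]) t * w t)%R).
  by apply: measurable_funM => //; exact: measurable_indic.
rewrite /sintegral -(fsbig_widen (range h) [set: R])//=; last first.
  move=> x [_ Nhx] /=; rewrite (_ : h @^-1` [set x] = set0) ?muE //.
    by rewrite integral_set0 mule0.
  by apply/seteqP; split => // t ht; apply: Nhx; exists t.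
transitivity (\int[nu]_t \sum_(r \in range h)
    ((r * \1_(h @^-1` [set r]) t) * w t)%:E); last first.
  apply: eq_integral => t _; rewrite (fimfunE h t) fsumEFin //.
  by rewrite !fsbig_finite //= mulr_suml.
rewrite ge0_integral_fsum //; last 2 first.
- move=> r; apply/measurable_EFinP; apply: measurable_funM => //.
  by apply: measurable_funM => //; exact: measurable_indic.
- by move=> r t _; rewrite lee_fin mulr_ge0.
apply: eq_fsbigr => r /set_mem[t _ <-{r}]; set r := h t.
rewrite muE // integral_mkcond.
under [RHS]eq_integral do rewrite -mulrA EFinM.
rewrite ge0_integralZl_EFin //; last 2 first.
- by move=> u _; rewrite lee_fin mulr_ge0 // indicE.
- by apply/measurable_EFinP; exact: m1.
congr (_ * _); apply: eq_integral => u _; rewrite patchE indicE.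
by case: ifPn => _; rewrite ?mul1r ?mul0r.
Qed.

(** The supremum unfolds the integral of a nonnegative function against [mu]. Monotone convergence
    is applied on the side of [nu], where a measure is available. *)
Let nnintegral_density (g : T -> \bar R) : measurable_fun setT g ->
  (forall t, 0 <= g t) ->
  ereal_sup [set sintegral mu h | h in
    [set h : {nnsfun T >-> R} | forall x, (h x)%:E <= g x]] =
  \int[nu]_t (g t * (w t)%:E).
Proof.
move=> mg g0; have mwE : measurable_fun setT (EFin \o w) by exact/measurable_EFinP.
have mhw (h : {nnsfun T >-> R}) : measurable_fun setT (fun t => (h t * w t)%:E).
  by apply/measurable_EFinP; exact: measurable_funM.
apply/eqP; rewrite eq_le; apply/andP; split.
  apply: ge_ereal_sup => _ [h /= hg <-]; rewrite sintegral_density.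
  apply: ge0_le_integral => //.
  - by move=> t _; rewrite lee_fin mulr_ge0.
  - by apply: emeasurable_funM.
  - by move=> t _; rewrite EFinM lee_wpmul2r // lee_fin.
pose a := nnsfun_approx measurableT mg.
have a_nd t : {homo (fun n => a n t) : m n / (m <= n)%N >-> (m <= n)%R}.
  by move=> m n mn; have /lefP := nd_nnsfun_approx measurableT mg mn; apply.
have ag t : EFin \o a ^~ t @ \oo --> g t by exact: cvg_nnsfun_approx.
have aw t : (fun n => (a n t * w t)%:E) @ \oo --> g t * (w t)%:E.
  under eq_fun do rewrite EFinM.
  by apply: cvgeZr => //; exact: ag.
have -> : \int[nu]_t (g t * (w t)%:E) =
    \int[nu]_t (limn (fun n => (a n t * w t)%:E)).
  by apply: eq_integral => t _; apply/esym/cvg_lim => //; exact: aw.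
rewrite monotone_convergence //; last 2 first.
- by move=> n t _; rewrite lee_fin mulr_ge0.
- by move=> t _ m n mn; rewrite lee_fin ler_wpM2r // a_nd.
apply: lime_le.
  apply: ereal_nondecreasing_is_cvgn => m n mn; apply: ge0_le_integral => //.
  - by move=> t _; rewrite lee_fin mulr_ge0.
  - by move=> t _; rewrite lee_fin ler_wpM2r // a_nd.
apply: nearW => n; rewrite -sintegral_density; apply: ereal_sup_ubound.
exists (a n) => //= t.
rewrite -(cvg_lim _ (ag t)) //; apply: lime_ge.
  by apply/cvg_ex; exists (g t); exact: ag.
by near=> m; rewrite lee_fin a_nd //; near: m; exact: nbhs_infty_ge.
Unshelve. all: by end_near. Qed.

Lemma integral_density (D : set T) (f : T -> \bar R) : measurable D ->
  measurable_fun D f ->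
  \int[mu]_(t in D) f t = \int[nu]_(t in D) (f t * (w t)%:E).
Proof.
move=> mD mf; rewrite [LHS]/integral funepos_restrict funeneg_restrict.
have E (g : T -> \bar R) : measurable_fun D g -> (forall t, 0 <= g t) ->
    ereal_sup [set sintegral mu h | h in
      [set h : {nnsfun T >-> R} | forall x, (h x)%:E <= (g \_ D) x]] =
    \int[nu]_(t in D) (g t * (w t)%:E).
  move=> mg g0; rewrite nnintegral_density.
  - rewrite [RHS]integral_mkcond; apply: eq_integral => t _.
    by rewrite !patchE; case: ifP => // _; rewrite mul0e.
  - exact: (measurable_restrictT g mD).1.
  - by move=> t; rewrite patchE; case: ifP.
rewrite E; [|exact: measurable_funepos|by move=> t; exact: funepos_ge0].
rewrite E; [|exact: measurable_funeneg|by move=> t; exact: funeneg_ge0].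
(* Since [w >= 0], the positive and negative parts of [f * w] are those of [f] multiplied by [w]. *)
rewrite [RHS]integralE; congr (_ - _); apply: eq_integral => t _.
  have := congr1 (fun g : T -> \bar R => g t) (ge0_funeposM f (w0 t)).
  by rewrite muleC => <-; rewrite !funeposE muleC.
have := congr1 (fun g : T -> \bar R => g t) (ge0_funenegM f (w0 t)).
by rewrite muleC => <-; rewrite !funenegE muleC.
Qed.

End integral_density.

(** * Variations of set functions with a density *)

Section variation.
Variables (R : realType).
Local Notation T := (lebT R).
Implicit Types (t : T) (A B : set T) (p nu : set T -> R) (w h : T -> R).
Local Open Scope ereal_scope.

Lemma set_variation_ub p w A : measurable_fun setT w -> (forall t, (0 <= w t)%R) ->
  (forall B, measurable B -> (p B)%:E <= \int[lam]_(t in B) (w t)%:E) ->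
  set_variation p A <= \int[lam]_(t in A) (w t)%:E.
Proof.
move=> mw w0 pw; apply: ge_ereal_sup => _ [n [F [mF tF <- ->]]].
rewrite -sumEFin; apply: (@le_trans _ _ (\sum_(i < n) \int[lam]_(t in F i) (w t)%:E)).
  by apply: lee_sum => i _; exact: pw.
have sT : [set` index_enum 'I_n] = [set: 'I_n].
  by apply/seteqP; split => i //= _; rewrite mem_index_enum.
have FE : \bigcup_i F i = \big[setU/set0]_(i <- index_enum 'I_n) F i.
  by rewrite -sT; exact: bigcup_seq.
rewrite FE -(ge0_integral_bigsetU _ mF (index_enum_uniq _)).
- exact: lexx.
- by rewrite sT.
- apply/measurable_EFinP; apply: (measurable_funS measurableT _ mw).
  exact: subsetT.
- by move=> t _; rewrite lee_fin.
Qed.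

(** The remainder [A] minus the union, placed at index 0, completes the disjoint pieces to a
    partition of [A]. *)
Lemma set_variation_superadditive p n (F : 'I_n -> set T) A :
  (forall B, measurable B -> (0 <= p B)%R) -> measurable A ->
  (forall i, measurable (F i)) -> trivIset setT F -> (forall i, F i `<=` A) ->
  (\sum_(i < n) p (F i))%:E <= set_variation p A.
Proof.
move=> p0 mA mF tF FA; pose U := \bigcup_i F i.
have mU : measurable U.
  have sT : [set` index_enum 'I_n] = [set: 'I_n].
    by apply/seteqP; split => i //= _; rewrite mem_index_enum.
  by rewrite /U -sT bigcup_seq; apply: bigsetU_measurable => i _; exact: mF.
pose G (i : 'I_n.+1) := if unlift ord0 i is Some j then F j else A `\` U.
have mG i : measurable (G i).
  by rewrite /G; case: unliftP => [j _|_]; [exact: mF|exact: measurableD].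
apply: (@le_trans _ _ (\sum_(i < n.+1) p (G i))%:E).
  rewrite lee_fin big_ord_recl.
  rewrite [X in (_ <= _ + X)%R](_ : _ = \sum_(i < n) p (F i))%R.
    by rewrite lerDr; exact: p0.
  by apply: eq_bigr => i _; rewrite /G liftK.
apply: ereal_sup_ubound; exists n.+1, G; split => //.
- move=> i j _ _; rewrite /G.
  case: unliftP => [i' ->|->]; case: unliftP => [j' ->|->] //.
  + by move=> [t [Fi Fj]]; congr lift; apply: tF => //; exists t.
  + by move=> [t [Fi [_ nU]]]; case: nU; exists i'.
  + by move=> [t [[_ nU] Fj]]; case: nU; exists j'.
- apply/seteqP; split => [t [i _]|t At].
    by rewrite /G; case: unliftP => [j _ /FA|_ []].
  have [[i _ Fi]|nU] := pselect (U t).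
    by exists (lift ord0 i) => //; rewrite /G liftK.
  by exists ord0 => //; rewrite /G unlift_none.
Qed.

Definition is_density nu h := [/\ measurable_fun setT h,
  lam.-integrable setT (EFin \o h) &
  forall A, measurable A -> (nu A)%:E = \int[lam]_(t in A) (h t)%:E].

Lemma density_integrable nu h A : is_density nu h -> measurable A ->
  lam.-integrable A (EFin \o h).
Proof.
by move=> [_ ih _] mA; exact: (integrableS measurableT mA (@subsetT _ A) ih).
Qed.

Lemma density_opp nu h : is_density nu h ->
  is_density (fun A => - nu A)%R (fun t => - h t)%R.
Proof.
move=> dh; have [mh ih hE] := dh; split.
- exact: (measurableT_comp (@oppr_measurable R setT)).
- by have := integrableN ih.
move=> A mA; have := integralZl mA (density_integrable dh mA) (-1)%R.
rewrite mulN1e -(hE _ mA) -EFinN => <-; apply: eq_integral => t _.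
by rewrite mulN1e.
Qed.

Lemma measurable_nneg_set h : measurable_fun setT h ->
  measurable [set t | (0 <= h t)%R].
Proof.
move=> mh; have := mh measurableT _ (measurable_itv `[0%R, +oo[).
congr measurable; apply/seteqP; split => t /=; rewrite in_itv/= andbT //.
by case.
Qed.

Definition pos_part w t := Num.max (w t) 0%R.

Lemma pos_part_ge0 w t : (0 <= pos_part w t)%R.
Proof. by rewrite /pos_part le_max lexx orbT. Qed.

Lemma measurable_pos_part h D : measurable_fun D h -> measurable_fun D (pos_part h).
Proof. by move=> mh; apply: measurable_maxr; [exact: mh|exact: measurable_cst]. Qed.

(** The supremum is attained on the part of [A] where [h >= 0], the positive set of a Hahn
    decomposition. *)
Lemma upper_variation_density nu h A : is_density nu h -> measurable A ->
  upper_variation nu A = \int[lam]_(t in A) (pos_part h t)%:E.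
Proof.
move=> dh mA; have [mh ih hE] := dh; apply/eqP; rewrite eq_le; apply/andP; split.
  apply: ge_ereal_sup => _ [B [mB BA] <-]; rewrite hE //.
  have mp D : measurable_fun D (EFin \o pos_part h).
    apply/measurable_EFinP.
    exact: (measurable_funS measurableT (@subsetT _ D) (measurable_pos_part mh)).
  have ihB := density_integrable dh mB.
  apply: (@le_trans _ _ (\int[lam]_(t in B) (pos_part h t)%:E)).
    apply: (le_integral mB ihB) => [|t _]; last by rewrite lee_fin le_max lexx.
    apply: (le_integrable mB (mp B) _ ihB) => t _ /=; rewrite lee_fin.
    rewrite ger0_norm; last exact: pos_part_ge0.
    by rewrite /pos_part; case: (leP (h t) 0%R) => // _; exact: ler_norm.
  apply: (@ge0_subset_integral _ _ _ lam B A mB mA _ (mp A) _ BA) => t _.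
  by rewrite lee_fin pos_part_ge0.
have mP := measurable_nneg_set mh.
apply: ereal_sup_ubound; exists (A `&` [set t | (0 <= h t)%R]).
  by split; [exact: measurableI|exact: subIsetl].
rewrite hE; last exact: measurableI.
rewrite integral_mkcondr; apply: eq_integral => t _; rewrite patchE /pos_part.
case: ifPn => [/set_mem/= h0|/negP hP]; first by rewrite max_l.
by rewrite max_r // leNgt; apply/negP => h0; apply: hP; rewrite inE /= ltW.
Qed.

Lemma lower_variation_density nu h A : is_density nu h -> measurable A ->
  lower_variation nu A = \int[lam]_(t in A) (pos_part (fun t => - h t)%R t)%:E.
Proof. by move=> dh mA; exact: upper_variation_density (density_opp dh) mA. Qed.

Lemma pos_partB h t : (pos_part h t - pos_part (fun t => - h t) t)%R = h t.
Proof.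
rewrite /pos_part; case: (leP (h t) 0%R) => h0.
  by rewrite max_l ?oppr_ge0 // sub0r opprK.
by rewrite max_r ?oppr_le0 ?(ltW h0) // subr0.
Qed.

Lemma nonneg_density nu h : is_density nu h ->
  (forall A, measurable A -> (0 <= nu A)%R) -> is_density nu (pos_part h).
Proof.
move=> dh nu0; have [mh ih hE] := dh.
have mp := measurable_pos_part mh; split; first exact: mp.
  apply: (le_integrable measurableT _ _ ih).
    by apply/measurable_EFinP; exact: mp.
  move=> t _ /=; rewrite lee_fin ger0_norm; last exact: pos_part_ge0.
  by rewrite /pos_part; case: (leP (h t) 0%R) => // _; exact: ler_norm.
move=> A mA; have low : lower_variation nu A = 0.
  apply/eqP; rewrite eq_le; apply/andP; split.
    apply: ge_ereal_sup => _ [B [mB _] <-].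
    by rewrite lee_fin oppr_le0 nu0.
  rewrite (lower_variation_density dh mA); apply: integral_ge0 => t _.
  by rewrite lee_fin pos_part_ge0.
rewrite (hE _ mA) integralE [X in _ - X](_ : _ = lower_variation nu A).
  rewrite low sube0; apply: eq_integral => t _.
  by rewrite funeposE /pos_part EFin_max.
rewrite (lower_variation_density dh mA); apply: eq_integral => t _.
by rewrite funenegE /pos_part EFin_max.
Qed.

(** The partition of [A] into the parts where [h >= 0] and [h < 0] already reaches the supremum. *)
Lemma set_variation_density nu h A : is_density nu h -> measurable A ->
  set_variation (fun B => `|nu B|%R) A = \int[lam]_(t in A) (`|h t|%R)%:E.
Proof.
move=> dh mA; have [mh ih hE] := dh; pose P := [set t | (0 <= h t)%R].
have mP : measurable P := measurable_nneg_set mh.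
have mn : measurable_fun setT (fun t => `|h t|%R).
  exact: (measurableT_comp (@normr_measurable R setT)).
apply/eqP; rewrite eq_le; apply/andP; split.
  apply: set_variation_ub => // B mB; rewrite -abse_EFin (hE _ mB).
  by apply: (le_abse_integral _ mB); case/integrableP: (density_integrable dh mB).
pose F (i : 'I_2) := if val i == 0%N then A `&` P else A `\` P.
have mF i : measurable (F i).
  by rewrite /F; case: ifP => _; [exact: measurableI|exact: measurableD].
have tF : trivIset setT F.
  move=> i j _ _; rewrite /F => -[t []].
  case: eqP => i0; case: eqP => j0.
  - by move=> _ _; apply/val_inj; rewrite i0 j0.
  - by move=> [_ Pt] [_ /(_ Pt)].
  - by move=> [_ nPt] [_ /nPt].
  - move=> _ _; apply/val_inj; move: i j i0 j0 => [[|[|i]] hi] [[|[|j]] hj] //.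
have FA i : F i `<=` A by rewrite /F; case: ifP => _ t [].
apply: le_trans (set_variation_superadditive (p := fun B => `|nu B|%R) _ mA mF tF FA).
  rewrite !big_ord_recl big_ord0 addr0 EFinD /F /=.
  rewrite -{1}(setUIDK A P) ge0_integral_setU //=.
  - have n1 t : (A `&` P) t -> (`|h t| = h t)%R by move=> [_ h0]; rewrite ger0_norm.
    have n2 t : (A `\` P) t -> (`|h t| = - h t)%R.
      by move=> [_ /negP h0]; rewrite ler0_norm // ltW // ltNge.
    apply: leeD.
      under eq_integral => t /set_mem/n1 -> do [].
      rewrite -hE; last exact: measurableI.
      by rewrite lee_fin ler_norm.
    under eq_integral => t /set_mem/n2 -> do [].
    rewrite -[leLHS]oppeK -integral_ge0N => [|t /n2 <-]; last by rewrite lee_fin.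
    under eq_integral do rewrite -EFinN opprK.
    rewrite -hE; last exact: measurableD.
    by rewrite -EFinN lee_fin -normrN ler_norm.
  - exact: measurableI.
  - exact: measurableD.
  - by apply/measurable_EFinP; exact: (measurable_funS measurableT _ mn).
  - by apply/disj_setPS => t [[_ h0] [_ /(_ h0)]].
by move=> B _; exact: normr_ge0.
Qed.

Lemma scalar_variation_integral nu h (f : T -> R) : is_density nu h ->
  measurable_fun I01 f ->
  \int[set_variation (fun B => `|nu B|%R)]_(t in I01) `|f t|%:E =
  \int[lam]_(t in I01) (`|f t| * `|h t|)%:E.
Proof.
move=> dh mf; have [mh _ _] := dh.
have ma : measurable_fun (@I01 R) (fun t => `|f t|%:E).
  by apply/measurable_EFinP; exact: (nneg_meas (nneg_abs mf)).
apply: (integral_density _ _ _ (@measurable_I01 R) ma).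
- exact: (measurableT_comp (@normr_measurable R setT)).
- by move=> t; exact: normr_ge0.
- by move=> A mA; exact: set_variation_density.
Qed.

Lemma signed_integral_density nu h (f : T -> R) A : is_density nu h -> measurable A ->
  measurable_fun A f -> lam.-integrable A (fun t => (f t * h t)%:E) ->
  signed_integral nu A f = \int[lam]_(t in A) (f t * h t)%:E.
Proof.
move=> dh mA mf jf; have [mh _ _] := dh.
have [mN _ _] := density_opp dh.
have mfE : measurable_fun A (EFin \o f) by apply/measurable_EFinP; exact: mf.
have I (g : T -> R) : measurable_fun setT g -> (forall t, (`|g t| <= `|h t|)%R) ->
    lam.-integrable A (fun t => (f t * g t)%:E).
  move=> mg gh; apply: (le_integrable mA _ _ jf).
    apply/measurable_EFinP; apply: measurable_funM; first exact: mf.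
    exact: (measurable_funS measurableT (@subsetT _ A) mg).
  by move=> t _ /=; rewrite lee_fin !normrM ler_wpM2l.
have pn g t : (`|pos_part g t| <= `|g t|)%R.
  rewrite ger0_norm; last exact: pos_part_ge0.
  by rewrite /pos_part; case: (leP (g t) 0%R) => // _; exact: ler_norm.
have ip := I _ (measurable_pos_part mh) (pn h).
have im : lam.-integrable A (fun t => (f t * pos_part (fun t => - h t)%R t)%:E).
  apply: I; first exact: (measurable_pos_part mN).
  by move=> t; rewrite (le_trans (pn _ t)) // normrN.
rewrite /signed_integral.
have uE B : measurable B -> _ := @upper_variation_density nu h B dh.
have lE B : measurable B -> _ := @lower_variation_density nu h B dh.
rewrite (integral_density (measurable_pos_part mh) (pos_part_ge0 h) uE mA mfE).
rewrite (integral_density (measurable_pos_part mN) (pos_part_ge0 _) lE mA mfE).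
rewrite -[LHS](integralB mA ip im); apply: eq_integral => t _.
by rewrite -EFinB -mulrBr pos_partB.
Qed.

End variation.

(** * Densities of the scalar measures of [m_X] *)

Section dual.
Variables (R : realType) (X : funspace R) (hX : is_ri X).
Local Notation T := (lebT R).
Local Notation N := (fs_norm X).
Local Notation hB := (ri_Bfs hX).
Local Notation mX := (cesaro_vm R).
Implicit Types (f g u v : T -> R) (t : T) (A B : set T) (x : (T -> R) -> R).

Definition dual_bound x (K : R) := forall f, X f -> `|x f| <= K * N f.

Lemma dual_boundP x : dual_space X x -> exists2 K : R, 0 <= K & dual_bound x K.
Proof.
move=> [_ [K hK]]; exists `|K| => // f Xf; apply: le_trans (hK f Xf) _.
by apply: ler_wpM2r; [exact: (bfs_norm_ge0 hB)|exact: ler_norm].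
Qed.

Lemma dualD x f g : dual_space X x -> X f -> X g ->
  x (fun t => f t + g t) = x f + x g.
Proof.
move=> [xl _] Xf Xg; have := xl 1 f g Xf Xg; rewrite mul1r => <-.
by congr x; apply/funext => t; rewrite mul1r.
Qed.

Lemma dual0 x : dual_space X x -> x (fun=> 0) = 0.
Proof.
move=> dx; have := dualD dx (bfs_zero hB) (bfs_zero hB).
under eq_fun do rewrite addr0.
by move=> h; apply: (addrI (x (fun=> 0))); rewrite -h addr0.
Qed.

Lemma dualZ x (a : R) f : dual_space X x -> X f -> x (fun t => a * f t) = a * x f.
Proof.
move=> dx Xf; have := dx.1 a f _ Xf (bfs_zero hB); rewrite (dual0 dx) addr0 => <-.
by congr x; apply/funext => t; rewrite addr0.
Qed.

Lemma dualB x f g : dual_space X x -> X f -> X g ->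
  x (fun t => f t - g t) = x f - x g.
Proof.
move=> dx Xf Xg; rewrite (dualD dx Xf (bfs_opp hB Xg)); congr (_ + _).
rewrite -mulN1r -(dualZ _ dx Xg); congr x.
by apply/funext => t; rewrite mulN1r.
Qed.

(** Functionals act on representatives; boundedness makes them respect classes, because the
    difference has norm 0. *)
Lemma dual_ae x f g : dual_space X x -> X f -> X g -> ae_eq01 f g -> x f = x g.
Proof.
move=> dx Xf Xg fg; apply/eqP; rewrite -subr_eq0 -(dualB dx Xf Xg) -normr_eq0.
have [K K0 hK] := dual_boundP dx.
have Xd := bfs_sub hB Xf Xg.
have N0 : N (fun t => f t - g t) = 0.
  rewrite -(bfs_norm0 hB); apply: (bfs_ae hB (bfs_zero hB) _ _).2.
    exact: (bfs_measurable hB Xd).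
  by apply: filterS fg => t h It; rewrite h // subrr.
by rewrite -normr_le0 normr_id; have := hK _ Xd; rewrite N0 mulr0.
Qed.

Lemma dual_eq x f g : dual_space X x -> X f -> X g ->
  (forall t, 0 < (t : R) < 1 -> f t = g t) -> x f = x g.
Proof. by move=> dx Xf Xg fg; apply: dual_ae => //; exact: ae01W. Qed.

Lemma dual_cesD x f g : dual_space X x -> cx X f -> cx X g ->
  x (ces (fun t => f t + g t)) = x (ces f) + x (ces g).
Proof.
move=> dx cf cg; rewrite -(dualD dx cf.2 cg.2).
apply: dual_eq => //; [exact: (cxD hX cf cg).1.2|exact: (bfs_add hB cf.2 cg.2)|].
by move=> t /andP[t0 t1]; rewrite (cesD _ cf.1 cg.1) // ltW.
Qed.

Lemma dual_cesZ x (a : R) f : dual_space X x -> 0 <= a -> cx X f ->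
  x (ces (fun t => a * f t)) = a * x (ces f).
Proof.
move=> dx a0 cf; rewrite -(dualZ a dx cf.2).
apply: dual_eq => //; [exact: (cxZ hX a0 cf).1.2|exact: (bfs_scale hB a cf.2)|].
by move=> t /andP[t0 t1]; rewrite (cesZ _ a0 cf.1) // ltW.
Qed.

Lemma dual_ces_eq x f g : dual_space X x -> cx X f -> cx X g ->
  (forall t, I01 t -> f t = g t) -> x (ces f) = x (ces g).
Proof.
move=> dx cf cg fg; apply: dual_eq => //; [exact: cf.2|exact: cg.2|].
by move=> t /andP[t0 t1]; apply: eq_ces => //; exact: ltW.
Qed.

Lemma indic01 A t : 0 <= (\1_A t : R) <= 1.
Proof. by rewrite indicE; case: (_ \in _); rewrite ?lexx ?ler01. Qed.

Lemma cx_indic A : measurable A -> cx X \1_A.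
Proof.
move=> mA; apply: (cx_bounded hX (nneg_indic mA) (M := 1)) => t _.
by case/andP: (indic01 A t).
Qed.

(** The average is at most 1 on [0,eta] and at most the mass divided by [eta] beyond. Together with
    [ri_small], a function below 1 of small mass has an average of small norm. *)
Lemma norm_ces_le_mass g (eta : R) : nneg g -> (forall t, I01 t -> g t <= 1) ->
  0 < eta ->
  N (ces g) <= N \1_(seg0 (eta : T)) + fine (cint g (1 : T)) / eta * N (fun=> 1).
Proof.
move=> ng g1 e0; set c := fine _.
have c0 : 0 <= c by rewrite fine_ge0 // cint_ge0.
have cE : cint g (1 : T) = c%:E by rewrite fineK // (cint1_fin ng g1).
have X1 : X \1_(seg0 (eta : T)).
  apply: (ri_bounded01 hX (M := 1) (nneg_meas (nneg_indic (measurable_seg0 _))) _).1.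
  by move=> t _; have /andP[h1 h2] := indic01 (seg0 (eta : T)) t; rewrite ger0_norm.
have Xc := bfs_scale hB (c / eta) (ri_one hX).
have ce0 : 0 <= c / eta by rewrite divr_ge0 // ltW.
rewrite -(ger0_norm ce0) -(bfs_normZ hB _ (ri_one hX)).
apply: le_trans (bfs_normD hB X1 Xc).
apply: (bfs_le hB (bfs_add hB X1 Xc) (ces_measurable ng) _).2 => t t01.
have /andP[t0 t1] := t01; have It : I01 t by rewrite /I01/= !ltW.
have /andP[i0 i1] := indic01 (seg0 (eta : T)) t.
rewrite mulr1 !ger0_norm ?addr_ge0 ?ces_ge0 //.
have [te|et] := leP (t : R) eta.
  rewrite indicE mem_set; last by rewrite /seg0/= te ltW.
  by apply: le_trans (ces_bound It ng ler01 g1) _; rewrite lerDl.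
apply: le_trans (_ : _ <= c / eta) _; last by rewrite lerDr.
apply: ces_le_of_cint => //; first exact: bounded_locint g1.
apply: le_trans (cint_homo (ltW t1 : (t : R) <= (1 : T)) (lexx _) ng) _.
rewrite cE lee_fin mulrA ler_pdivlMr // mulrC ler_wpM2r //; exact: ltW.
Qed.

Hypothesis hXinf : fs_car X <> Linfty01 R.

(** The remainder [b n] of the union is bounded by 1 and its mass tends to 0, so [norm_ces_le_mass]
    makes its average small in norm. *)
Lemma dual_sigma_additive x : dual_space X x ->
  semi_sigma_additive (fun A : set T => (x (mX A))%:E).
Proof.
move=> dx F mF tF mUF; set U := \bigcup_n F n in mUF *.
have [K K0 hK] := dual_boundP dx.
pose S n t : R := \sum_(i < n) \1_(F i) t.
pose b n t : R := \1_U t - S n t.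
have SU n t : S n t <= \1_U t.
  rewrite -lee_fin indic_bigcup //.
  by apply: (@nneseries_partial R (fun k => \1_(F k))) => k; rewrite indicE.
have nS n : nneg (S n) by apply: nneg_sum => i; exact: nneg_indic.
have nU : nneg (\1_U : T -> R) by exact: nneg_indic.
have nb n : nneg (b n) by apply: nnegB => // t _; exact: SU.
have b1 n t : I01 t -> b n t <= 1.
  move=> It; apply: (@le_trans _ _ (\1_U t)); last by case/andP: (indic01 U t).
  by rewrite gerBl (nneg_ge0 (nS n)).
have cb n : cx X (b n) := cx_bounded hX (nb n) (b1 n).
have cF i : cx X \1_(F i) by exact: cx_indic.
have cS n : cx X (S n) := (cx_sum hX (index_enum 'I_n) (fun i : 'I_n => cF i)).1.
have xS n : x (ces (S n)) = \sum_(i < n) x (ces \1_(F i)).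
  elim: n => [|n IH].
    rewrite big_ord0 -(dual0 dx); congr x; apply/funext => t.
    by rewrite /S; under eq_fun do rewrite big_ord0; rewrite ces0.
  rewrite big_ord_recr /= -IH -(dual_cesD dx (cS n) (cF n)).
  apply: (dual_ces_eq dx (cS _)); first exact: (cxD hX (cS n) (cF n)).1.
  by move=> t _; rewrite /S big_ord_recr.
have xb n : x (ces \1_U) = x (ces (S n)) + x (ces (b n)).
  rewrite -(dual_cesD dx (cS n) (cb n)); apply: (dual_ces_eq dx (cx_indic mUF)).
    exact: (cxD hX (cS n) (cb n)).1.
  by move=> t _; rewrite /b addrC subrK.
have U1 t : I01 t -> (\1_U t : R) <= 1 by move=> _; case/andP: (indic01 U t).
pose a n := fine (cint (b n) (1 : T)).
have aE n : cint (b n) (1 : T) = (a n)%:E by rewrite fineK // (cint1_fin (nb n) (b1 n)).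
have a_cvg : a @ \oo --> (0 : R).
  pose s n := fine (cint (S n) (1 : T)).
  have S1 n t : I01 t -> S n t <= 1 by move=> It; exact: le_trans (SU n t) (U1 t It).
  have sE n : cint (S n) (1 : T) = (s n)%:E by rewrite fineK // (cint1_fin (nS n) (S1 n)).
  pose c := fine (cint \1_U (1 : T)).
  have cE : cint \1_U (1 : T) = c%:E by rewrite fineK // (cint1_fin nU U1).
  have -> : a = fun n => c - s n.
    apply/funext => n; apply/eqP; rewrite eq_sym subr_eq addrC; apply/eqP.
    apply: EFin_inj; rewrite EFinD -sE -aE -cE -(cintD _ (nS n) (nb n)) //.
    by apply: eq_integral => t _; rewrite /b addrC subrK.
  suff sc : s @ \oo --> c.
    by rewrite -(subrr c); apply: cvgB => //; exact: cvg_cst.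
  suff sc : EFin \o s @ \oo --> c%:E by exact: (fine_cvg sc).
  rewrite -cE.
  have -> : cint \1_U (1 : T) = (\sum_(i <oo) cint \1_(F i) (1%R : T))%E.
    rewrite /cint; have s1 : seg0 (1%R : T) `<=` I01 by exact: seg0_sub.
    under eq_integral do rewrite indic_bigcup //.
    apply: (integral_nneseries _ (measurable_seg0 _)).
      by move=> n; apply: nneg_EFin => //; exact: nneg_indic.
    by move=> n t _; rewrite lee_fin indicE.
  rewrite (_ : EFin \o s = fun n => (\sum_(0 <= i < n) cint \1_(F i) (1%R : T))%E).
    apply: is_cvg_nneseries => n _ _; apply: cint_ge0 => //; exact: nneg_indic.
  apply/funext => n /=; rewrite -sE big_mkord.
  elim: n => [|n IH].
    rewrite big_ord0 /S; under eq_fun do rewrite big_ord0.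
    by rewrite (cint_cst _ (I01_1 R)) mul0r.
  rewrite big_ord_recr /= -IH -(cintD (lexx 1) (nS n) (nneg_indic (mF n))).
  by apply: eq_integral => t _; rewrite /S big_ord_recr.
have xb0 : (fun n => x (ces (b n))) @ \oo --> (0 : R).
  apply/cvgr0Pnorm_lt => e e0.
  have K1 : 0 < K + 1 by rewrite ltr_wpDl.
  (* One half pays for the indicator of [0,eta]; once [eta] is fixed, the other half pays for the
     mass divided by [eta]. *)
  pose e' := e / (K + 1) / 2.
  have e'0 : 0 < e' by rewrite !divr_gt0.
  have [eta /andP[eta0 _] heta] := ri_small hX hXinf e'0.
  pose n1 := N (fun=> 1); have n10 : 0 <= n1 := bfs_norm_ge0 hB (ri_one hX).
  have n11 : 0 < n1 + 1 by rewrite ltr_wpDl.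
  have r0 : 0 < e' * eta / (n1 + 1) by apply: divr_gt0 => //; exact: mulr_gt0.
  have /cvgr0Pnorm_lt/(_ _ r0)[n0 _ hn] := a_cvg.
  exists n0 => // n n0n; apply: le_lt_trans (hK _ (cb n).2) _.
  have Nb : N (ces (b n)) < e / (K + 1).
    apply: le_lt_trans (norm_ces_le_mass (nb n) (b1 n) eta0) _.
    rewrite [e / _]splitr; apply: ltrD; first exact: heta.
    have an : a n < e' * eta / (n1 + 1).
      by apply: le_lt_trans (ler_norm _) (hn n n0n).
    apply: (@le_lt_trans _ _ (a n / eta * (n1 + 1))).
      apply: ler_wpM2l; last by rewrite lerDl.
      by rewrite divr_ge0 ?(ltW eta0) // fine_ge0 // cint_ge0.
    by rewrite mulrAC ltr_pdivrMr // -ltr_pdivlMr.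
  apply: (@le_lt_trans _ _ ((K + 1) * N (ces (b n)))).
    by apply: ler_wpM2r; [exact: (bfs_norm_ge0 hB (cb n).2)|rewrite lerDl].
  by rewrite mulrC -ltr_pdivlMr.
have -> : (fun n => (\sum_(0 <= i < n) (x (mX (F i)))%:E)%E) =
    EFin \o (fun n => x (ces \1_U) - x (ces (b n))).
  apply/funext => n /=; rewrite big_mkord sumEFin (xb n) addrK xS.
  by [].
have h : (fun n => x (ces \1_U) - x (ces (b n))) @ \oo --> x (ces \1_U) - 0.
  by apply: cvgB => //; exact: cvg_cst.
rewrite subr0 in h; apply: cvg_EFin; first exact: nearW.
exact: h.
Qed.

Lemma dual_null x A : dual_space X x -> measurable A -> lam (A `&` I01) = 0%E ->
  x (mX A) = 0.
Proof.
move=> dx mA A0; rewrite -(dual0 dx).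
have mI := @measurable_I01 R.
have h : ae_eq01 (\1_A : T -> R) (fun=> 0).
  exists (A `&` I01); split => //; first exact: measurableI.
  move=> t /= /not_implyP[It]; rewrite indicE.
  by case: (boolP (t \in A)) => [/set_mem At _|_].
have n0 : nneg (fun=> 0 : R) := nneg_cst (lexx 0).
apply: (dual_eq dx (cx_indic mA).2 (bfs_zero hB)) => t /andP[t0 t1].
rewrite -[LHS]/(ces \1_A t) (ae_eq_ces (ltW t1) (nneg_indic mA) n0 h).
exact: ces0.
Qed.

Lemma dual_density x : dual_space X x ->
  exists h, is_density (scalar_measure mX x) h.
Proof.
move=> dx; pose nu0 := fun A : set T => (x (mX A))%:E.
have nu00 : nu0 set0 = 0%E by rewrite /nu0 (dual_null dx) // set0I measure0.
have nufin A : measurable A -> nu0 A \is a fin_num by [].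
pose mix := isCharge.Build _ _ _ nu0 nu00 nufin (dual_sigma_additive dx).
pose nu : {charge set T -> \bar R} := HB.pack nu0 mix.
have mI := @measurable_I01 R.
have nul : nu `<< (lam : {sigma_finite_measure set T -> \bar R}).
  move=> A nA B mB BA; congr EFin; apply: (dual_null dx mB).
  by apply: nA; [exact: measurableI|move=> t [/BA]].
pose h0 := Radon_Nikodym nu (lam : {sigma_finite_measure set T -> \bar R}).
have h0fin t : h0 t \is a fin_num by exact: Radon_Nikodym_fin_num.
have ih0 : lam.-integrable setT h0 by exact: Radon_Nikodym_integrable.
have h0E A : measurable A -> nu0 A = (\int[lam]_(t in A) h0 t)%E.
  by move=> mA; exact: (Radon_Nikodym_integral nul mA).
pose h t : R := if t \in I01 then fine (h0 t) else 0.
have hE : EFin \o h = h0 \_ I01.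
  by apply/funext => t; rewrite /h /= patchE; case: ifP => // _; rewrite fineK.
have ih : lam.-integrable setT (EFin \o h).
  rewrite hE; apply/(integrable_mkcond h0 mI).
  exact: (integrableS measurableT mI _ ih0).
exists h; split.
- by apply/measurable_EFinP; case/integrableP: ih.
- exact: ih.
move=> A mA; rewrite -[LHS]/(nu0 A).
have -> : nu0 A = nu0 (A `&` I01).
  have mAI : measurable (A `&` I01) by exact: measurableI.
  congr EFin; apply: (dual_ces_eq dx (cx_indic mA) (cx_indic mAI)) => t It.
  by rewrite !indicE in_setI (mem_set It) andbT.
rewrite h0E; last exact: measurableI.
by rewrite integral_mkcondr -hE.
Qed.

End dual.

(** * Integral representation of functionals on averages *)

Section representation.
Variables (R : realType) (X : funspace R) (hX : is_ri X).
Local Notation T := (lebT R).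
Local Notation N := (fs_norm X).
Local Notation hB := (ri_Bfs hX).
Local Notation mX := (cesaro_vm R).
Variables (x : (T -> R) -> R) (K : R) (h : T -> R).
Hypotheses (dx : dual_space X x) (K0 : 0 <= K) (xK : dual_bound X x K).
Hypothesis dh : is_density (scalar_measure mX x) h.
Implicit Types (f g : T -> R) (t : T) (A : set T).

Let mI := @measurable_I01 R.

Let mh : measurable_fun setT h.
Proof. by case: dh. Qed.

Let hE A : measurable A -> (x (mX A))%:E = (\int[lam]_(t in A) (h t)%:E)%E.
Proof. by case: dh => _ _; exact. Qed.

Definition I01int g : R := fine (\int[lam]_(t in I01) (g t)%:E).

Definition I01_integrable g := lam.-integrable I01 (EFin \o g).

Lemma I01intE g : I01_integrable g ->
  (I01int g)%:E = (\int[lam]_(t in I01) (g t)%:E)%E.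
Proof. by move=> ig; rewrite fineK //; exact: (integrable_fin_num mI ig). Qed.

Lemma I01intD f g : I01_integrable f -> I01_integrable g ->
  I01int (fun t => f t + g t) = I01int f + I01int g.
Proof.
move=> jf jg; rewrite /I01int -fineD; try exact: (integrable_fin_num mI).
congr fine; rewrite -(integralD mI jf jg).
by apply: eq_integral => t _; rewrite EFinD.
Qed.

Lemma I01intZ (a : R) f : I01_integrable f ->
  I01int (fun t => a * f t) = a * I01int f.
Proof.
move=> jf; rewrite /I01int -[RHS]/(fine a%:E * _) -fineM //; last first.
  exact: (integrable_fin_num mI).
congr fine; rewrite -(integralZl mI jf).
by apply: eq_integral => t _; rewrite EFinM.
Qed.

Lemma I01_integrable_le f g : measurable_fun (@I01 R) f ->
  (forall t, I01 t -> `|f t| <= `|g t|) -> I01_integrable g -> I01_integrable f.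
Proof.
move=> mf fg jg; apply: (le_integrable mI _ _ jg).
  exact/measurable_EFinP.
by move=> t It /=; rewrite lee_fin fg.
Qed.

Lemma eq_I01int f g : (forall t, I01 t -> f t = g t) -> I01int f = I01int g.
Proof.
by move=> fg; congr fine; apply: eq_integral => t; rewrite inE => /fg ->.
Qed.

Lemma I01int_norm f : I01_integrable f -> `|I01int f| <= I01int (fun t => `|f t|).
Proof.
move=> jf; have ja : I01_integrable (fun t => `|f t|) by exact: integrable_norm.
rewrite -lee_fin (I01intE ja) -abse_EFin (I01intE jf).
have mf : measurable_fun (@I01 R) (EFin \o f) by case/integrableP: jf.
exact: (le_abse_integral _ mI mf).
Qed.

Lemma I01int_le f g : I01_integrable f -> I01_integrable g ->
  (forall t, I01 t -> f t <= g t) -> I01int f <= I01int g.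
Proof.
move=> jf jg fg; rewrite -lee_fin (I01intE jf) (I01intE jg).
apply: (le_integral mI jf jg) => t; rewrite inE => It /=.
by rewrite lee_fin fg.
Qed.

Let mhI : measurable_fun (@I01 R) h.
Proof. exact: (measurable_funS measurableT _ mh). Qed.

Let jh : I01_integrable h.
Proof. exact: density_integrable dh mI. Qed.

Lemma bounded_mul_integrable f (M : R) : nneg f -> (forall t, I01 t -> f t <= M) ->
  I01_integrable (fun t => f t * h t).
Proof.
move=> nf fM; have jM : I01_integrable (fun t => M * h t).
  rewrite /I01_integrable (_ : _ \o _ = fun t => (M%:E * (h t)%:E)%E); last first.
    by apply/funext => t; rewrite /= EFinM.
  exact: (integrableZl mI M jh).
apply: I01_integrable_le jM; first exact: (measurable_funM (nneg_meas nf) mhI).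
move=> t It; rewrite !normrM ler_wpM2r // (ger0_norm (nneg_ge0 nf It)).
exact: le_trans (fM t It) (ler_norm _).
Qed.

(** The defect of the representation: it vanishes on indicators and is uniformly bounded on
    functions with values in [0,1]. *)
Let L f := x (ces f) - I01int (fun t => f t * h t).

Let unit_fun f := nneg f /\ forall t, I01 t -> f t <= 1.

Let unit_cx f : unit_fun f -> cx X f.
Proof. by move=> [nf f1]; exact: (cx_bounded hX nf f1). Qed.

Let unit_int f : unit_fun f -> I01_integrable (fun t => f t * h t).
Proof. by move=> [nf f1]; exact: bounded_mul_integrable f1. Qed.

Let L_bound f : unit_fun f ->
  `|L f| <= K * N (fun=> 1) + I01int (fun t => `|h t|).
Proof.
move=> uf; have [nf f1] := uf; apply: le_trans (ler_normB _ _) _; apply: lerD.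
  apply: le_trans (xK (unit_cx uf).2) _; apply: ler_wpM2l => //.
  apply: (bfs_le hB (ri_one hX) (ces_measurable nf) _).2 => t /andP[t0 t1].
  have It : I01 t by rewrite /I01/= !ltW.
  by rewrite normr1 ger0_norm ?ces_ge0 // ces_bound.
apply: le_trans (I01int_norm (unit_int uf)) _; apply: I01int_le.
- exact: (integrable_norm (unit_int uf)).
- exact: (integrable_norm jh).
- move=> t It; rewrite normrM ler_piMl // (ger0_norm (nneg_ge0 nf It)).
  exact: f1.
Qed.

Let L_indic A : measurable A -> A `<=` I01 -> L \1_A = 0.
Proof.
move=> mA AI; apply/eqP; rewrite subr_eq0; apply/eqP.
apply: EFin_inj; rewrite -[X in X%:E]/(x (mX A)) (hE mA) I01intE; last first.
  by apply: unit_int; split; [exact: nneg_indic|move=> t _; case/andP: (indic01 A t)].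
rewrite integral_mkcond [RHS]integral_mkcond; apply: eq_integral => t _.
rewrite !patchE indicE; case: (boolP (t \in A)) => [/set_mem/AI It|_].
  by rewrite (mem_set It) mul1r.
by rewrite mul0r; case: ifP.
Qed.

(* [f = (1_{f >= 1/2} + g) / 2] with [0 <= g <= 1]: iterating this, as in a binary
   expansion, reduces [L f = 0] to indicator functions. *)
Let L_half f : unit_fun f -> exists2 g, unit_fun g & L f = 2^-1 * L g.
Proof.
move=> uf; have [nf f1] := uf.
pose A := [set t | I01 t /\ 2^-1 <= f t].
have mA : measurable A.
  have := nneg_meas nf mI (measurable_itv `[2^-1, +oo[).
  by congr measurable; apply/seteqP; split => t /=; rewrite in_itv/= andbT.
have AI : A `<=` I01 by move=> t [].
pose g t := 2 * f t - \1_A t.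
have gt t : I01 t -> 0 <= g t <= 1.
  move=> It; rewrite /g indicE; have f0 := nneg_ge0 nf It; have f1t := f1 t It.
  case: (boolP (t \in A)) => [/set_mem[_ h2]|/negP nA].
    by rewrite /=; apply/andP; split; lra.
  have h2 : f t < 2^-1 by rewrite ltNge; apply/negP => h2; apply: nA; rewrite inE.
  by rewrite /=; apply/andP; split; lra.
have ng : nneg g.
  split; last by move=> t /gt/andP[].
  apply: measurable_funB; last exact: (nneg_meas (nneg_indic mA)).
  exact: (nneg_meas (nnegZ (ler0n R 2) nf)).
have ug : unit_fun g by split=> // t /gt/andP[].
have uA : unit_fun \1_A by split; [exact: nneg_indic|move=> t _; case/andP: (indic01 A t)].
exists g => //.
have h0 : 0 <= (2^-1 : R) by rewrite invr_ge0.
have fE t : f t = 2^-1 * \1_A t + 2^-1 * g t by rewrite /g; field.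
have cA := (cxZ hX h0 (unit_cx uA)).1; have cg := (cxZ hX h0 (unit_cx ug)).1.
have xf : x (ces f) = 2^-1 * x (ces \1_A) + 2^-1 * x (ces g).
  rewrite -(dual_cesZ hX dx h0 (unit_cx uA)) -(dual_cesZ hX dx h0 (unit_cx ug)).
  rewrite -(dual_cesD hX dx cA cg); apply: (dual_ces_eq hX dx (unit_cx uf)).
    exact: (cxD hX cA cg).1.
  by move=> t _; exact: fE.
have jA : I01_integrable (fun t => 2^-1 * (\1_A t * h t)).
  by have := integrableZl mI 2^-1 (unit_int uA).
have jg : I01_integrable (fun t => 2^-1 * (g t * h t)).
  by have := integrableZl mI 2^-1 (unit_int ug).
have If : I01int (fun t => f t * h t) =
    2^-1 * I01int (fun t => \1_A t * h t) + 2^-1 * I01int (fun t => g t * h t).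
  rewrite -(I01intZ _ (unit_int uA)) -(I01intZ _ (unit_int ug)).
  rewrite -(I01intD jA jg); apply: eq_I01int => t _.
  by rewrite {1}fE mulrDl !mulrA.
have := L_indic mA AI; rewrite /L xf If => /eqP; rewrite subr_eq0 => /eqP ->.
by rewrite opprD addrACA subrr add0r -mulrBr.
Qed.

Lemma dual_ces_unit f : nneg f -> (forall t, I01 t -> f t <= 1) ->
  x (ces f) = I01int (fun t => f t * h t).
Proof.
move=> nf f1; have uf : unit_fun f by [].
pose C := K * N (fun=> 1) + I01int (fun t => `|h t|).
(* Halving [n] times leaves 2^-n times a defect bounded by [C]. *)
have hn n : exists2 g, unit_fun g & L f = 2^-1 ^+ n * L g.
  elim: n => [|n [g ug IH]]; first by exists f => //; rewrite expr0 mul1r.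
  have [g' ug' gg'] := L_half ug; exists g' => //.
  by rewrite IH gg' exprSr mulrA.
apply/eqP; rewrite -subr_eq0 -normr_le0 -[x (ces f) - _]/(L f).
apply/ler_addgt0Pr => e e0; rewrite add0r.
have p0 n : 0 <= (2^-1 : R) ^+ n by rewrite exprn_ge0 // invr_ge0.
have C0 : 0 <= C by exact: le_trans (normr_ge0 _) (L_bound uf).
have C1 : 0 < C + 1 by rewrite ltr_wpDl.
have : (fun n => (2^-1 : R) ^+ n) @ \oo --> (0 : R).
  by apply: cvg_expr; rewrite ger0_norm ?invr_ge0 // invf_lt1 // ltr1n.
move=> /cvgr0Pnorm_lt/(_ _ (divr_gt0 e0 C1))[n _ /(_ n (leqnn _))] hn'.
have [g ug ->] := hn n; rewrite normrM (ger0_norm (p0 n)).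
apply: (@le_trans _ _ (2^-1 ^+ n * (C + 1))).
  by rewrite ler_wpM2l // (le_trans (L_bound ug)) // lerDl.
by rewrite -ler_pdivlMr // ltW // (le_lt_trans (ler_norm _) hn').
Qed.

Lemma dual_ces_bounded f (M : R) : nneg f -> (forall t, I01 t -> f t <= M) ->
  x (ces f) = I01int (fun t => f t * h t).
Proof.
move=> nf fM; pose m := Num.max M 1.
have m0 : 0 < m by rewrite lt_max ltr01 orbT.
have mi0 : 0 <= m^-1 by rewrite invr_ge0 ltW.
have cf := cx_bounded hX nf fM.
have nmf := nnegZ mi0 nf.
have h1 t : I01 t -> m^-1 * f t <= 1.
  move=> It; rewrite mulrC ler_pdivrMr // mul1r (le_trans (fM t It)) //.
  by rewrite le_max lexx.
have := dual_ces_unit nmf h1; rewrite (dual_cesZ hX dx mi0 cf).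
rewrite (@eq_I01int _ (fun t => m^-1 * (f t * h t))) => [|t _]; last by rewrite mulrA.
rewrite (I01intZ _ (bounded_mul_integrable nf fM)).
by apply: mulfI; rewrite invr_eq0 gt_eqF.
Qed.

(** Averages of nonnegative functions satisfy |C g1 - C g2| <= C g1 + C g2 = C f. *)
Lemma norm_ces_sub f g1 g2 : cx X f -> nneg g1 -> nneg g2 ->
  (forall t, I01 t -> f t = g1 t + g2 t) ->
  [/\ cx X g1, cx X g2 & N (fun t => ces g1 t - ces g2 t) <= N (ces f)].
Proof.
move=> cf n1 n2 fE.
have [c1 _] : cx X g1 /\ N (ces g1) <= N (ces f).
  by apply: (cx_le hX n1 cf) => t It; rewrite fE // lerDl (nneg_ge0 n2).
have [c2 _] : cx X g2 /\ N (ces g2) <= N (ces f).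
  by apply: (cx_le hX n2 cf) => t It; rewrite fE // lerDr (nneg_ge0 n1).
split => //; apply: (bfs_le hB cf.2 _ _).2.
  exact: (measurable_funB (ces_measurable n1) (ces_measurable n2)).
move=> t /andP[t0 t1]; have It : I01 t by rewrite /I01/= !ltW.
have -> : ces f t = ces g1 t + ces g2 t.
  rewrite -(cesD _ c1.1 c2.1) ?ltW //; apply: eq_ces; [exact: ltW|exact: fE].
apply: le_trans (ler_normB _ _) _.
by rewrite !ger0_norm ?addr_ge0 ?ces_ge0.
Qed.

(** The sign of [h] is moved to the function: if [g1] and [g2] are the parts of a truncation of [f]
    where [h >= 0] and [h < 0], its integral against |h| is [x] applied to C g1 - C g2, whose norm
    is at most that of C f. *)
Lemma dual_abs_le f : cx X f ->
  (\int[lam]_(t in I01) (f t * `|h t|)%:E <= (K * N (ces f))%:E)%E.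
Proof.
move=> cf; have nf := cx_nneg cf.
apply: (trunc_sup mI (@subset_refl _ I01) nf (nneg_meas (nneg_abs mhI))
  (fun t _ => normr_ge0 _)) => n; have nt := trunc_nneg n nf.
have tM t : I01 t -> trunc n f t <= n%:R by move=> _; exact: trunc_bound.
have [ct Nt] : cx X (trunc n f) /\ N (ces (trunc n f)) <= N (ces f).
  by apply: (cx_le hX nt cf) => t It; apply: trunc_le; exact: (nneg_ge0 nf).
pose A := [set t | I01 t /\ 0 <= h t].
have mA : measurable A.
  have := mhI mI (measurable_itv `[0, +oo[).
  by congr measurable; apply/seteqP; split => t /=; rewrite in_itv/= andbT.
have mAc : measurable (~` A) by exact: measurableC.
pose g1 t := trunc n f t * \1_A t; pose g2 t := trunc n f t * \1_(~` A) t.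
have n1 : nneg g1 := nnegM nt (nneg_indic mA).
have n2 : nneg g2 := nnegM nt (nneg_indic mAc).
have gE t : trunc n f t = g1 t + g2 t.
  by rewrite /g1 /g2 -mulrDr !indicE in_setC; case: (t \in A); rewrite ?addr0 ?add0r mulr1.
have [c1 c2 Ng] := norm_ces_sub ct n1 n2 (fun t _ => gE t).
have g1M t : I01 t -> g1 t <= n%:R.
  by move=> It; rewrite (le_trans _ (tM t It)) // gE lerDl (nneg_ge0 n2).
have g2M t : I01 t -> g2 t <= n%:R.
  by move=> It; rewrite (le_trans _ (tM t It)) // gE lerDr (nneg_ge0 n1).
have j1 := bounded_mul_integrable n1 g1M; have j2 := bounded_mul_integrable n2 g2M.
have jt : I01_integrable (fun t => trunc n f t * `|h t|).
  have j3 := bounded_mul_integrable nt tM.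
  apply: I01_integrable_le j3.
    exact: (measurable_funM (nneg_meas nt) (nneg_meas (nneg_abs mhI))).
  by move=> t _; rewrite !normrM normr_id.
rewrite -(I01intE jt) lee_fin.
have -> : I01int (fun t => trunc n f t * `|h t|) = x (fun t => ces g1 t - ces g2 t).
  rewrite (dualB hX dx c1.2 c2.2) (dual_ces_bounded n1 g1M) (dual_ces_bounded n2 g2M).
  apply/eqP; rewrite eq_sym subr_eq -(I01intD jt j2); apply/eqP; apply: eq_I01int.
  move=> t It; rewrite /g1 /g2 !indicE in_setC.
  case: (boolP (t \in A)) => [/set_mem[_ h0]|/negP nA] /=.
    by rewrite mulr0 mul0r addr0 mulr1 ger0_norm.
  have h0 : h t < 0 by rewrite ltNge; apply/negP => h0; apply: nA; rewrite inE.
  by rewrite mulr0 mul0r mulr1 (ltr0_norm h0) mulrN addNr.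
apply: le_trans (ler_norm _) _; apply: le_trans (xK (bfs_sub hB c1.2 c2.2)) _.
by rewrite ler_wpM2l // (le_trans Ng).
Qed.

Lemma cx_mul_integrable f : cx X f -> I01_integrable (fun t => f t * h t).
Proof.
move=> cf; have nf := cx_nneg cf; apply/integrableP; split.
  apply/measurable_EFinP; exact: (measurable_funM (nneg_meas nf) mhI).
apply: (@le_lt_trans _ _ (K * N (ces f))%:E); last by rewrite ltry.
apply: le_trans (dual_abs_le cf); rewrite le_eqVlt; apply/orP; left; apply/eqP.
apply: eq_integral => t; rewrite inE => It /=.
by rewrite normrM (ger0_norm (nneg_ge0 nf It)).
Qed.

(** The remainder [d n] of the truncation has [N (ces (d n)) <= Iphi (d n)], which tends to 0
    because [Iphi f] is finite. *)
Lemma dual_ces f : nneg f -> (Iphi X f < +oo)%E ->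
  x (ces f) = I01int (fun t => f t * h t).
Proof.
move=> nf If; have [lf Xf _] := Iphi_norm_le hX nf If.
have cf : cx X f by [].
have If' : Iphi X f \is a fin_num by rewrite ge0_fin_numE // (Iphi_ge0 hX).
pose d n t := f t - trunc n f t.
have tf n t : I01 t -> trunc n f t <= f t.
  by move=> It; apply: trunc_le; exact: (nneg_ge0 nf).
have nt n := trunc_nneg n nf.
have nd n : nneg (d n) by apply: nnegB => // t It; exact: tf.
have tM n t : I01 t -> trunc n f t <= n%:R by move=> _; exact: trunc_bound.
have ct n : cx X (trunc n f) := cx_bounded hX (nt n) (tM n).
have dE n t : f t = trunc n f t + d n t by rewrite /d addrC subrK.
have Id n : Iphi X (d n) = (Iphi X f - Iphi X (trunc n f))%E.
  have It : Iphi X (trunc n f) \is a fin_num.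
    exact: bsupp_Iphi_fin (trunc_bsupp n nf) (inv_n2 R n).
  rewrite (@eq_Iphi R X f (fun t => trunc n f t + d n t)) => [|t _]; last exact: dE.
  by rewrite (IphiD hX (nt n) (nd n)) addeAC subee ?add0e.
have Idn n : (Iphi X (d n) < +oo)%E.
  apply: le_lt_trans If; apply: (Iphi_le hX (nd n) nf) => t It.
  by rewrite gerBl (nneg_ge0 (nt n)).
have cd n : cx X (d n) by have [ld Xd _] := Iphi_norm_le hX (nd n) (Idn n).
(* One [K] bounds the functional on the remainder, the other the integral of the remainder against
   [h]. *)
have key n : `|x (ces f) - I01int (fun t => f t * h t)| <= 2 * K * fine (Iphi X (d n)).
  have -> : x (ces f) = x (ces (trunc n f)) + x (ces (d n)).
    rewrite -(dual_cesD hX dx (ct n) (cd n)); apply: (dual_ces_eq hX dx cf).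
      exact: (cxD hX (ct n) (cd n)).1.
    by move=> t _; exact: dE.
  have -> : I01int (fun t => f t * h t) =
      I01int (fun t => trunc n f t * h t) + I01int (fun t => d n t * h t).
    rewrite -(I01intD (cx_mul_integrable (ct n)) (cx_mul_integrable (cd n))).
    by apply: eq_I01int => t _; rewrite -mulrDl -dE.
  rewrite (dual_ces_bounded (nt n) (tM n)) opprD addrACA subrr add0r.
  have KN : K * N (ces (d n)) <= K * fine (Iphi X (d n)).
    rewrite ler_wpM2l // -lee_fin fineK ?ge0_fin_numE ?(Iphi_ge0 hX) //.
    by have [] := Iphi_norm_le hX (nd n) (Idn n).
  apply: le_trans (ler_normB _ _) _; rewrite -mulrA mulr_natl mulr2n; apply: lerD.
    exact: le_trans (xK (cd n).2) KN.
  apply: le_trans KN; have jd := cx_mul_integrable (cd n).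
  apply: le_trans (I01int_norm jd) _; rewrite -lee_fin I01intE; last first.
    exact: (integrable_norm jd).
  apply: le_trans (dual_abs_le (cd n)); rewrite le_eqVlt; apply/orP; left; apply/eqP.
  apply: eq_integral => t; rewrite inE => It.
  by rewrite normrM (ger0_norm (nneg_ge0 (nd n) It)).
apply/eqP; rewrite -subr_eq0 -normr_le0; apply/ler_addgt0Pr => e e0; rewrite add0r.
have cv : (fun n => Iphi X (trunc n f)) @ \oo --> Iphi X f.
  apply: (trunc_cvg mI) => //; first exact: (nneg_meas (nneg_phi hX)).
  by move=> t _; exact: phi_ge0.
rewrite -(fineK If') in cv.
have K21 : 0 < 2 * K + 1 by rewrite ltr_wpDl // mulr_ge0.
have cvr : (fun n => fine (Iphi X (trunc n f))) @ \oo --> fine (Iphi X f).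
  exact: (fine_cvg cv).
have e'0 : 0 < e / (2 * K + 1) by rewrite divr_gt0.
have /cvgrPdist_lt/(_ _ e'0)[n _ /(_ n (leqnn _)) hn] := cvr.
apply: le_trans (key n) _.
have Idf : fine (Iphi X (d n)) = fine (Iphi X f) - fine (Iphi X (trunc n f)).
  rewrite Id fineB //; exact: bsupp_Iphi_fin (trunc_bsupp n nf) (inv_n2 R n).
have Id0 : 0 <= fine (Iphi X (d n)) by rewrite fine_ge0 // (Iphi_ge0 hX).
apply: (@le_trans _ _ ((2 * K + 1) * fine (Iphi X (d n)))).
  by rewrite ler_wpM2r // lerDl.
rewrite mulrC -ler_pdivlMr // Idf; apply/ltW; exact: le_lt_trans (ler_norm _) hn.
Qed.

End representation.

(** * The density of the variation of the vector measure *)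

Section vm_variation.
Variables (R : realType) (X : funspace R) (hX : is_ri X).
Local Notation T := (lebT R).
Local Notation N := (fs_norm X).
Local Notation hB := (ri_Bfs hX).
Local Notation mX := (cesaro_vm R).
Implicit Types (f g : T -> R) (t : T) (A B : set T).

Let mI := @measurable_I01 R.

Lemma measurable_phi : measurable_fun setT (phi X).
Proof.
have mp := nneg_meas (nneg_phi hX).
have := (measurable_restrictT (phi X) mI).1 mp.
rewrite (_ : phi X \_ I01 = phi X) //; apply/funext => t.
rewrite patchE; case: ifPn => // /negP tI; rewrite /phi.
case: ifP => // /andP[t0 t1]; case: tI; rewrite inE.
by apply/andP; split => //; exact: ltW.
Qed.

Lemma Iphi_indic A : Iphi X \1_A = (\int[lam]_(t in A) (phi X t)%:E)%E.
Proof.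
rewrite /Iphi integral_mkcond [RHS]integral_mkcond; apply: eq_integral => t _.
rewrite !patchE indicE; case: ifPn => [_|/negP tI].
  by case: ifP; rewrite ?mul1r ?mul0r.
rewrite [phi X t](_ : _ = 0); first by case: ifP.
rewrite /phi; case: ifP => // /andP[t0 t1]; case: tI; rewrite inE.
by apply/andP; split => //; exact: ltW.
Qed.

(** [Iphi_norm_le] on each piece bounds the variation from above. From below, the intersections of
    [A] with the cells give sums of norms that approach the integral away from 0. *)
Lemma vm_variation_density A : measurable A ->
  vm_variation X mX A = (\int[lam]_(t in A) (phi X t)%:E)%E.
Proof.
move=> mA; apply/eqP; rewrite eq_le; apply/andP; split.
  apply: set_variation_ub; [exact: measurable_phi|exact: phi_ge0|].
  move=> B mB; rewrite -Iphi_indic.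
  have [I|I] := ltP (Iphi X \1_B) +oo%E; last exact: le_trans (leey _) I.
  by have [] := Iphi_norm_le hX (nneg_indic mB) I.
rewrite -Iphi_indic.
apply: (trunc_sup mI (@subset_refl _ I01) (nneg_indic mA)
  (nneg_meas (nneg_phi hX)) (fun t _ => phi_ge0 hX t)) => n.
pose d : R := n.+2%:R^-1; have /andP[d0 d1] : 0 < d < 1 := inv_n2 R n.
(* An indicator replaces the truncation, so that every [fcell] is again an indicator and its average
   is a value of [mX]. *)
pose C := A `&` [set t : T | d < (t : R)].
have mC : measurable C.
  apply: measurableI => //.
  rewrite (_ : [set t : T | _] = [set` `]d, +oo[ ]); first exact: lam_measurable_itv.
  by apply/seteqP; split => t /=; rewrite in_itv/= andbT.
pose f : T -> R := \1_C; have nf : nneg f := nneg_indic mC.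
have bf : bsupp d 1 f.
  split; [exact: nf|by move=> t _; case/andP: (indic01 C t)|].
  by move=> t _ td; rewrite /f indicE memNset // => -[_ /= dt]; rewrite ltNge td in dt.
have If : Iphi X f \is a fin_num by apply: (bsupp_Iphi_fin hX bf); rewrite d0.
apply: (@le_trans _ _ (Iphi X f)).
  apply: (Iphi_le hX (trunc_nneg n (nneg_indic mA)) nf) => t It.
  have [dt|td] := ltP d (t : R).
    rewrite /f indicE in_setI (mem_set (dt : [set t : T | d < (t : R)] t)) andbT -indicE.
    by apply: trunc_le; rewrite indicE.
  by have [_ _ ->] := trunc_bsupp n (nneg_indic mA).
apply/lee_addgt0Pr => e e0.
pose m := Num.truncn (1 * phi X (d : T) / e).
have me : 1 * phi X (d : T) / m.+1%:R <= e.
  rewrite ler_pdivrMr ?ltr0n // [leRHS]mulrC -ler_pdivrMr //.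
  by rewrite ltW // truncnS_gt.
have d01 : 0 < d < 1 by rewrite d0.
have hn := norm_fcell hX m bf d01.
pose F (i : 'I_m.+1) := A `&` cell (part d m) i.
have FE (i : 'I_m.+1) : N (ces (fcell f d m i)) = N (mX (F i)).
  congr N; congr ces; apply/funext => t; rewrite /fcell /f /F !indicE !in_setI.
  case: (boolP (t \in cell _ _)) => [/set_mem/andP[ti _]|_]; last by rewrite mulr0 andbF.
  rewrite (_ : t \in [set t : T | d < (t : R)]) ?andbT ?mulr1 //.
  by rewrite inE/=; apply: le_lt_trans ti; rewrite -{1}(part0 d m) part_nd.
have S : ((\sum_(i < m.+1) N (mX (F i)))%:E <= vm_variation X mX A)%E.
  apply: (set_variation_superadditive (p := fun B => N (mX B)) _ mA).
  - by move=> B mB; exact: (bfs_norm_ge0 hB (cx_indic hX mB).2).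
  - by move=> i; apply: measurableI => //; exact: measurable_cell.
  - by move=> i j _ _ [t [[_ ti] [_ tj]]]; apply/val_inj; exact: disjoint_cells ti tj.
  - by move=> i t [].
apply: le_trans (leeD2r _ S); rewrite -(fineK If) -EFinD lee_fin.
rewrite -lerBlDl -(eq_bigr _ (fun i _ => FE i)).
apply: le_trans (ler_norm _) _; rewrite distrC; exact: le_trans hn me.
Qed.

End vm_variation.

(** * The spaces [L^1(m_X)] and [L^1(|m_X|)] *)

Section L1_spaces.
Variables (R : realType) (X : funspace R) (hX : is_ri X).
Hypothesis hXinf : fs_car X <> Linfty01 R.
Local Notation T := (lebT R).
Local Notation N := (fs_norm X).
Local Notation hB := (ri_Bfs hX).
Local Notation mX := (cesaro_vm R).
Local Notation CX := (cesaro_space X).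
Implicit Types (f g p : T -> R) (t : T) (A B S : set T) (x : (T -> R) -> R).

Let mI := @measurable_I01 R.

Lemma vm_variation_integral f : measurable_fun (@I01 R) f ->
  (\int[vm_variation X mX]_(t in I01) `|f t|%:E)%E = Iphi X (fun t => `|f t|).
Proof.
move=> mf; have ma : measurable_fun (@I01 R) (fun t => `|f t|%:E).
  by apply/measurable_EFinP; exact: (nneg_meas (nneg_abs mf)).
have vE B : measurable B -> _ := @vm_variation_density R X hX B.
exact: (integral_density (measurable_phi hX) (phi_ge0 hX) vE mI ma).
Qed.

Lemma L1_variationP f : L1_variation X mX f <->
  measurable_fun (@I01 R) f /\ (Iphi X (fun t => `|f t|%R) < +oo)%E.
Proof.
split=> [/integrableP[/measurable_EFinP mf jf]|[mf jf]].
  by split; [exact: mf|rewrite -(vm_variation_integral mf)].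
apply/integrableP; split; first by apply/measurable_EFinP; exact: mf.
by have := jf; rewrite -(vm_variation_integral mf).
Qed.

Lemma L1_variation_norm f : measurable_fun (@I01 R) f ->
  fs_norm (L1_variation X mX) f = fine (Iphi X (fun t => `|f t|)).
Proof. by move=> mf; congr fine; exact: vm_variation_integral. Qed.

Lemma L1_variation_CX f : L1_variation X mX f -> CX f.
Proof.
move=> /L1_variationP[mf jf]; apply/cesaro_spaceP; split; first exact: mf.
by have [lf Xf _] := Iphi_norm_le hX (nneg_abs mf) jf.
Qed.

Lemma vm_integrable_mul f x h : vm_integrable X mX f -> dual_space X x ->
  is_density (scalar_measure mX x) h -> I01_integrable (fun t => f t * h t).
Proof.
move=> [mf jf _] dx dh; have [mh _ _] := dh.
have /integrableP[_ jx] := jf x dx.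
apply/integrableP; split.
  apply/measurable_EFinP; apply: measurable_funM; first exact: mf.
  exact: (measurable_funS measurableT (@subsetT _ I01) mh).
apply: le_lt_trans jx; rewrite (scalar_variation_integral dh mf).
rewrite le_eqVlt; apply/orP; left; apply/eqP; apply: eq_integral => t _.
by rewrite /= normrM.
Qed.

Lemma signed_integral_I01 f x h A : measurable_fun (@I01 R) f ->
  is_density (scalar_measure mX x) h -> I01_integrable (fun t => f t * h t) ->
  measurable A -> A `<=` I01 ->
  signed_integral (scalar_measure mX x) A f =
    (I01int (fun t => f t * \1_A t * h t))%:E.
Proof.
move=> mf dh jf mA AI; have [mh _ _] := dh.
have mfA := measurable_funS mI AI mf.
have jfA := integrableS mI mA AI jf.
rewrite (signed_integral_density dh mA mfA jfA) I01intE; last first.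
  apply: I01_integrable_le jf.
    apply: measurable_funM.
      exact: (measurable_funM mf (nneg_meas (nneg_indic mA))).
    exact: (measurable_funS measurableT (@subsetT _ I01) mh).
  move=> t _; rewrite mulrAC normrM ler_piMr // ger0_norm; last first.
    by case/andP: (indic01 A t).
  by case/andP: (indic01 A t).
rewrite integral_mkcond [RHS]integral_mkcond; apply: eq_integral => t _.
rewrite !patchE indicE; case: (boolP (t \in A)) => [/set_mem/AI It|_].
  by rewrite (mem_set It) mulr1.
by rewrite mulr0 mul0r; case: ifP.
Qed.

Lemma vm_integrable_of_Iphi f : measurable_fun (@I01 R) f ->
  (Iphi X (fun t => `|f t|%R) < +oo)%E -> vm_integrable X mX f.
Proof.
move=> mf jf; have nf := nneg_abs mf.
have [lf Xf _] := Iphi_norm_le hX nf jf.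
have cf : cx X (fun t => `|f t|) by [].
have jx x h : dual_space X x -> is_density (scalar_measure mX x) h ->
    (\int[lam]_(t in I01) (`|f t| * `|h t|)%:E < +oo)%E.
  move=> dx dh; have [K K0 xK] := dual_boundP hX dx.
  apply: (@le_lt_trans _ _ (K * N (ces (fun t => `|f t|)))%:E); last by rewrite ltry.
  exact: (dual_abs_le hX dx K0 xK dh cf).
split; first exact: mf.
  move=> x dx; have [h dh] := dual_density hX hXinf dx; apply/integrableP; split.
    by apply/measurable_EFinP; exact: mf.
  by have := jx x h dx dh; rewrite -(scalar_variation_integral dh mf).
move=> A mA AI; pose fN t := - f t.
have mN : measurable_fun (@I01 R) fN.
  exact: (measurableT_comp (@oppr_measurable R setT)).
pose p g t := pos_part g t * \1_A t.
have np g : measurable_fun (@I01 R) g -> nneg (p g).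
  move=> mg; apply: (nnegM _ (nneg_indic mA)).
  by split; [exact: measurable_pos_part|move=> t _; exact: pos_part_ge0].
have pf g : (forall t, `|g t| = `|f t|) -> forall t, I01 t -> p g t <= `|f t|.
  move=> gf t _; rewrite /p -gf; apply: (@le_trans _ _ (pos_part g t)).
    by rewrite ler_piMr ?pos_part_ge0 //; case/andP: (indic01 A t).
  by rewrite /pos_part; case: (leP (g t) 0) => // _; exact: ler_norm.
have [n1 n2] := (np _ mf, np _ mN).
have I1 : (Iphi X (p f) < +oo)%E.
  by apply: le_lt_trans jf; apply: (Iphi_le hX n1 nf); exact: pf.
have I2 : (Iphi X (p fN) < +oo)%E.
  apply: le_lt_trans jf; apply: (Iphi_le hX n2 nf); apply: pf => t.
  exact: normrN.
have [l1 X1 _] := Iphi_norm_le hX n1 I1; have [l2 X2 _] := Iphi_norm_le hX n2 I2.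
(* The vector integral of [f] over [A]: the average of the positive part of [f] on [A] minus that of
   its negative part. *)
exists (fun t => ces (p f) t - ces (p fN) t); first exact: (bfs_sub hB X1 X2).
move=> x dx; have [h dh] := dual_density hX hXinf dx.
have [K K0 xK] := dual_boundP hX dx.
have j1 := cx_mul_integrable hX dx K0 xK dh (conj l1 X1).
have j2 := cx_mul_integrable hX dx K0 xK dh (conj l2 X2).
have jfh : I01_integrable (fun t => f t * h t).
  have [mh _ _] := dh; apply/integrableP; split.
    apply/measurable_EFinP; apply: measurable_funM; first exact: mf.
    exact: (measurable_funS measurableT (@subsetT _ I01) mh).
  apply: le_lt_trans (jx x h dx dh); rewrite le_eqVlt; apply/orP; left; apply/eqP.
  by apply: eq_integral => t _; rewrite /= normrM.
rewrite (signed_integral_I01 mf dh jfh mA AI) (dualB hX dx X1 X2); congr EFin.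
rewrite (dual_ces hX dx K0 xK dh n1 I1) (dual_ces hX dx K0 xK dh n2 I2).
have -> : I01int (fun t => f t * \1_A t * h t) =
    I01int (fun t => p f t * h t + (-1) * (p fN t * h t)).
  apply: eq_I01int => t _; rewrite /p mulN1r -mulrBl -mulrBl.
  by rewrite -[fN]/(fun t => - f t) pos_partB.
rewrite I01intD; [|exact: j1|exact: (integrableZl mI (-1) j2)].
by rewrite (I01intZ _ j2) mulN1r.
Qed.

Lemma pos_part_X f : X f -> X (pos_part f) /\ N (pos_part f) <= N f.
Proof.
move=> Xf; apply: (bfs_le hB Xf (measurable_pos_part (bfs_measurable hB Xf))) => t _.
rewrite ger0_norm ?pos_part_ge0 // /pos_part.
by case: (leP (f t) 0) => // _; exact: ler_norm.
Qed.

(** Hahn-Banach, where [q <= N] puts the functional in the dual ball. It is used with [q = N], for a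
    norming functional, and with the norm of the positive part, for a positive one. *)
Lemma sublinear_dual (q : (T -> R) -> R) v :
  (forall f g, X f -> X g -> q (fun t => f t + g t) <= q f + q g) ->
  (forall (a : R) f, 0 <= a -> X f -> q (fun t => a * f t) = a * q f) ->
  (forall f, X f -> q f <= N f) -> X v ->
  exists2 l, dual_ball X l & (forall f, X f -> l f <= q f) /\ l v = q v.
Proof.
move=> qD qZ qN Xv.
have [l [ll lq lv]] := @hahn_banach R (T -> R^o : lmodType R) (fs_car X) q
  (bfs_zero hB) (bfs_linear hB) qD qZ v Xv.
have l0 : l (fun=> 0) = 0.
  have := ll 1 (fun=> 0) (fun=> 0) (bfs_zero hB) (bfs_zero hB).
  rewrite mul1r -[X in l X = _]/(fun t : T => 1 * 0 + 0 : R).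
  under [X in l X = _]eq_fun do rewrite mulr0 addr0.
  by move=> h; apply: (addrI (l (fun=> 0))); rewrite -h addr0.
have lN f : X f -> l (fun t => - f t) = - l f.
  move=> Xf; have E : -1 *: (f : T -> R^o) + (fun=> 0) = (fun t => - f t).
    by apply/funext => t; rewrite -[LHS]/(-1 * f t + 0) mulN1r addr0.
  by have := ll (-1) f (fun=> 0) Xf (bfs_zero hB); rewrite E l0 mulN1r addr0.
have lle f : X f -> `|l f| <= N f.
  move=> Xf; rewrite ler_norml lerNl -(lN f Xf) (le_trans (lq _ Xf) (qN _ Xf)) andbT.
  have XN := bfs_opp hB Xf; apply: le_trans (lq _ XN) _.
  by apply: le_trans (qN _ XN) _; rewrite (bfs_normN hB Xf).
exists l => //; split; last exact: lle; split; first exact: ll.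
by exists 1 => f Xf; rewrite mul1r; exact: lle.
Qed.

(** The upper bound is [dual_abs_le] with constant 1. For the lower bound, a functional norming the
    average of |f| has a density [h], and the norm equals int |f| h <= int |f| |h|. *)
Lemma L1_vm_norm f : measurable_fun (@I01 R) f ->
  (Iphi X (fun t => `|f t|%R) < +oo)%E ->
  fs_norm (L1_vm X mX) f = N (ces (fun t => `|f t|)).
Proof.
move=> mf jf; have nf := nneg_abs mf.
have [lf Xf _] := Iphi_norm_le hX nf jf.
have cf : cx X (fun t => `|f t|) by [].
rewrite /L1_vm /=; set s := ereal_sup _.
suff -> : s = (N (ces (fun t => `|f t|)))%:E by [].
apply/eqP; rewrite eq_le; apply/andP; split.
  apply: ge_ereal_sup => _ [x [dx x1] <-].
  have [h dh] := dual_density hX hXinf dx.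
  have bx : dual_bound X x 1 by move=> g Xg; rewrite mul1r; exact: x1.
  rewrite (scalar_variation_integral dh mf).
  by have := dual_abs_le hX dx ler01 bx dh cf; rewrite mul1r.
have [l [dl l1] [_ lv]] := sublinear_dual (bfs_normD hB)
  (fun a g a0 Xg => etrans (bfs_normZ hB a Xg) (congr1 (fun b => b * N g) (ger0_norm a0)))
  (fun g _ => lexx (N g)) Xf.
have [h dh] := dual_density hX hXinf dl.
have [K K0 xK] := dual_boundP hX dl.
have j := cx_mul_integrable hX dl K0 xK dh cf.
rewrite -lv (dual_ces hX dl K0 xK dh nf jf).
apply: (@le_trans _ _ (\int[scalar_variation mX l]_(t in I01) `|f t|%:E)%E); last first.
  by apply: ereal_sup_ubound; exists l.
rewrite (scalar_variation_integral dh mf).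
have ja : I01_integrable (fun t => `|f t| * `|h t|).
  have : I01_integrable (fun t => `| `|f t| * h t|) := integrable_norm j.
  by congr I01_integrable; apply/funext => t; rewrite normrM normr_id.
rewrite -(I01intE ja) lee_fin; apply: (I01int_le j ja) => t _.
by rewrite ler_wpM2l // ler_norm.
Qed.

(* Testing against all functionals dominated by [f |-> N f^+], which are
   positive, shows that [g] dominates the Cesaro averages of the truncations. *)
Lemma cx_of_dual p g : nneg p -> X g ->
  (forall x h, dual_space X x -> is_density (scalar_measure mX x) h ->
     I01_integrable (fun t => p t * h t) /\ x g = I01int (fun t => p t * h t)) ->
  cx X p.
Proof.
move=> np Xg hg.
have key n : {ae lam, forall t, I01 t -> ces (trunc n p) t <= g t}.
  have nu := trunc_nneg n np.
  have uM t : I01 t -> trunc n p t <= n%:R by move=> _; exact: trunc_bound.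
  have [_ Xu] := cx_bounded hX nu uM.
  pose v t := ces (trunc n p) t - g t; have Xv : X v := bfs_sub hB Xu Xg.
  pose q f := N (pos_part f).
  have qD f1 f2 : X f1 -> X f2 -> q (fun t => f1 t + f2 t) <= q f1 + q f2.
    move=> X1 X2; have [P1 P2] := ((pos_part_X X1).1, (pos_part_X X2).1).
    apply: le_trans (bfs_normD hB P1 P2).
    have mD := bfs_measurable hB (bfs_add hB X1 X2).
    apply: (bfs_le hB (bfs_add hB P1 P2) (measurable_pos_part mD) _).2 => t _.
    rewrite !ger0_norm ?addr_ge0 ?pos_part_ge0 //.
    by rewrite ge_max addr_ge0 ?pos_part_ge0 // andbT lerD // le_max lexx.
  have qZ (a : R) f1 : 0 <= a -> X f1 -> q (fun t => a * f1 t) = a * q f1.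
    move=> a0 X1; rewrite -{2}(ger0_norm a0) -(bfs_normZ hB a (pos_part_X X1).1).
    by congr N; apply/funext => t; rewrite /pos_part maxr_pMr // mulr0.
  have qN f1 : X f1 -> q f1 <= N f1 by move=> X1; exact: (pos_part_X X1).2.
  have [l [dl l1] [lq lv]] := sublinear_dual qD qZ qN Xv.
  have [h0 dh0] := dual_density hX hXinf dl.
  (* [l (- mX A)] is at most the norm of the positive part of [- mX A], which is 0 inside (0,1). *)
  have pos A : measurable A -> 0 <= scalar_measure mX l A.
    move=> mA; have XA := (cx_indic hX mA).2.
    have lN : l (fun t => - mX A t) = - l (mX A).
      rewrite -mulN1r -(dualZ hX (-1) dl XA); congr l.
      by apply/funext => t; rewrite mulN1r.
    rewrite -oppr_le0 -lN; apply: le_trans (lq _ (bfs_opp hB XA)) _.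
    have mo := bfs_measurable hB (bfs_opp hB XA).
    have E t : 0 < (t : R) < 1 -> 0 = pos_part (fun t => - mX A t) t.
      move=> /andP[t0 t1]; rewrite /pos_part max_r // oppr_le0.
      by apply: (nneg_ge0 (nneg_ces (nneg_indic mA))); rewrite /I01/= !ltW.
    have [_ N0] := bfs_eq hB (bfs_zero hB) (measurable_pos_part mo) E.
    by rewrite (bfs_norm0 hB) in N0; rewrite /q -[X in X <= _]/(N _) N0.
  have dh := nonneg_density dh0 pos; set h := pos_part h0 in dh.
  have [jp lg] := hg _ _ dl dh.
  have bl : dual_bound X l 1 by move=> f1 X1; rewrite mul1r; exact: l1.
  have ju := bounded_mul_integrable dh nu uM.
  have lu := dual_ces_bounded hX dl ler01 bl dh nu uM.
  (* [l v] is the norm of the positive part of [v], so this inequality gives [v <= 0] almost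
     everywhere. *)
  have v0 : l v <= 0.
    rewrite /v (dualB hX dl Xu Xg) lu lg subr_le0; apply: (I01int_le ju jp) => t It.
    by apply: ler_wpM2r; [exact: pos_part_ge0|apply: trunc_le; exact: (nneg_ge0 np)].
  have Nv : N (pos_part v) = 0.
    apply/eqP; rewrite eq_le (bfs_norm_ge0 hB (pos_part_X Xv).1) andbT.
    by rewrite -[N _]/(q v) -lv.
  apply: filterS (bfs_norm0_eq0 hB (pos_part_X Xv).1 Nv) => t ht It.
  by rewrite -subr_le0 -[X in X <= _]/(v t) -(ht It) le_max lexx.
have [lp le] := ces_sup np key; split; first exact: lp.
have nc := nneg_ces np.
apply: (bfs_ideal hB Xg (nneg_meas nc) _).1.
apply: filterS le => t ht It; rewrite ger0_norm ?(nneg_ge0 nc) //.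
exact: le_trans (ht It) (ler_norm _).
Qed.

(** On the set [A] where [s * f >= 0] the function [s * f] equals its positive part, so [s] times
    the vector integral of [f] over [A] is the witness that [cx_of_dual] asks for. The values 1 and
    -1 of [s] give the two parts of [f]. *)
Lemma vm_integrable_cx f (s : R) : vm_integrable X mX f ->
  cx X (pos_part (fun t => s * f t)).
Proof.
move=> vf; have [mf jf hf] := vf.
have ms : measurable_fun (@I01 R) (fun t => s * f t).
  by apply: measurable_funM; [exact: measurable_cst|exact: mf].
pose A := I01 `&` (fun t => s * f t) @^-1` `[0, +oo[.
have mA : measurable A := ms mI _ (measurable_itv `[0, +oo[).
have [g Xg gE] := hf A mA (@subIsetl _ _ _).
have np : nneg (pos_part (fun t => s * f t)).
  have mp := measurable_pos_part ms; split; first exact: mp.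
  by move=> t _; exact: pos_part_ge0.
apply: (cx_of_dual np (bfs_scale hB s Xg)) => x h dx dh.
have [mh _ _] := dh; have jfh := vm_integrable_mul vf dx dh.
have pE t : I01 t -> s * (f t * \1_A t * h t) = pos_part (fun t => s * f t) t * h t.
  move=> It; rewrite !mulrA; congr (_ * h t); rewrite /pos_part indicE.
  case: (boolP (t \in A)) => [/set_mem[_]|/negP tA] /=.
    by rewrite in_itv /= andbT mulr1 => h0; rewrite max_l.
  rewrite mulr0 max_r // leNgt; apply/negP => h0; apply: tA; rewrite inE; split => //=.
  by rewrite in_itv /= andbT ltW.
have jA : I01_integrable (fun t => f t * \1_A t * h t).
  apply: I01_integrable_le jfh.
    apply: measurable_funM; first exact: (measurable_funM mf (nneg_meas (nneg_indic mA))).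
    exact: (measurable_funS measurableT (@subsetT _ I01) mh).
  move=> t _; rewrite mulrAC normrM ler_piMr // ger0_norm; last first.
    by case/andP: (indic01 A t).
  by case/andP: (indic01 A t).
split.
  have : I01_integrable (fun t => s * (f t * \1_A t * h t)) := integrableZl mI s jA.
  apply: eq_integrable => //= t; rewrite inE => It; congr EFin; exact: pE.
rewrite (dualZ hX s dx Xg) -(eq_I01int pE) (I01intZ s jA); congr (_ * _).
apply: EFin_inj; rewrite (gE x dx).
exact: (signed_integral_I01 mf dh jfh mA (@subIsetl _ _ _)).
Qed.

Lemma vm_integrable_CX f : vm_integrable X mX f -> CX f.
Proof.
move=> vf; have [mf _ _] := vf; apply/cesaro_spaceP; split; first exact: mf.
have [cD _] := cxD hX (vm_integrable_cx 1 vf) (vm_integrable_cx (-1) vf).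
apply: (cx_eq hX cD _).1 => t _; rewrite /pos_part mul1r mulN1r.
case: (leP (f t) 0) => f0; first by rewrite add0r max_l ?oppr_ge0 // ler0_norm.
by rewrite max_r ?oppr_le0 ?(ltW f0) // addr0 gtr0_norm.
Qed.

(** A form shared by the two notions of null set below: both [vm_null] and zero variation amount to
    an indicator that vanishes almost everywhere on [0,1]. *)
Lemma ae_eq01P f g : ae_eq01 f g <-> exists S, [/\ measurable S,
  ae_eq01 (\1_S : T -> R) (fun=> 0) & forall t, I01 t -> ~ S t -> f t = g t].
Proof.
split=> [[S [mS S0 fgS]]|[S [mS S0 fgS]]].
  exists S; split; first exact: mS.
    exists S; split; [exact: mS|exact: S0|] => t /= /not_implyP[It].
    by rewrite indicE; case: (boolP (t \in S)) => [/set_mem|_].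
  by move=> t It nS; apply: contrapT => fg; apply: nS; apply: fgS => /(_ It).
apply: filterS S0 => t St It; apply: fgS => // hS; have := St It.
by rewrite indicE (mem_set hS) => /eqP; rewrite oner_eq0.
Qed.

Lemma vm_variation0 S : measurable S ->
  vm_variation X mX S = 0%E <-> ae_eq01 (\1_S : T -> R) (fun=> 0).
Proof.
move=> mS; rewrite (vm_variation_density hX mS) -(Iphi_indic X).
have nS : nneg (\1_S : T -> R) := nneg_indic mS.
split; first exact: (Iphi_eq0 hX nS).
move=> S0; rewrite (ae_eq_Iphi hX nS (nneg_cst (lexx 0)) S0) /Iphi.
by apply: integral0_eq => t _; rewrite mul0r.
Qed.

Lemma vm_nullP S : vm_null X mX S <->
  measurable S /\ ae_eq01 (\1_S : T -> R) (fun=> 0).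
Proof.
split=> [[mS S0]|[mS S0]]; split; try exact: mS.
  (* A null set of the vector measure has zero variation, hence is Lebesgue null in [0,1] because
     [phi > 0] on (0,1). *)
  apply/(vm_variation0 mS)/eqP; rewrite eq_le; apply/andP; split; last first.
    rewrite (vm_variation_density hX mS); apply: integral_ge0 => t _.
    by rewrite lee_fin phi_ge0.
  apply: ge_ereal_sup => _ [n [F [mF _ FS ->]]]; rewrite lee_fin big1 // => i _.
  have Fi : F i `<=` S by move=> t Ft; rewrite -FS; exists i.
  have := S0 _ (mF i) Fi => /(bfs_eqE hB) h.
  rewrite -(bfs_ae hB (cx_indic hX (mF i)).2 (bfs_measurable hB (bfs_zero hB)) h).2.
  exact: (bfs_norm0 hB).
move=> B mB BS; apply/(bfs_eqE hB); apply: ae01W => t /andP[t0 t1].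
rewrite -(ces0 t); apply: (ae_eq_ces (ltW t1) (nneg_indic mB) (nneg_cst (lexx 0))).
apply: filterS S0 => u h Iu; move: (h Iu); rewrite !indicE.
case: (boolP (u \in B)) => // /set_mem/BS hS.
by rewrite (mem_set hS).
Qed.

Lemma L1_variation_eqP f g : fs_eq (L1_variation X mX) f g <-> ae_eq01 f g.
Proof.
rewrite ae_eq01P; split=> [[S [mS S0 fgS]]|[S [mS S0 fgS]]]; exists S.
  split; [exact: mS|exact/(vm_variation0 mS)|].
  by move=> t It nS; apply: contrapT => fg; apply: nS; apply: fgS => /(_ It).
split; [exact: mS|exact/(vm_variation0 mS)|].
by move=> t /= /not_implyP[It fg]; apply: contrapT => nS; apply: fg; exact: fgS.
Qed.

Lemma L1_vm_eqP f g : fs_eq (L1_vm X mX) f g <-> ae_eq01 f g.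
Proof.
rewrite ae_eq01P; split=> [[S /vm_nullP[mS S0] fgS]|[S [mS S0 fgS]]]; exists S => //.
by apply/vm_nullP.
Qed.

Lemma Iphi_normZ (a : R) f : measurable_fun (@I01 R) f ->
  Iphi X (fun t => `|a * f t|%R) = (`|a|%:E * Iphi X (fun t => `|f t|%R))%E.
Proof.
move=> mf; rewrite -(IphiZ hX (normr_ge0 a) (nneg_abs mf)).
by apply: eq_Iphi => t _; rewrite normrM.
Qed.

Lemma L1_variation_linear (a : R) f g : L1_variation X mX f -> L1_variation X mX g ->
  L1_variation X mX (fun t => a * f t + g t).
Proof.
move=> /L1_variationP[mf jf] /L1_variationP[mg jg].
have ma : measurable_fun (@I01 R) (fun t => a * f t).
  by apply: measurable_funM; [exact: measurable_cst|exact: mf].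
have mfg : measurable_fun (@I01 R) (fun t => a * f t + g t) := measurable_funD ma mg.
apply/L1_variationP; split; first exact: mfg.
have nf := nneg_abs ma; have ng := nneg_abs mg.
apply: le_lt_trans (Iphi_le hX (nneg_abs mfg) (nnegD nf ng) _) _.
  by move=> t _; exact: ler_normD.
rewrite (IphiD hX nf ng) Iphi_normZ //; apply: lte_add_pinfty; last exact: jg.
by apply: lte_mul_pinfty => //; rewrite lee_fin.
Qed.

(** Only the continuity of the inverse at 0 is exploited, made quantitative by
    [homogeneous_bound]. *)
Lemma AL_bound_of_iso : L1_vm_iso_L1_variation X mX -> AL_bound X.
Proof.
move=> iso; have L0 : L1_variation X mX (fun=> 0).
  apply/L1_variationP; split; first exact: measurable_cst.
  rewrite /Iphi integral0_eq ?ltry // => t _; by rewrite normr0 mul0r.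
have [d d0 hd] := oi_inv_continuous iso L0 ltr01.
pose C : set (T -> R^o) := fs_car (L1_variation X mX).
pose q f := N (ces (fun t => `|f t|)).
pose r f := fine (Iphi X (fun t => `|f t|)).
have hb := @homogeneous_bound R (T -> R^o : lmodType R) C q r d d0.
exists (2 / d); first by rewrite divr_ge0 // ltW.
move=> f e M e01 bf; have [nf fM _] := bf.
have If := bsupp_Iphi_fin hX bf e01.
have E t : I01 t -> `|f t| = f t by move=> It; rewrite ger0_norm // (nneg_ge0 nf It).
have Cf : C f.
  apply/L1_variationP; split; first exact: (nneg_meas nf).
  rewrite (eq_Iphi X E) -ge0_fin_numE //; exact: (Iphi_ge0 hX nf).
have cf := cx_bounded hX nf fM.
have <- : r f = fine (Iphi X f) by rewrite /r (eq_Iphi X E).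
have <- : q f = N (ces f) by exact: (cx_eq hX cf (fun t It => esym (E t It))).2.
apply: hb Cf.
- move=> a g a0 Cg; have := L1_variation_linear a Cg L0.
  congr (C _); apply/funext => t; exact: addr0.
- by move=> g /L1_variation_CX/cesaro_spaceP[_ cg]; exact: (bfs_norm_ge0 hB cg.2).
- move=> a g a0 /L1_variation_CX Cg.
  by have [_] := CXZ hX a Cg; rewrite (ger0_norm a0).
- move=> a g a0 /L1_variationP[mg jg].
  rewrite /r -[X in Iphi X]/X (Iphi_normZ a mg) (ger0_norm a0) fineM //.
  by rewrite ge0_fin_numE //; exact: (Iphi_ge0 hX (nneg_abs mg)).
move=> g Cg; have /L1_variationP[mg jg] := Cg.
have E0 : (g - (fun=> 0) : T -> R^o) = g.
  by apply/funext => t; rewrite -[LHS]/(g t - 0) subr0.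
have : fs_norm (L1_vm X mX) g < d -> fs_norm (L1_variation X mX) g < 1.
  by have := hd g Cg; rewrite E0; exact.
by rewrite (L1_vm_norm mg jg) (L1_variation_norm mg); exact.
Qed.

Section AL_bound_L1.
Hypothesis hAL : AL_bound X.

Lemma CX_L1_variation f : CX f <-> L1_variation X mX f.
Proof.
split; last exact: L1_variation_CX.
move=> Cf; apply/L1_variationP; split; first exact: (CX_meas Cf).
by rewrite -(LphiE hX hAL Cf) ltry.
Qed.

Lemma CX_L1_vm f : CX f <-> L1_vm X mX f.
Proof.
split; last exact: vm_integrable_CX.
by move=> /CX_L1_variation/L1_variationP[mf jf]; exact: vm_integrable_of_Iphi.
Qed.

Lemma L1_vm_norm_CX f : CX f -> fs_norm (L1_vm X mX) f = N (cesaro_abs f).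
Proof. by move=> /CX_L1_variation/L1_variationP[mf jf]; exact: L1_vm_norm. Qed.

Lemma fs_same_CX_L1_vm : fs_same CX (L1_vm X mX).
Proof.
split.
- by apply/funext => f; apply/propext; exact: CX_L1_vm.
- by move=> f g _ _; rewrite (L1_vm_eqP f g).
- by move=> f Cf; rewrite (L1_vm_norm_CX Cf).
Qed.

Lemma CX_sub f g : CX f -> CX g -> CX (f - g : T -> R^o).
Proof.
move=> Cf Cg; have := CXD hX Cf (CXN hX Cg).
by congr (fs_car CX _).
Qed.

Lemma iso_of_AL_bound : L1_vm_iso_L1_variation X mX.
Proof.
have [K K0 hK] := AL_bound_cx hX hAL.
have normE f : CX f -> [/\ fs_norm (L1_vm X mX) f = N (cesaro_abs f),
    fs_norm (L1_variation X mX) f = Lphi X f, N (cesaro_abs f) <= Lphi X f &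
    Lphi X f <= K * N (cesaro_abs f)].
  move=> Cf; split; first exact: L1_vm_norm_CX.
  - exact: (L1_variation_norm (CX_meas Cf)).
  - exact: (norm_le_Lphi hX hAL Cf).
  - rewrite -lee_fin (LphiE hX hAL Cf); apply: hK.
    by have /cesaro_spaceP[] := Cf.
have aeR f : fs_eq (L1_vm X mX) f f by apply/L1_vm_eqP; exact: aeW.
split.
- by move=> f /CX_L1_variation/CX_L1_vm.
- move=> f g _ _; apply: iff_trans (L1_vm_eqP f g) _.
  exact: iff_sym (L1_variation_eqP f g).
- move=> f /CX_L1_vm/CX_L1_variation Lf; exists f; [exact: Lf|exact: aeR].
- by move=> a f g _ _; exact: aeR.
- by move=> f g _ _; exact: aeR.
- by move=> f g _ _; exact: aeR.
(* The inclusion is a contraction, and its inverse has constant [K]. *)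
- move=> f /CX_L1_variation Cf e e0; exists e => // g /CX_L1_variation Cg.
  have [h1 h2 h3 _] := normE _ (CX_sub Cg Cf).
  move=> h0; have h : fs_norm (L1_variation X mX) (g - f) < e := h0.
  rewrite h2 in h.
  suff h' : fs_norm (L1_vm X mX) (g - f) < e by exact: h'.
  by rewrite h1; exact: le_lt_trans h3 h.
move=> f /CX_L1_variation Cf e e0.
have K1 : 0 < K + 1 by rewrite ltr_wpDl.
exists (e / (K + 1)); first by rewrite divr_gt0.
move=> g /CX_L1_variation Cg; have Cd := CX_sub Cg Cf.
have [h1 h2 _ h4] := normE _ Cd.
move=> h0; have h : fs_norm (L1_vm X mX) (g - f) < e / (K + 1) := h0.
rewrite h1 in h.
suff h' : fs_norm (L1_variation X mX) (g - f) < e by exact: h'.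
rewrite h2; apply: le_lt_trans h4 _.
apply: (@le_lt_trans _ _ ((K + 1) * N (cesaro_abs (g - f)))).
  by apply: ler_wpM2r; [exact: (CX_norm_ge0 hX Cd)|rewrite lerDl].
by rewrite mulrC -ltr_pdivlMr.
Qed.

End AL_bound_L1.

End L1_spaces.

Theorem proposition3p5 (R : realType) (X : funspace R)
    (hX : is_ri X) (hXinf : fs_car X <> Linfty01 R) :
  let CX := cesaro_space X in
  let mX := cesaro_vm R in
  let a := order_isomorphic_to_AL (nl_of_fun CX) in
  let b := L1_vm_iso_L1_variation X mX in
  let c := associate CX (fun y => fs_norm X (Fy y)) in
  [/\ a <-> b, b <-> c &
      a \/ b \/ c ->
      fs_same CX (L1_vm X mX) /\ L1_vm_iso_L1_variation X mX].
Proof.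
move=> CX mX a b c.
have ha : a <-> AL_bound X.
  by split; [exact: AL_bound_necessary|exact: AL_bound_sufficient].
have hb : b <-> AL_bound X.
  by split; [exact: AL_bound_of_iso|exact: iso_of_AL_bound].
have hc : AL_bound X <-> c by exact: AL_boundP.
split; first exact: iff_trans ha (iff_sym hb).
- exact: iff_trans hb hc.
move=> h; have hAL : AL_bound X by case: h => [/ha|[/hb|/hc]].
by split; [exact: fs_same_CX_L1_vm|exact: iso_of_AL_bound].
Qed.
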